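(* Let $G$ be a discrete group such that $C^*_{\max}(G)$ has the local lifting property. Then for any $G$-$C^*$-algebra $A$, $A\rtimes_{\mathrm{inj}}G=A\rtimes_rG$, i.e. $\|\cdot\|_{\mathrm{inj}}=\|\cdot\|_r$ on $C_c(G,A)$.
   Context: A $C^*$-algebra $D$ has the local lifting property (LLP) if for every Hilbert space $H$ one has $D\otimes\mathcal{B}(H)=D\otimes_{\max}\mathcal{B}(H)$ ($\otimes$ being the minimal tensor product), i.e. there is a unique $C^*$-norm on the algebraic tensor product $D\odot\mathcal{B}(H)$. $C^*_{\max}(G)$ is the maximal group $C^*$-algebra of $G$. A $G$-$C^*$-algebra is a $C^*$-algebra $A$ with an action of $G$ by automorphisms. $C_c(G,A)$ carries its usual convolution $*$-algebra structure; $A\rtimes_{\max}G$ and $A\rtimes_rG$ are its maximal and reduced $C^*$-completions, the latter with norm $\|\cdot\|_r$. For an equivariant injective $*$-homomorphism $\iota:A\to B$ of $G$-$C^*$-algebras, put $\|a\|_\iota:=\|(\iota\rtimes G)(a)\|_{B\rtimes_{\max}G}$ for $a\in C_c(G,A)$, where $(\iota\rtimes G)(f)=\iota\circ f$. The injective norm on $C_c(G,A)$ is $\|a\|_{\mathrm{inj}}:=\inf\{\|a\|_\iota : \iota:A\to B\text{ an equivariant injective }*\text{-homomorphism}\}$, and $A\rtimes_{\mathrm{inj}}G$ is the corresponding completion of $C_c(G,A)$. *)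

(* Defs.v *)
From HB Require Import structures.
From mathcomp Require Import all_boot all_order all_algebra.
From mathcomp Require Import complex.
From mathcomp Require Import all_classical all_reals all_analysis.
From mathcomp Require Import ring lra.
Set Implicit Arguments.
Unset Strict Implicit.
Unset Printing Implicit Defensive.
Import Order.TTheory GRing.Theory Num.Theory.
Import numFieldNormedType.Exports.
Local Open Scope classical_set_scope.
Local Open Scope complex_scope.
Local Open Scope ring_scope.

(* The library norm of a complex normed module is R[i]-valued. *)
Definition rnorm (R : realType) (V : normedModType R[i]) (x : V) : R :=
  complex.Re `|x|.

(* Complex *-algebras, possibly without a unit. *)
HB.mixin Record Lmodule_isStarAlgebra (R : realType) A
    of GRing.Lmodule R[i] A := {
  smul : A -> A -> A ;
  star : A -> A ;
  smulA : associative smul ;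
  smulDl : left_distributive smul +%R ;
  smulDr : right_distributive smul +%R ;
  smulZl : forall (c : R[i]) x y, smul (c *: x) y = c *: smul x y ;
  smulZr : forall (c : R[i]) x y, smul x (c *: y) = c *: smul x y ;
  starK : involutive star ;
  starD : {morph star : x y / x + y} ;
  starZ : forall (c : R[i]) x, star (c *: x) = c^* *: star x ;
  starM : forall x y, star (smul x y) = smul (star y) (star x)
}.

#[short(type="starAlgType")]
HB.structure Definition StarAlgebra (R : realType) :=
  {A of GRing.Lmodule R[i] A & Lmodule_isStarAlgebra R A}.

HB.mixin Record StarAlgebra_isCStar (R : realType) A
    of CompleteNormedModule R[i] A & StarAlgebra R A := {
  norm_smul : forall x y : A, `|smul x y| <= `|x| * `|y| ;
  norm_star_smul : forall x : A, `|smul (star x) x| = `|x| ^+ 2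
}.

#[short(type="cstarAlgType")]
HB.structure Definition CStarAlgebra (R : realType) :=
  {A of CompleteNormedModule R[i] A & StarAlgebra R A
      & StarAlgebra_isCStar R A}.

HB.mixin Record StarAlgebra_hasAction (G : groupType) (R : realType) A
    of StarAlgebra R A := {
  act : G -> A -> A ;
  act1 : forall x, act 1%g x = x ;
  actM : forall (g h : G) x, act (g * h)%g x = act g (act h x) ;
  actD : forall g, {morph act g : x y / x + y} ;
  actZ : forall g (c : R[i]) x, act g (c *: x) = c *: act g x ;
  act_smul : forall g x y, act g (smul x y) = smul (act g x) (act g y) ;
  act_star : forall g x, act g (star x) = star (act g x)
}.

#[short(type="gStarAlgType")]
HB.structure Definition GStarAlgebra (G : groupType) (R : realType) :=
  {A of StarAlgebra R A & StarAlgebra_hasAction G R A}.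

#[short(type="gCstarAlgType")]
HB.structure Definition GCStarAlgebra (G : groupType) (R : realType) :=
  {A of CStarAlgebra R A & StarAlgebra_hasAction G R A}.

Definition star_hom (R : realType) (A B : starAlgType R)
    (f : {linear A -> B}) : Prop :=
  (forall x y, f (smul x y) = smul (f x) (f y)) /\
  (forall x, f (star x) = star (f x)).

Definition cstar_norm (R : realType) (A : starAlgType R) (N : A -> R) : Prop :=
  [/\ forall x y, N (x + y) <= N x + N y,
      forall (c : R[i]) x, N (c *: x) = complex.Re `|c| * N x,
      forall x, N x = 0 -> x = 0,
      forall x y, N (smul x y) <= N x * N y
    & forall x, N (smul (star x) x) = N x ^+ 2].

(* The inner product is linear in its first argument. *)
HB.mixin Record CompleteNormedModule_isHilbert (R : realType) H
    of CompleteNormedModule R[i] H := {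
  dot : H -> H -> R[i] ;
  dotDl : forall x y z, dot (x + y) z = dot x z + dot y z ;
  dotZl : forall (c : R[i]) x y, dot (c *: x) y = c * dot x y ;
  dotC : forall x y, dot y x = (dot x y)^* ;
  dot_norm : forall x, dot x x = `|x| ^+ 2
}.

#[short(type="hilbertType")]
HB.structure Definition Hilbert (R : realType) :=
  {H of CompleteNormedModule R[i] H & CompleteNormedModule_isHilbert R H}.

(* The complex numbers, with the trivial action of G. *)
Section ComplexStarAlgebra.
Variable R : realType.

HB.instance Definition _ := Lmodule_isStarAlgebra.Build R R[i]
  (@mulrA R[i]) (@mulrDl R[i]) (@mulrDr R[i])
  (fun c x y : R[i] => esym (mulrA c x y))
  (fun c x y : R[i] => mulrCA x c y)
  (@conjCK R[i]) (@raddfD _ _ Num.conj) (fun c x : R[i] => rmorphM Num.conj c x)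
  (fun x y : R[i] => etrans (rmorphM Num.conj x y) (mulrC _ _)).

Let triv_act (G : groupType) (_ : G) (x : R[i]) : R[i] := x.

HB.instance Definition _ (G : groupType) :=
  @StarAlgebra_hasAction.Build G R R[i] (@triv_act G)
  (fun=> erefl) (fun _ _ _ => erefl) (fun _ _ _ => erefl)
  (fun _ _ _ => erefl) (fun _ _ _ => erefl) (fun _ _ => erefl).

End ComplexStarAlgebra.

Section HilbertTheory.
Variables (R : realType) (H : hilbertType R).
Implicit Types (x y z w : H) (c : R[i]).

Let rdot x y : R := complex.Re (dot x y).

Lemma rnorm_ge0 (V : normedModType R[i]) (v : V) : 0 <= rnorm v.
Proof. by have := normr_ge0 v; rewrite lecE => /andP[_]. Qed.

Lemma rnormE (V : normedModType R[i]) (v : V) : `|v| = (rnorm v)%:C.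
Proof. by rewrite /rnorm RRe_real. Qed.

Lemma dotDr x y z : dot x (y + z) = dot x y + dot x z.
Proof. by rewrite dotC dotDl rmorphD/= -!dotC. Qed.

Lemma dotZr c x y : dot x (c *: y) = c^* * dot x y.
Proof. by rewrite dotC dotZl rmorphM/= -dotC. Qed.

Let rdotDl x y z : rdot (x + y) z = rdot x z + rdot y z.
Proof. by rewrite /rdot dotDl raddfD. Qed.

Let rdotC x y : rdot x y = rdot y x.
Proof. by rewrite /rdot [in RHS]dotC; case: (dot x y). Qed.

Let rdotDr x y z : rdot x (y + z) = rdot x y + rdot x z.
Proof. by rewrite /rdot dotDr raddfD. Qed.

Let rdotZl (r : R) x y : rdot (r%:C *: x) y = r * rdot x y.
Proof. by rewrite /rdot dotZl; case: (dot x y) => a b/=; rewrite mul0r subr0. Qed.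

Let rdotZr (r : R) x y : rdot x (r%:C *: y) = r * rdot x y.
Proof. by rewrite rdotC rdotZl rdotC. Qed.

Let rdotN x y : rdot (- x) y = - rdot x y.
Proof. by rewrite -scaleN1r -(rmorphN1 (real_complex R)) rdotZl mulN1r. Qed.

Let rdotxx x : rdot x x = rnorm x ^+ 2.
Proof. by rewrite /rdot dot_norm rnormE -rmorphXn. Qed.

Let quad_le (e b n : R) : 0 <= n -> 0 <= e ->
  (forall t, 0 <= e ^+ 2 + t * b *+ 2 + t ^+ 2 * n ^+ 2) -> `|b| <= e * n.
Proof.
move=> n0 e0 Q; have [n00|nn0] := eqVneq n 0.
  rewrite n00 mulr0 normr_le0; apply/eqP; apply: contrapT => /eqP b0.
  have := Q (- (e ^+ 2 + 1) / b).
  by rewrite mulfVK// n00 expr0n mulr0 addr0; nra.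
have np : 0 < n by rewrite lt_neqAle eq_sym nn0.
rewrite -(@ler_pXn2r _ 2) ?nnegrE ?mulr_ge0// real_normK ?num_real// exprMn.
have := Q (- b / n ^+ 2).
rewrite [X in 0 <= X](_ : _ = e ^+ 2 - b ^+ 2 / n ^+ 2); last by field.
by rewrite subr_ge0 ler_pdivrMr ?exprn_gt0.
Qed.

Let rnormD_sq x y (t : R) :
  rnorm (x + t%:C *: y) ^+ 2 =
  rnorm x ^+ 2 + t * rdot x y *+ 2 + t ^+ 2 * rnorm y ^+ 2.
Proof.
by rewrite -!rdotxx !(rdotDl, rdotDr, rdotZl, rdotZr) (rdotC y x); ring.
Qed.

Let rcauchy_schwarz x y : `|rdot x y| <= rnorm x * rnorm y.
Proof.
by apply: quad_le => [||t]; rewrite ?rnorm_ge0// -rnormD_sq exprn_ge0 ?rnorm_ge0.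
Qed.

Let dot_eq (u v : R[i]) : (forall k : R[i],
  complex.Re (k * u) = complex.Re (k * v)) -> u = v.
Proof.
move=> E; have := E 1; have := E 'i; rewrite !mul1r.
case: u {E} => a b; case: v => a' b' /=; rewrite !(mul0r, mul1r, sub0r).
by move=> /oppr_inj -> ->.
Qed.

Lemma cauchy_schwarz x y : `|dot x y| <= `|x| * `|y|.
Proof.
have [->|d0] := eqVneq (dot x y) 0; first by rewrite normr0 mulr_ge0// ler0c normr_ge0.
pose k := (dot x y)^* / `|dot x y|.
have nk : `|k| = 1.
  by rewrite normrM normfV normr_id norm_conjC divff// normr_eq0.
have kd : k * dot x y = `|dot x y|.
  by rewrite /k mulrAC -[_^* * _]mulrC -normCK expr2 mulfK// normr_eq0.
have := rcauchy_schwarz (k *: x) y; rewrite /rdot dotZl kd.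
rewrite -lecR; set a := complex.Re _; have a0 : 0 <= a.
  by have := normr_ge0 (dot x y); rewrite lecE => /andP[].
rewrite ger0_norm// /a RRe_real ?normr_real// => /le_trans; apply.
by rewrite rmorphM/= -!rnormE normrZ nk mul1r.
Qed.

(* Riesz representation, from which adjoints are obtained. *)
Lemma riesz (phi : H -> R[i]) (M : R) : scalar phi ->
  (forall x, `|phi x| <= M%:C * `|x|) ->
  exists z, forall x, phi x = dot x z.
Proof.
move=> lphi bphi.
have phiD x y : phi (x + y) = phi x + phi y.
  by rewrite -[x]scale1r lphi mul1r scale1r.
have phi0 : phi 0 = 0.
  by apply: (addrI (phi 0)); rewrite -phiD !addr0.
have phiZ c x : phi (c *: x) = c * phi x.
  by rewrite -[c *: x]addr0 lphi phi0 addr0.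
pose rp x := complex.Re (phi x).
have rpD x y : rp (x + y) = rp x + rp y by rewrite /rp phiD raddfD.
have rpZ (t : R) x : rp (t%:C *: x) = t * rp x.
  by rewrite /rp phiZ; case: (phi x) => a b/=; rewrite mul0r subr0.
have brp x : `|rp x| <= M * rnorm x.
  rewrite -lecR rmorphM/= -rnormE; apply: le_trans (bphi x).
  exact: normc_ge_Re.
pose J z := rnorm z ^+ 2 - rp z *+ 2.
have JE z (t : R) w : J (z + t%:C *: w) =
    J z + t * (rdot z w - rp w) *+ 2 + t ^+ 2 * rnorm w ^+ 2.
  by rewrite /J rnormD_sq rpD rpZ; ring.
have Jlb z : - M ^+ 2 <= J z.
  have := le_trans (ler_norm (rp z)) (brp z); have := sqr_ge0 (rnorm z - M).
  by rewrite /J !expr2; lra.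
have hi : has_inf [set J z | z in setT].
  split; first by exists (J 0), 0.
  by exists (- M ^+ 2) => _ [z _ <-].
pose m := inf [set J z | z in setT].
have Jm z : m <= J z by apply: ge_inf; [case: hi|exists z].
have /choice[u uP] : forall n : nat, exists z, J z <= m + (n.+1%:R^-1) ^+ 2.
  move=> n; have e0 : 0 < (n.+1%:R^-1 : R) ^+ 2 by rewrite exprn_gt0// invr_gt0.
  by have [_ [z _ <-] /ltW] := inf_adherent e0 hi; exists z.
have uB n w : `|rdot (u n) w - rp w| <= n.+1%:R^-1 * rnorm w.
  apply: quad_le; rewrite ?rnorm_ge0 ?invr_ge0// => t.
  have := Jm (u n + t%:C *: w); rewrite JE.
  by move=> /le_trans/(_ (lerD (lerD (uP n) (lexx _)) (lexx _))); rewrite -!addrA lerDl.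
have uC n k : rnorm (u n - u k) <= n.+1%:R^-1 + k.+1%:R^-1.
  have := rdotxx (u n - u k); rewrite {1}rdotDl rdotN => ab.
  have n0 : (0 : R) <= n.+1%:R^-1 by rewrite invr_ge0.
  have k0 : (0 : R) <= k.+1%:R^-1 by rewrite invr_ge0.
  have [->|pn0] := eqVneq (rnorm (u n - u k)) 0; first exact: addr_ge0.
  have pp : 0 < rnorm (u n - u k) by rewrite lt_neqAle eq_sym pn0 rnorm_ge0.
  rewrite -(ler_pM2r pp) -expr2 -ab mulrDl; have := uB k (u n - u k).
  rewrite distrC; move=> /(le_trans (ler_norm _)) h1.
  have /(le_trans (ler_norm _)) h2 := uB n (u n - u k).
  apply: le_trans (lerD h2 h1); rewrite le_eqVlt; apply/orP; left; apply/eqP.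
  by ring.
have cu : cvgn u.
  apply: cauchy_cvg; apply/cauchy_ballP => e e0.
  have er : e = (complex.Re e)%:C by rewrite RRe_real// gtr0_real.
  have re0 : 0 < complex.Re e by rewrite -ltcR -er.
  have [N _ NP] : \forall n \near \oo, (n.+1%:R^-1 : R) < complex.Re e / 2.
    by apply: near_infty_natSinv_lt (PosNum _); rewrite divr_gt0.
  exists (u @` [set n | (N <= n)%N], u @` [set n | (N <= n)%N]) => /=.
    by split; exists N => // n /= Nn; exists n.
  move=> [_ _] [/= [n /= Nn <-] [k /= Nk <-]].
  rewrite -ball_normE/= rnormE er ltcR (le_lt_trans (uC n k))//.
  by rewrite [ltRHS]splitr ltrD//; [exact: NP Nn|exact: NP Nk].
pose z := lim (u @ \oo).
have lz w : rdot z w = rp w.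
  apply: contrapT => /eqP; rewrite -subr_eq0 -normr_gt0 => d0.
  set d := `|_| in d0.
  pose e := d / (rnorm w + 1) / 2.
  have w1 : 0 < rnorm w + 1 by rewrite ltr_pwDr ?rnorm_ge0.
  have e0 : 0 < e by rewrite !divr_gt0.
  have [n [h1 h2]] : exists n, rnorm (z - u n) < e /\ (n.+1%:R^-1 : R) < e.
    have : \forall n \near \oo, `|z - u n| < e%:C.
      by move/cvgrPdist_lt : cu; apply; rewrite ltcR.
    move=> h1.
    have h2 : \forall n \near \oo, (n.+1%:R^-1 : R) < e.
      exact: near_infty_natSinv_lt (PosNum e0).
    have [n [n1 n2]] := filter_ex (filterI h1 h2).
    by exists n; split => //; rewrite -ltcR -rnormE.
  have : d <= e * rnorm w + e * rnorm w.
    have -> : d = `|rdot (z - u n) w + (rdot (u n) w - rp w)|.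
      by rewrite /d rdotDl rdotN; congr `|_|; ring.
    rewrite (le_trans (ler_normD _ _))// lerD//.
      by rewrite (le_trans (rcauchy_schwarz _ _))// ler_wpM2r ?rnorm_ge0 ?ltW.
    by rewrite (le_trans (uB _ _))// ler_wpM2r ?rnorm_ge0 ?ltW.
  suff : e * rnorm w + e * rnorm w < d by lra.
  have de : d = e * (rnorm w + 1) * 2 by rewrite /e; field; exact: lt0r_neq0.
  by rewrite de; nra.
exists z => x; apply: dot_eq => c.
by rewrite -phiZ -dotZl -[LHS]/(rp _) -lz rdotC.
Qed.

End HilbertTheory.

Section BoundedOperators.
Variables (R : realType) (H : hilbertType R).

Definition bounded_op : {pred H -> H} := fun T =>
  `[< linear T /\ exists M : R, forall x, `|T x| <= M%:C * `|x| >].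

Lemma bounded_op_submod : submod_closed bounded_op.
Proof.
split; first by apply/asboolP; split=> [c x y|];
  [rewrite /= scaler0 addr0|exists 0 => x; rewrite normr0 mul0r].
move=> c S T /asboolP[lS [M SM]] /asboolP[lT [N TN]]; apply/asboolP; split.
  move=> a x y /=; rewrite -[LHS]/(c *: S _ + T _) -[RHS]/(_ *: (c *: S _ + T _) + (c *: S _ + T _)).
  rewrite lS lT !scalerDr !scalerA (mulrC a) -!addrA; congr (_ + _).
  by rewrite addrCA.
have [r cr] : exists r, `|c| = r%:C.
  by exists (complex.Re `|c|); rewrite RRe_real ?normr_real.
exists (r * M + N) => x.
rewrite -[X in `|X|]/(c *: S _ + T _) (le_trans (ler_normD _ _))//.
rewrite normrZ cr rmorphD rmorphM mulrDl lerD//.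
by rewrite -mulrA ler_wpM2l// -cr.
Qed.

HB.instance Definition _ :=
  GRing.isSubmodClosed.Build R[i] (H -> H) bounded_op bounded_op_submod.

Record bop := Bop { bop_fun :> H -> H ; _ : bop_fun \in bounded_op }.

HB.instance Definition _ := [isSub for bop_fun].
HB.instance Definition _ := [Choice of bop by <:].
HB.instance Definition _ := [SubChoice_isSubLmodule of bop by <:].

Implicit Types (S T : bop) (x y : H).

Lemma bop_linear T : linear T.
Proof. by case: T => T /= /asboolP[]. Qed.

HB.instance Definition _ T :=
  GRing.isLinear.Build R[i] H H *:%R (bop_fun T) (bop_linear T).

Lemma bop_bounded T : exists M : R, forall x, `|T x| <= M%:C * `|x|.
Proof. by case: T => T /= /asboolP[]. Qed.

Lemma bopP S T : (forall x, S x = T x) -> S = T.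
Proof. by move=> E; apply/val_inj/funext. Qed.

Lemma bopDE S T x : (S + T) x = S x + T x. Proof. by []. Qed.
Lemma bopZE (c : R[i]) T x : (c *: T) x = c *: T x. Proof. by []. Qed.

Lemma bop_comp_subproof S T : S \o T \in bounded_op.
Proof.
apply/asboolP; split=> [c x y|]; first by rewrite /= !linearP.
have [M SM] := bop_bounded S; have [N TN] := bop_bounded T.
exists (`|M| * N) => x /=; rewrite (le_trans (SM _))// rmorphM -mulrA.
rewrite (@le_trans _ _ (`|M|%:C * `|T x|))//.
  by rewrite ler_wpM2r// lecR ler_norm.
by rewrite ler_wpM2l// ler0c.
Qed.

Definition bop_comp S T : bop := Bop (bop_comp_subproof S T).

Lemma dot_inj (u v : H) : (forall x, dot x u = dot x v) -> u = v.
Proof.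
move=> E; apply/eqP; rewrite -subr_eq0 -normr_eq0 -sqrf_eq0.
by rewrite -dot_norm -scaleN1r dotDr dotZr rmorphN1 mulN1r E subrr.
Qed.

Lemma bop_adj_subproof T : exists T' : bop, forall x y, dot (T x) y = dot x (T' y).
Proof.
have [M TM] := bop_bounded T; pose M' := `|M|.
have TM' x : `|T x| <= M'%:C * `|x|.
  by rewrite (le_trans (TM x))// ler_wpM2r// lecR ler_norm.
have /choice[f fP] y : exists z, forall x, dot (T x) y = dot x z.
  apply: (@riesz R H (fun x => dot (T x) y) (M' * rnorm y)).
    by move=> c u v /=; rewrite linearP dotDl dotZl.
  move=> x; rewrite (le_trans (cauchy_schwarz _ _))// rmorphM/= mulrAC -rnormE.
  by rewrite ler_wpM2r.
have lf : linear f.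
  move=> c u v; apply: dot_inj => x.
  by rewrite -fP !(dotDr, dotZr) !fP.
have bf x : `|f x| <= M'%:C * `|x|.
  have [->|fx0] := eqVneq (f x) 0; first by rewrite normr0 mulr_ge0// ler0c normr_ge0.
  rewrite -(@ler_pM2l _ `|f x|) ?normr_gt0// -expr2 -dot_norm.
  have -> : dot (f x) (f x) = `|dot (T (f x)) x|.
    by rewrite fP dot_norm ger0_norm// exprn_ge0.
  rewrite (le_trans (cauchy_schwarz _ _))// mulrCA mulrA ler_wpM2r//.
have f_op : f \in bounded_op by apply/asboolP; split => //; exists M'.
by exists (Bop f_op).
Qed.

Definition adj T : bop := projT1 (cid (bop_adj_subproof T)).

Lemma adjP T x y : dot (T x) y = dot x (adj T y).
Proof. by rewrite /adj; case: cid. Qed.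

Lemma adj_uniq S T : (forall x y, dot (T x) y = dot x (S y)) -> adj T = S.
Proof. by move=> E; apply: bopP => y; apply: dot_inj => x; rewrite -adjP. Qed.

Lemma adjPr T x y : dot x (T y) = dot (adj T x) y.
Proof. by rewrite dotC adjP -dotC. Qed.

Lemma bop_compA : associative bop_comp.
Proof. by move=> S T U; apply: bopP. Qed.
Lemma bop_compDl : left_distributive bop_comp +%R.
Proof. by move=> S T U; apply: bopP. Qed.
Lemma bop_compDr : right_distributive bop_comp +%R.
Proof. by move=> S T U; apply: bopP => x; apply: (linearD S). Qed.
Lemma bop_compZl (c : R[i]) S T : bop_comp (c *: S) T = c *: bop_comp S T.
Proof. exact: bopP. Qed.
Lemma bop_compZr (c : R[i]) S T : bop_comp S (c *: T) = c *: bop_comp S T.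
Proof. by apply: bopP => x; rewrite bopZE /= linearZ. Qed.
Lemma adjK : involutive adj.
Proof. by move=> T; apply: adj_uniq => x y; rewrite -adjPr. Qed.
Lemma adjD : {morph adj : S T / S + T}.
Proof.
by move=> S T; apply: adj_uniq => x y; rewrite !bopDE dotDl dotDr !adjP.
Qed.
Lemma adjZ (c : R[i]) T : adj (c *: T) = c^* *: adj T.
Proof. by apply: adj_uniq => x y; rewrite !bopZE dotZl dotZr conjCK adjP. Qed.
Lemma adjM S T : adj (bop_comp S T) = bop_comp (adj T) (adj S).
Proof. by apply: adj_uniq => x y /=; rewrite !adjP. Qed.

HB.instance Definition _ := Lmodule_isStarAlgebra.Build R bop
  bop_compA bop_compDl bop_compDr bop_compZl bop_compZr adjK adjD adjZ adjM.

Definition opnorm T : R := sup [set rnorm (T x) | x in [set x | rnorm x <= 1]].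

End BoundedOperators.

Section StarAlgebraTheory.
Variables (R : realType) (A : starAlgType R).
Implicit Types x y : A.

Lemma smul0l x : smul 0 x = 0.
Proof. by rewrite -(scale0r (0 : A)) smulZl !scale0r. Qed.
Lemma smul0r x : smul x 0 = 0.
Proof. by rewrite -(scale0r (0 : A)) smulZr !scale0r. Qed.
Lemma star0 : star (0 : A) = 0.
Proof. by rewrite -(scale0r (0 : A)) starZ conjC0 !scale0r. Qed.

Lemma act0 (G : groupType) (B : gStarAlgType G R) (g : G) : act g (0 : B) = 0.
Proof. by rewrite -(scale0r (0 : B)) actZ !scale0r. Qed.

End StarAlgebraTheory.

Section FiniteSums.
Variables (I : choiceType) (V W : zmodType).
Implicit Types (X : set I) (F : I -> V).

Lemma fsum_setT X F : (forall i, ~ X i -> F i = 0) ->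
  \sum_(i \in setT) F i = \sum_(i \in X) F i.
Proof. by move=> F0; apply/esym/fsbig_widen => // i [_ /F0]. Qed.

Lemma fsumD X F F' : finite_set X ->
  \sum_(i \in X) (F i + F' i) = \sum_(i \in X) F i + \sum_(i \in X) F' i.
Proof. by move=> fX; rewrite !fsbig_finite//= big_split. Qed.

Lemma raddf_fsum (phi : V -> W) X F : finite_set X ->
  {morph phi : x y / x + y} -> phi 0 = 0 ->
  phi (\sum_(i \in X) F i) = \sum_(i \in X) phi (F i).
Proof. by move=> fX pD p0; rewrite !fsbig_finite//= (big_morph phi pD p0). Qed.

End FiniteSums.

Section ConvolutionAlgebra.
Variables (R : realType) (G : groupType) (A : gStarAlgType G R).

Definition finsupp : {pred G -> A} := fun f =>
  `[< finite_set [set g | f g != 0] >].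

Lemma finsupp_submod : submod_closed finsupp.
Proof.
split; first by apply/asboolP; rewrite (_ : [set g | _] = set0)//;
  apply/seteqP; split=> // g /=; rewrite eqxx.
move=> c f g /asboolP ff /asboolP fg; apply/asboolP.
apply: sub_finite_set (_ : _ `<=` [set h | f h != 0] `|` [set h | g h != 0]) _.
  move=> h /=; rewrite -[_ h]/(c *: f h + g h).
  have [->|fh _] := eqVneq (f h) 0; last by left.
  by rewrite scaler0 add0r; right.
by rewrite finite_setU.
Qed.

HB.instance Definition _ :=
  GRing.isSubmodClosed.Build R[i] (G -> A) finsupp finsupp_submod.

Record Cc := MkCc { Cc_fun :> G -> A ; _ : Cc_fun \in finsupp }.

HB.instance Definition _ := [isSub for Cc_fun].
HB.instance Definition _ := [Choice of Cc by <:].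
HB.instance Definition _ := [SubChoice_isSubLmodule of Cc by <:].

Implicit Types (f g h : Cc) (s t r : G).

Let supp f : set G := [set t | f t != 0].

Lemma Cc_finsupp f : finite_set [set t | f t != 0].
Proof. by case: f => f /= /asboolP. Qed.

Lemma CcP f g : (forall t, f t = g t) -> f = g.
Proof. by move=> E; apply/val_inj/funext. Qed.

Lemma CcDE f g t : (f + g) t = f t + g t. Proof. by []. Qed.
Lemma CcZE (c : R[i]) f t : (c *: f) t = c *: f t. Proof. by []. Qed.

Let out f t : ~ supp f t -> f t = 0.
Proof. by move=> /negP; rewrite negbK => /eqP. Qed.

Let conv f g (t : G) : A :=
  \sum_(s \in setT) smul (f s) (act s (g (s^-1 * t)%g)).

Let convE f g t (X : set G) : supp f `<=` X ->
  conv f g t = \sum_(s \in X) smul (f s) (act s (g (s^-1 * t)%g)).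
Proof.
by move=> fX; apply: fsum_setT => s Xs; rewrite out ?smul0l// => /fX.
Qed.

Let suppM f g : set G := [set (s * t)%g | s in supp f & t in supp g].

Let conv_out f g t : ~ suppM f g t -> conv f g t = 0.
Proof.
move=> nt; apply: fsbig1 => s _.
have [fs|/out ->] := pselect (supp f s); last by rewrite smul0l.
rewrite (out (f := g)) ?act0 ?smul0r// => gs; apply: nt.
by exists s => //; exists (s^-1 * t)%g => //; rewrite mulVKg.
Qed.

Let fin_suppM f g : finite_set (suppM f g).
Proof. by apply: finite_image2; exact: Cc_finsupp. Qed.

Lemma conv_subproof f g : conv f g \in finsupp.
Proof.
apply/asboolP; apply: sub_finite_set (fin_suppM f g) => t /= /eqP h.
by apply: contrapT => /conv_out.
Qed.

(* (f * g)(t) = \sum_s f(s) s.g(s^-1 t) and f^*(t) = t.(f(t^-1)^* ) *)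
Definition Cc_mul f g : Cc := MkCc (conv_subproof f g).

Lemma Cc_star_subproof f :
  (fun t => act t (star (f t^-1%g))) \in finsupp.
Proof.
apply/asboolP; apply: sub_finite_set (finite_image (fun t => t^-1)%g (Cc_finsupp f)).
move=> t /= /eqP h; exists t^-1%g; last by rewrite invgK.
by apply/eqP => f0; apply: h; rewrite f0 star0 act0.
Qed.

Definition Cc_star f : Cc := MkCc (Cc_star_subproof f).

Lemma Cc_mulE f g t :
  Cc_mul f g t = \sum_(s \in setT) smul (f s) (act s (g (s^-1 * t)%g)).
Proof. by []. Qed.

Lemma Cc_mulA : associative Cc_mul.
Proof.
move=> f g h; apply: CcP => t.
rewrite -[LHS]/(conv _ _ _) -[RHS]/(conv _ _ _).
pose X := supp f; pose Y := suppM f g.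
have fX : finite_set X by exact: Cc_finsupp.
have fY : finite_set Y by exact: fin_suppM.
have YP : supp (Cc_mul f g) `<=` Y.
  by move=> s /eqP ss; apply: contrapT => /conv_out.
rewrite (@convE f _ t X)// (@convE (Cc_mul f g) h t Y)//.
transitivity (\sum_(s \in X) \sum_(r \in Y)
  smul (smul (f s) (act s (g (s^-1 * r)%g))) (act r (h (r^-1 * t)%g))); last first.
  rewrite exchange_fsbig//; apply: eq_fsbigr => r _.
  rewrite -[Cc_mul f g r]/(conv f g r) (@convE f g r X)//.
  rewrite (raddf_fsum (phi := fun x => smul x _))// ?smul0l// => x y.
  exact: smulDl.
apply: eq_fsbigr => s; rewrite inE => Xs.
rewrite -[Cc_mul g h _]/(conv g h _) /conv.
rewrite (@reindex_fsbigT _ _ _ _ _ (fun r => s^-1 * r)%g); last first.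
  by exists (fun r => s * r)%g => r; rewrite ?mulVKg ?mulKg.
rewrite (@fsum_setT _ _ Y); last first.
  move=> r nYr; rewrite (out (f := g)) ?smul0l// => gr; apply: nYr.
  by exists s => //; exists (s^-1 * r)%g => //; rewrite mulVKg.
rewrite (raddf_fsum (phi := fun x => smul (f s) (act s x)))//; last 2 first.
- by move=> x y; rewrite actD smulDr.
- by rewrite act0 smul0r.
apply: eq_fsbigr => r _; rewrite act_smul -actM mulVKg smulA.
by rewrite invgM invgK -mulgA mulVKg.
Qed.

Lemma Cc_mulDl : left_distributive Cc_mul +%R.
Proof.
move=> f g h; apply: CcP => t; rewrite CcDE.
have fX : finite_set (supp f `|` supp g) by rewrite finite_setU; split; exact: Cc_finsupp.
have E k : supp k `<=` supp f `|` supp g -> Cc_mul k h t =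
    \sum_(s \in supp f `|` supp g) smul (k s) (act s (h (s^-1 * t)%g)).
  exact: convE.
rewrite !E ?subsetUl ?subsetUr//; last first.
  move=> s ss; have [f0|] := eqVneq (f s) 0; last by left.
  by right; move: ss; rewrite /supp /mkset CcDE f0 add0r.
apply: etrans (fsumD _ _ fX); apply: eq_fsbigr => s _; exact: smulDl.
Qed.

Lemma Cc_mulDr : right_distributive Cc_mul +%R.
Proof.
move=> f g h; apply: CcP => t; rewrite CcDE.
have fX := Cc_finsupp f.
have E k : Cc_mul f k t =
    \sum_(s \in supp f) smul (f s) (act s (k (s^-1 * t)%g)) by exact: convE.
rewrite !E; apply: etrans (fsumD _ _ fX).
by apply: eq_fsbigr => s _; rewrite CcDE actD smulDr.
Qed.

Lemma Cc_mulZl (c : R[i]) f g : Cc_mul (c *: f) g = c *: Cc_mul f g.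
Proof.
apply: CcP => t; rewrite CcZE -[LHS]/(conv _ _ _) -[Cc_mul f g t]/(conv _ _ _).
rewrite !(@convE _ g t (supp f))//; last first.
  by move=> s; rewrite /supp /mkset; apply: contra_neq; rewrite CcZE => ->; rewrite scaler0.
rewrite (raddf_fsum (phi := fun x => c *: x)) ?scaler0//; last 2 first.
- exact: Cc_finsupp.
- by move=> x y; rewrite scalerDr.
by apply: eq_fsbigr => s _; rewrite CcZE smulZl.
Qed.

Lemma Cc_mulZr (c : R[i]) f g : Cc_mul f (c *: g) = c *: Cc_mul f g.
Proof.
apply: CcP => t; rewrite CcZE -[LHS]/(conv _ _ _) -[Cc_mul f g t]/(conv _ _ _).
rewrite !(@convE f _ t (supp f))//.
rewrite (raddf_fsum (phi := fun x => c *: x)) ?scaler0//; last 2 first.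
- exact: Cc_finsupp.
- by move=> x y; rewrite scalerDr.
by apply: eq_fsbigr => s _; rewrite CcZE actZ smulZr.
Qed.

Lemma Cc_starK : involutive Cc_star.
Proof.
by move=> f; apply: CcP => t /=; rewrite -act_star -actM mulgV act1 starK invgK.
Qed.

Lemma Cc_starD : {morph Cc_star : f g / f + g}.
Proof. by move=> f g; apply: CcP => t; rewrite CcDE /= starD actD. Qed.

Lemma Cc_starZ (c : R[i]) f : Cc_star (c *: f) = c^* *: Cc_star f.
Proof. by apply: CcP => t; rewrite CcZE /= starZ actZ. Qed.

Lemma Cc_starM f g : Cc_star (Cc_mul f g) = Cc_mul (Cc_star g) (Cc_star f).
Proof.
apply: CcP => t; rewrite /= /conv -/(conv f g _) (@convE f g _ (supp f))//.
rewrite (raddf_fsum (phi := fun x => act t (star x))); last 3 first.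
- exact: Cc_finsupp.
- by move=> x y; rewrite starD actD.
- by rewrite star0 act0.
rewrite (@reindex_fsbigT _ _ _ _ _ (fun r => t * r)%g); last first.
  by exists (fun r => t^-1 * r)%g => r; rewrite ?mulVKg ?mulKg.
have e s : (((t * s)^-1 * t)^-1 = s)%g by rewrite invgM invgK mulKg.
rewrite (@fsum_setT _ _ (supp f)); last first.
  by move=> s /out fs /=; rewrite e fs star0 !act0 smul0r.
apply: eq_fsbigr => s _ /=; rewrite e starM act_smul -act_star -!actM mulVKg.
by rewrite invgM.
Qed.

HB.instance Definition _ := Lmodule_isStarAlgebra.Build R Cc
  Cc_mulA Cc_mulDl Cc_mulDr Cc_mulZl Cc_mulZr
  Cc_starK Cc_starD Cc_starZ Cc_starM.

End ConvolutionAlgebra.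

Section AlgebraicTensor.
Variables (R : realType) (A B : starAlgType R).
Implicit Types (a : A) (b : B) (s t u v : seq (A * B)).

(* A formal sum [:: (a1, b1); ...; (an, bn)] stands for the tensor
   a1 (x) b1 + ... + an (x) bn. *)
Inductive tens_eq : seq (A * B) -> seq (A * B) -> Prop :=
| tens_refl s : tens_eq s s
| tens_sym s t : tens_eq s t -> tens_eq t s
| tens_trans s t u : tens_eq s t -> tens_eq t u -> tens_eq s u
| tens_cat s t u v : tens_eq s t -> tens_eq u v -> tens_eq (s ++ u) (t ++ v)
| tens_catC s t : tens_eq (s ++ t) (t ++ s)
| tens_0 b : tens_eq [:: (0, b)] [::]
| tens_Dl a a' b : tens_eq [:: (a + a', b)] [:: (a, b); (a', b)]
| tens_Dr a b b' : tens_eq [:: (a, b + b')] [:: (a, b); (a, b')]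
| tens_Z (c : R[i]) a b : tens_eq [:: (c *: a, b)] [:: (a, c *: b)].

Definition tens_eqb : rel (seq (A * B)) := fun s t => `[< tens_eq s t >].

Lemma tens_eqb_refl : reflexive tens_eqb.
Proof. by move=> s; apply/asboolP/tens_refl. Qed.
Lemma tens_eqb_sym : symmetric tens_eqb.
Proof. by move=> s t; apply/asboolP/asboolP; apply: tens_sym. Qed.
Lemma tens_eqb_trans : transitive tens_eqb.
Proof.
by move=> t s u /asboolP st /asboolP tu; apply/asboolP/(tens_trans st tu).
Qed.

Canonical tens_equiv :=
  EquivRel tens_eqb tens_eqb_refl tens_eqb_sym tens_eqb_trans.

Local Open Scope quotient_scope.

Definition tensor := {eq_quot tens_equiv}.
HB.instance Definition _ := Choice.on tensor.
HB.instance Definition _ := EqQuotient.on tensor.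

Definition tens_of s : tensor := \pi_tensor s.

Lemma tensP s t : tens_eq s t <-> tens_of s = tens_of t.
Proof.
split; first by move=> st; apply/eqmodP/asboolP.
by move=> /eqmodP/asboolP.
Qed.

Let piK (x : tensor) : tens_of (repr x) = x. Proof. exact: reprK. Qed.

Let reprP s : tens_eq (repr (tens_of s)) s.
Proof. by apply/tensP; rewrite piK. Qed.

(* Compatibility of an operation on formal sums, from the generators. *)
Let tens_map_eq (f : A * B -> seq (A * B)) :
  (forall b, tens_eq (f (0, b)) [::]) ->
  (forall a a' b, tens_eq (f (a + a', b)) (f (a, b) ++ f (a', b))) ->
  (forall a b b', tens_eq (f (a, b + b')) (f (a, b) ++ f (a, b'))) ->
  (forall (c : R[i]) a b, tens_eq (f (c *: a, b)) (f (a, c *: b))) ->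
  forall s t, tens_eq s t -> tens_eq (flatten (map f s)) (flatten (map f t)).
Proof.
move=> f0 fDl fDr fZ s t; elim=> {s t}.
- by move=> s; apply: tens_refl.
- by move=> s t _; apply: tens_sym.
- by move=> s t u _ + _; apply: tens_trans.
- by move=> s t u v _ h1 _ h2; rewrite !map_cat !flatten_cat; apply: tens_cat.
- by move=> s t; rewrite !map_cat !flatten_cat; apply: tens_catC.
- by move=> b /=; rewrite cats0.
- by move=> a a' b /=; rewrite !cats0.
- by move=> a b b' /=; rewrite !cats0.
- by move=> c a b /=; rewrite !cats0.
Qed.

Let tens_catAC s t u v :
  tens_eq ((s ++ t) ++ (u ++ v)) ((s ++ u) ++ (t ++ v)).
Proof.
rewrite -!catA; apply: tens_cat (tens_refl _) _; rewrite !catA.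
by apply: tens_cat (tens_catC _ _) (tens_refl _).
Qed.

Definition fscale (c : R[i]) s := flatten (map (fun p => [:: (c *: p.1, p.2)]) s).
Definition fstar s := flatten (map (fun p => [:: (star p.1, star p.2)]) s).
Definition fmul1 t p := [seq (smul p.1 q.1, smul p.2 q.2) | q <- t].
Definition fmul s t := flatten (map (fmul1 t) s).

Let scale_cons (c : R[i]) p s : fscale c (p :: s) = (c *: p.1, p.2) :: fscale c s.
Proof. by []. Qed.
Let star_cons p s : fstar (p :: s) = (star p.1, star p.2) :: fstar s.
Proof. by []. Qed.
Let mul_cons p s t : fmul (p :: s) t = fmul1 t p ++ fmul s t.
Proof. by []. Qed.
Let mul1_cons p q t :
  fmul1 (q :: t) p = (smul p.1 q.1, smul p.2 q.2) :: fmul1 t p.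
Proof. by []. Qed.
Let mul1_cat p s t : fmul1 (s ++ t) p = fmul1 s p ++ fmul1 t p.
Proof. exact: map_cat. Qed.
Let scale_cat (c : R[i]) s t : fscale c (s ++ t) = fscale c s ++ fscale c t.
Proof. by rewrite /fscale map_cat flatten_cat. Qed.
Let star_cat s t : fstar (s ++ t) = fstar s ++ fstar t.
Proof. by rewrite /fstar map_cat flatten_cat. Qed.
Let mul_cat s t u : fmul (s ++ t) u = fmul s u ++ fmul t u.
Proof. by rewrite /fmul map_cat flatten_cat. Qed.

Let scale_eq (c : R[i]) s t : tens_eq s t -> tens_eq (fscale c s) (fscale c t).
Proof.
apply: tens_map_eq => /= [b|a a' b|a b b'|d a b].
- by rewrite scaler0; apply: tens_0.
- by rewrite scalerDr; apply: tens_Dl.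
- exact: tens_Dr.
- by rewrite scalerA mulrC -scalerA; apply: tens_Z.
Qed.

Let star_eq s t : tens_eq s t -> tens_eq (fstar s) (fstar t).
Proof.
apply: tens_map_eq => /= [b|a a' b|a b b'|d a b].
- by rewrite star0; apply: tens_0.
- by rewrite starD; apply: tens_Dl.
- by rewrite starD; apply: tens_Dr.
- by rewrite !starZ; apply: tens_Z.
Qed.

Let mul_eql u s t : tens_eq s t -> tens_eq (fmul s u) (fmul t u).
Proof.
apply: tens_map_eq => [b|a a' b|a b b'|d a b]; rewrite /fmul1 /=;
  (elim: u => [|q u IH] /=; first exact: tens_refl).
- by apply: (tens_cat (s := [:: _]) (t := [::])) IH; rewrite smul0l; apply: tens_0.
- apply: tens_trans (tens_catAC [:: _] [:: _] _ _).
  by apply: (tens_cat (s := [:: _])) IH; rewrite smulDl; apply: tens_Dl.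
- apply: tens_trans (tens_catAC [:: _] [:: _] _ _).
  by apply: (tens_cat (s := [:: _])) IH; rewrite smulDl; apply: tens_Dr.
- apply: (tens_cat (s := [:: _]) (t := [:: _])) IH.
  by rewrite !smulZl; apply: tens_Z.
Qed.

Let mul_flip p t : fmul1 t p = flatten [seq [:: (smul p.1 q.1, smul p.2 q.2)] | q <- t].
Proof. by elim: t => //= q t <-. Qed.

Let mul_eqr u s t : tens_eq s t -> tens_eq (fmul u s) (fmul u t).
Proof.
move=> st; elim: u => [|p u IH] /=; first exact: tens_refl.
rewrite /fmul /=; apply: tens_cat IH; rewrite !mul_flip; move: st.
apply: tens_map_eq => /= [b|a a' b|a b b'|d a b].
- by rewrite smul0r; apply: tens_0.
- by rewrite smulDr; apply: tens_Dl.
- by rewrite smulDr; apply: tens_Dr.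
- by rewrite !smulZr; apply: tens_Z.
Qed.

Definition tens_add (x y : tensor) : tensor := tens_of (repr x ++ repr y).
Definition tens_scale (c : R[i]) (x : tensor) : tensor := tens_of (fscale c (repr x)).
Definition tens_opp (x : tensor) : tensor := tens_scale (-1) x.
Definition tens_zero : tensor := tens_of [::].
Definition tens_mul (x y : tensor) : tensor := tens_of (fmul (repr x) (repr y)).
Definition tens_star (x : tensor) : tensor := tens_of (fstar (repr x)).

Lemma tens_of_add s t : tens_add (tens_of s) (tens_of t) = tens_of (s ++ t).
Proof. by apply/tensP; apply: tens_cat; apply: reprP. Qed.
Lemma tens_of_scale (c : R[i]) s : tens_scale c (tens_of s) = tens_of (fscale c s).
Proof. by apply/tensP/scale_eq/reprP. Qed.
Lemma tens_of_star s : tens_star (tens_of s) = tens_of (fstar s).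
Proof. by apply/tensP/star_eq/reprP. Qed.
Lemma tens_of_mul s t : tens_mul (tens_of s) (tens_of t) = tens_of (fmul s t).
Proof.
by apply/tensP/(tens_trans (mul_eql _ (reprP s)))/mul_eqr/reprP.
Qed.

Lemma tens_of_ind (P : tensor -> Prop) : (forall s, P (tens_of s)) -> forall x, P x.
Proof. by move=> Ps x; rewrite -(piK x). Qed.

Lemma tens_addA : associative tens_add.
Proof.
elim/tens_of_ind=> s; elim/tens_of_ind=> t; elim/tens_of_ind=> u.
by rewrite !tens_of_add catA.
Qed.
Lemma tens_addC : commutative tens_add.
Proof.
elim/tens_of_ind=> s; elim/tens_of_ind=> t; rewrite !tens_of_add.
by apply/tensP/tens_catC.
Qed.
Lemma tens_add0 : left_id tens_zero tens_add.
Proof. by elim/tens_of_ind=> s; rewrite /tens_zero tens_of_add. Qed.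
Lemma tens_addN : left_inverse tens_zero tens_opp tens_add.
Proof.
elim/tens_of_ind=> s; rewrite /tens_opp tens_of_scale tens_of_add; apply/tensP.
elim: s => [|[a b] s IH] /=; first exact: tens_refl.
rewrite -[_ :: fscale _ _ ++ _]/([:: _] ++ (fscale (-1) s ++ ([:: (a, b)] ++ s))).
apply: tens_trans (tens_catAC [:: _] _ [:: (a, b)] s) _.
apply: (tens_cat (t := [::]) (v := [::])) IH.
apply: tens_trans (tens_0 b); apply: tens_sym.
by rewrite -(addNr a) scaleN1r; apply: tens_Dl.
Qed.

HB.instance Definition _ := GRing.isZmodule.Build tensor
  tens_addA tens_addC tens_add0 tens_addN.

Lemma tens_of_D s t : tens_of (s ++ t) = tens_of s + tens_of t. Proof. by rewrite -tens_of_add. Qed.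
Lemma tens_of_0 : tens_of [::] = 0. Proof. by []. Qed.
Let pi1Dl a a' b : tens_of [:: (a + a', b)] = tens_of [:: (a, b)] + tens_of [:: (a', b)].
Proof. by rewrite -tens_of_D; apply/tensP/tens_Dl. Qed.
Let pi_cons p s : tens_of (p :: s) = tens_of [:: p] + tens_of s.
Proof. by rewrite -tens_of_D. Qed.

Lemma tens_scaleA (c d : R[i]) x : tens_scale c (tens_scale d x) = tens_scale (c * d) x.
Proof.
elim/tens_of_ind: x => s; rewrite !tens_of_scale; congr tens_of.
by elim: s => // p s IH; rewrite !scale_cons /= scalerA IH.
Qed.
Lemma tens_scale1 : left_id 1 tens_scale.
Proof.
elim/tens_of_ind=> s; rewrite !tens_of_scale; congr tens_of.
by elim: s => // [[a b] s] IH; rewrite scale_cons scale1r IH.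
Qed.
Lemma tens_scaleDr : right_distributive tens_scale +%R.
Proof.
move=> c; elim/tens_of_ind=> s; elim/tens_of_ind=> t.
by rewrite -tens_of_D !tens_of_scale -tens_of_D scale_cat.
Qed.
Lemma tens_scaleDl x : {morph tens_scale^~ x : c d / c + d}.
Proof.
elim/tens_of_ind: x => s c d; rewrite !tens_of_scale.
elim: s => [|p s IH]; first by rewrite tens_of_0 addr0.
rewrite !scale_cons (pi_cons _ (fscale (c + d) s)) IH scalerDl pi1Dl.
by rewrite (pi_cons _ (fscale c s)) (pi_cons _ (fscale d s)) addrACA.
Qed.

HB.instance Definition _ := GRing.Zmodule_isLmodule.Build R[i] tensor
  tens_scaleA tens_scale1 tens_scaleDr tens_scaleDl.

Lemma tens_mulA : associative tens_mul.
Proof.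
elim/tens_of_ind=> s; elim/tens_of_ind=> t; elim/tens_of_ind=> u; rewrite !tens_of_mul; congr tens_of.
elim: s => // p s IH; rewrite !mul_cons mul_cat IH; congr (_ ++ _) => {IH}.
elim: t => // q t IH; rewrite mul_cons mul1_cat mul1_cons mul_cons IH.
congr (_ ++ _); rewrite /fmul1 -map_comp; apply: eq_map => r /=.
by rewrite !smulA.
Qed.
Lemma tens_mulDl : left_distributive tens_mul +%R.
Proof.
elim/tens_of_ind=> s; elim/tens_of_ind=> t; elim/tens_of_ind=> u.
by rewrite -tens_of_D !tens_of_mul -tens_of_D mul_cat.
Qed.
Lemma tens_mulDr : right_distributive tens_mul +%R.
Proof.
elim/tens_of_ind=> s; elim/tens_of_ind=> t; elim/tens_of_ind=> u.
rewrite -tens_of_D !tens_of_mul; elim: s => [|p s IH]; first by rewrite tens_of_0 addr0.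
by rewrite !mul_cons mul1_cat !tens_of_D IH addrACA.
Qed.
Lemma tens_mulZl (c : R[i]) x y : tens_mul (c *: x) y = c *: tens_mul x y.
Proof.
elim/tens_of_ind: x => s; elim/tens_of_ind: y => t.
rewrite -[c *: _]/(tens_scale c _) -[RHS]/(tens_scale c _).
rewrite tens_of_scale !tens_of_mul tens_of_scale; congr tens_of.
elim: s => // p s IH; rewrite ?scale_cons !mul_cons scale_cat IH; congr (_ ++ _).
by elim: t {IH} => // q t IH; apply: (congr2 cons _ IH); rewrite /= smulZl.
Qed.
Lemma tens_mulZr (c : R[i]) x y : tens_mul x (c *: y) = c *: tens_mul x y.
Proof.
elim/tens_of_ind: x => s; elim/tens_of_ind: y => t.
rewrite -[c *: _]/(tens_scale c _) -[RHS]/(tens_scale c _).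
rewrite tens_of_scale !tens_of_mul tens_of_scale; congr tens_of.
elim: s => // p s IH; rewrite ?scale_cons !mul_cons scale_cat IH; congr (_ ++ _).
by elim: t {IH} => // q t IH; apply: (congr2 cons _ IH); rewrite /= smulZr.
Qed.
Lemma tens_starK : involutive tens_star.
Proof.
elim/tens_of_ind=> s; rewrite !tens_of_star; congr tens_of.
by elim: s => // [[a b] s] IH; rewrite !star_cons /= !starK IH.
Qed.
Lemma tens_starD : {morph tens_star : x y / x + y}.
Proof.
elim/tens_of_ind=> s; elim/tens_of_ind=> t.
by rewrite -tens_of_D !tens_of_star -tens_of_D star_cat.
Qed.
Lemma tens_starZ (c : R[i]) x : tens_star (c *: x) = c^* *: tens_star x.
Proof.
elim/tens_of_ind: x => s.
rewrite -[c *: _]/(tens_scale c _) -[RHS]/(tens_scale _ _).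
rewrite tens_of_scale !tens_of_star tens_of_scale; congr tens_of.
by elim: s => // p s IH; rewrite scale_cons !star_cons scale_cons starZ IH.
Qed.
Lemma tens_starM x y : tens_star (tens_mul x y) = tens_mul (tens_star y) (tens_star x).
Proof.
elim/tens_of_ind: x => s; elim/tens_of_ind: y => t; rewrite !(tens_of_mul, tens_of_star).
elim: s => [|p s IH]; first by congr tens_of; elim: (fstar t).
rewrite mul_cons star_cat tens_of_D IH star_cons -[_ :: fstar s]/([:: _] ++ fstar s).
rewrite -!tens_of_mul tens_of_D tens_mulDr; congr (_ + _); rewrite tens_of_mul; congr tens_of.
elim: t {IH} => // q t IH; rewrite mul1_cons !star_cons mul_cons -IH.
by apply: (congr2 cons) => //=; rewrite !starM.
Qed.

HB.instance Definition _ := Lmodule_isStarAlgebra.Build R tensor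
  tens_mulA tens_mulDl tens_mulDr tens_mulZl tens_mulZr
  tens_starK tens_starD tens_starZ tens_starM.

End AlgebraicTensor.

(* The local lifting property: for every Hilbert space H there is exactly one
   C*-norm on the algebraic tensor product of D and B(H). *)
Definition LLP (R : realType) (D : cstarAlgType R) : Prop :=
  forall H : hilbertType R, exists! N : tensor D (bop H) -> R, cstar_norm N.

(* Supremum over all *-representations by bounded operators on Hilbert
   spaces. *)
Definition max_norm (R : realType) (T : starAlgType R) (x : T) : R :=
  sup [set r | exists (H : hilbertType R) (rho : {linear T -> bop H}),
    star_hom rho /\ r = opnorm (rho x)].

(* D, with the map j, is the completion of the *-algebra T for the
   (semi)norm N. *)
Definition cstar_completion (R : realType) (T : starAlgType R) (N : T -> R)
    (D : cstarAlgType R) (j : {linear T -> D}) : Prop :=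
  [/\ star_hom j, forall x, rnorm (j x) = N x & dense (range j)].

(* The complex group algebra C[G] = C_c(G, C), G acting trivially on C. *)
Definition group_algebra (R : realType) (G : groupType) : starAlgType R :=
  Cc (R[i] : gStarAlgType G R).

Definition is_max_group_cstar (R : realType) (G : groupType)
    (D : cstarAlgType R) (j : {linear group_algebra R G -> D}) : Prop :=
  cstar_completion (@max_norm R (group_algebra R G)) j.

Section CrossedProductNorms.
Variables (R : realType) (G : groupType).

Section ReducedNorm.
Variables (A : gStarAlgType G R) (H : hilbertType R).

Definition l2norm (xi : G -> H) : \bar R :=
  sqrte (\esum_(t in [set: G]) (rnorm (xi t) ^+ 2)%:E).

(* The integrated form, on l^2(G, H), of the regular covariant representation
   induced by rho: (a xi)(t) = rho(t^-1.a)(xi(t)), (s xi)(t) = xi(s^-1 t). *)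
Definition regular_op (rho : A -> bop H) (f : Cc A) (xi : G -> H) (t : G) : H :=
  \sum_(s \in [set: G]) rho (act t^-1%g (f s)) (xi (s^-1 * t)%g).

End ReducedNorm.

(* Supremum over all representations of A of the operator norms on
   l^2(G, H). *)
Definition reduced_norm (A : gCstarAlgType G R) (f : Cc A) : R :=
  sup [set r | exists (H : hilbertType R) (rho : {linear A -> bop H})
      (xi : G -> H),
    [/\ star_hom rho, (l2norm xi <= 1)%E
      & (r%:E = l2norm (regular_op rho f xi))%E]].

Section InjectiveNorm.
Variables A B : gCstarAlgType G R.
Implicit Types (iota : {linear A -> B}) (f : Cc A).

Definition equivariant_embedding iota : Prop :=
  [/\ star_hom iota, injective iota
    & forall (g : G) (x : A), iota (act g x) = act g (iota x)].

Lemma Cc_map_subproof iota f : (fun t => iota (f t)) \in @finsupp R G B.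
Proof.
apply/asboolP; apply: sub_finite_set (Cc_finsupp f) => t /=.
by apply: contra_neq => ->; rewrite linear0.
Qed.

Definition Cc_map iota f : Cc B := MkCc (Cc_map_subproof iota f).

End InjectiveNorm.

Definition inj_norm (A : gCstarAlgType G R) (f : Cc A) : R :=
  inf [set r | exists (B : gCstarAlgType G R) (iota : {linear A -> B}),
    equivariant_embedding iota /\ r = max_norm (Cc_map iota f)].

End CrossedProductNorms.

(* Main.v *)
Require Import Defs.
From HB Require Import structures.
From mathcomp Require Import all_boot all_order all_algebra.
From mathcomp Require Import complex.
From mathcomp Require Import all_classical all_reals all_analysis.
From mathcomp Require Import ring lra.
Set Implicit Arguments.
Unset Strict Implicit.
Unset Printing Implicit Defensive.
Import Order.TTheory GRing.Theory Num.Theory.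
Import numFieldNormedType.Exports.
Local Open Scope classical_set_scope.
Local Open Scope complex_scope.
Local Open Scope ring_scope.

(** Both inequalities are proved with concrete operators on l^2(G, H), where pi is
    an isometric representation of A on H, which exists by gelfand_naimark.

    The reduced norm is a lower bound. Let iota : A -> B be an equivariant
    embedding. An isometric representation of B induces a regular representation
    of C_c(G, B), whose norms are at most the maximal ones. On the image of
    C_c(G, A) it is given by finite sections of the matrices of entries
    t^-1.f(t s^-1) over A, through a representation of A that is isometric since
    injective *-homomorphisms are (inj_star_hom_isometric). On matrices over A an
    isometric representation dominates all others (mxbound_transfer), so the
    maximal norm of iota o f is at least the reduced norm of f
    (regular_op_le).

    The reduced norm is attained. Let B be the algebra of all bounded operators
    on l^2(G, H), on which G acts by conjugation with the translations lam g.
    The coefficients of the regular representation embed A equivariantly into B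
    (regemb_embedding). As the action is inner, the elements (lam g)^-1 delta_g of
    the crossed product commute with B and form a copy of the group algebra, so
    a representation of C_c(G, B) amounts to commuting representations of the
    maximal group C*-algebra D and of B, that is to a representation of the
    algebraic tensor product of D and B. The local lifting property says that
    this tensor product has only one C*-norm, and the spatial one, of the
    representation sigma (x) id for a faithful sigma, is such a norm
    (tens_rep_inj). Hence every representation of C_c(G, B) is bounded by the
    spatial norm (LLP_le). The element iota o f corresponds to the sum of the
    delta_s (x) iota(f s) lam s, and its spatial norm is the norm of the sum of
    the u s (x) iota(f s) lam s, where u is a representation of G by unitary
    operators of a subspace.
    Fell's absorption principle removes the factors u s and leaves the regular
    representation of f (fell_absorption), whose norm is at most the reduced
    norm (opnorm_regrep_le).

    The operator theory behind this rests on two constructions. Hilbert spaces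
    are obtained from positive kernels as spaces of functions (rkhs), and
    operators on them from their values on generators (bop_ext); this gives
    tensor products, l^2(G, H) and the GNS construction. Positivity in a
    C*-algebra is expressed by norms (pos) and handled with square roots, which
    come from a fixed point iteration (sqrt_one_minus); spectral theory is
    replaced by these, most notably in the proof that x^* x is positive
    (pos_star_mul). *)

(** * Complex scalars and real-valued norms *)

Section ComplexScalars.
Variable R : realType.
Implicit Types (a b : R) (c d : R[i]).

Lemma RCD a b : (a + b)%:C = a%:C + b%:C. Proof. exact: rmorphD. Qed.
Lemma RCM a b : (a * b)%:C = a%:C * b%:C. Proof. exact: rmorphM. Qed.
Lemma RCN a : (- a)%:C = - a%:C. Proof. exact: rmorphN. Qed.
Lemma RCB a b : (a - b)%:C = a%:C - b%:C. Proof. exact: rmorphB. Qed.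
Lemma RCX a n : (a ^+ n)%:C = a%:C ^+ n. Proof. exact: rmorphXn. Qed.
Lemma RCsum (I : Type) (s : seq I) (P : pred I) (F : I -> R) :
  (\sum_(i <- s | P i) F i)%:C = \sum_(i <- s | P i) (F i)%:C.
Proof. exact: rmorph_sum. Qed.

Lemma cnormE c : `|c| = (complex.Re `|c|)%:C.
Proof. by rewrite RRe_real ?normr_real. Qed.

Lemma cnorm_RC a : complex.Re `|a%:C| = `|a|.
Proof. by rewrite normc_def /= expr0n addr0 sqrtr_sqr. Qed.

Lemma normRC a : `|a%:C| = `|a|%:C :> R[i].
Proof. by rewrite cnormE cnorm_RC. Qed.

Lemma cnormD c d : complex.Re `|c + d| <= complex.Re `|c| + complex.Re `|d|.
Proof. by rewrite -lecR RCD -!cnormE ler_normD. Qed.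

Lemma cnorm_ge0 c : 0 <= complex.Re `|c|.
Proof. by rewrite -ler0c -cnormE. Qed.

Lemma cnormM c d : complex.Re `|c * d| = complex.Re `|c| * complex.Re `|d|.
Proof. by apply: complexI; rewrite RCM -!cnormE normrM. Qed.

Lemma cnorm_conj c : complex.Re `|c^*| = complex.Re `|c|.
Proof. by rewrite norm_conjC. Qed.

Lemma ReD c d : complex.Re (c + d) = complex.Re c + complex.Re d.
Proof. by case: c d => [? ?] [? ?]. Qed.
Lemma ReN c : complex.Re (- c) = - complex.Re c.
Proof. by case: c. Qed.
Lemma ReB c d : complex.Re (c - d) = complex.Re c - complex.Re d.
Proof. by rewrite ReD ReN. Qed.
Lemma ReZ a c : complex.Re (a%:C * c) = a * complex.Re c.
Proof. by case: c => ? ? /=; rewrite mul0r subr0. Qed.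
Lemma ReJ c : complex.Re c^* = complex.Re c.
Proof. by case: c. Qed.
Lemma Re_sum (I : Type) (s : seq I) (P : pred I) (F : I -> R[i]) :
  complex.Re (\sum_(i <- s | P i) F i) = \sum_(i <- s | P i) complex.Re (F i).
Proof. by elim/big_rec2 : _ => // i x y _ <-; rewrite ReD. Qed.
Lemma Re_le_cnorm c : complex.Re c <= complex.Re `|c|.
Proof.
have := normc_ge_Re c; rewrite cnormE lecR; exact: le_trans (ler_norm _).
Qed.

Lemma ge0_RRe c : 0 <= c -> c = (complex.Re c)%:C.
Proof. by move=> c0; rewrite RRe_real// ger0_real. Qed.

Lemma conj_RC a : a%:C^* = a%:C.
Proof. by rewrite -[LHS]/(Complex a (- 0)) oppr0. Qed.

Lemma conjM c d : (c * d)^* = c^* * d^*.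
Proof. exact: rmorphM. Qed.

Lemma conj_i : 'i^* = - 'i :> R[i].
Proof. by apply/eqP; rewrite eq_complex /= oppr0 !eqxx. Qed.

Lemma conjN1 : (-1)^* = -1 :> R[i].
Proof. by rewrite rmorphN1. Qed.

End ComplexScalars.

Section RealNorm.
Variables (R : realType) (V : normedModType R[i]).
Implicit Types (x y z : V) (c : R[i]).

Lemma rnormD x y : rnorm (x + y) <= rnorm x + rnorm y.
Proof. by rewrite -lecR RCD -!rnormE ler_normD. Qed.

Lemma rnormZ c x : rnorm (c *: x) = complex.Re `|c| * rnorm x.
Proof.
apply: complexI; rewrite -rnormE normrZ RCM -rnormE -cnormE.
by [].
Qed.

Lemma rnormZr (r : R) x : rnorm (r%:C *: x) = `|r| * rnorm x.
Proof. by rewrite rnormZ cnorm_RC. Qed.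

Lemma rnormN x : rnorm (- x) = rnorm x.
Proof. by rewrite /rnorm normrN. Qed.

Lemma rnorm0 : rnorm (0 : V) = 0.
Proof. by rewrite /rnorm normr0. Qed.

Lemma rnorm_eq0 x : rnorm x = 0 -> x = 0.
Proof. by move=> x0; apply/eqP; rewrite -normr_eq0 rnormE x0. Qed.

Lemma rdistC x y : rnorm (x - y) = rnorm (y - x).
Proof. by rewrite -rnormN opprB. Qed.

(** The intermediate point comes first, since it is never inferred. *)
Lemma rdistD z x y : rnorm (x - y) <= rnorm (x - z) + rnorm (z - y).
Proof. by rewrite (le_trans _ (rnormD _ _))// addrA subrK. Qed.

Lemma rnorm_sum (I : Type) (s : seq I) (P : pred I) (F : I -> V) :
  rnorm (\sum_(i <- s | P i) F i) <= \sum_(i <- s | P i) rnorm (F i).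
Proof.
elim/big_ind2 : _ => //; first by rewrite rnorm0.
by move=> x a y b xa yb; rewrite (le_trans (rnormD _ _))// lerD.
Qed.

Lemma rnorm_small x y : (forall e, 0 < e -> rnorm (x - y) <= e) -> x = y.
Proof.
move=> h; apply/eqP; rewrite -subr_eq0; apply/eqP/rnorm_eq0/eqP.
rewrite eq_le rnorm_ge0 andbT; apply/ler_addgt0Pr => e e0.
by rewrite add0r h.
Qed.

End RealNorm.

(** Applied to c and to its inverse, a one-sided estimate is an equality. *)
Lemma homogeneous_of_le (R : realType) (V : lmodType R[i]) (N : V -> R) k :
  (forall x, 0 <= N x) ->
  (forall (c : R[i]) x, N (c *: x) <= complex.Re `|c| ^+ k.+1 * N x) ->
  forall (c : R[i]) x, N (c *: x) = complex.Re `|c| ^+ k.+1 * N x.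
Proof.
move=> N0 NZ c x; apply/eqP; rewrite eq_le NZ andTb.
have [->|c0] := eqVneq c 0; first by rewrite normr0 expr0n mul0r N0.
have n0 : 0 < complex.Re `|c| by rewrite -ltcR -cnormE normr_gt0.
have := NZ c^-1 (c *: x); rewrite scalerA mulVf// scale1r.
have -> : complex.Re `|c^-1| = (complex.Re `|c|)^-1.
  apply: (mulfI (lt0r_neq0 n0)).
  by rewrite -cnormM (divff c0) normr1 divff ?lt0r_neq0.
by rewrite exprVn mulrC ler_pdivlMr ?exprn_gt0// mulrC.
Qed.

(** The two notions below are stated for any function N in the place of a norm,
    so that they also apply to the square of a norm and to spaces that do not
    carry a topology yet. *)
Definition rcauchy (R : realType) (V : zmodType) (N : V -> R) (u : nat -> V) :=
  forall e, 0 < e -> exists n, forall m k, (n <= m)%N -> (n <= k)%N ->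
    N (u m - u k) <= e.

Definition rlim (R : realType) (V : zmodType) (N : V -> R) (u : nat -> V) l :=
  forall e, 0 < e -> exists n, forall m, (n <= m)%N -> N (u m - l) <= e.

Lemma natSinv_small (R : realType) (e : R) : 0 < e ->
  exists n, forall m, (n <= m)%N -> (m.+1%:R^-1 : R) < e.
Proof.
move=> e0; have [N _ NP] := near_infty_natSinv_lt (PosNum e0).
by exists N => m /NP.
Qed.

Lemma rcauchy_lim (R : realType) (V : completeNormedModType R[i])
  (u : nat -> V) : rcauchy (@rnorm R V) u -> exists l, rlim (@rnorm R V) u l.
Proof.
move=> cu; have cvu : cvgn u.
  apply: cauchy_cvg; apply/cauchy_ballP => e e0.
  have er : e = (complex.Re e)%:C by rewrite RRe_real// gtr0_real.
  have re0 : 0 < complex.Re e by rewrite -ltcR -er.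
  have [N NP] := cu _ (divr_gt0 re0 (ltr0Sn R 1)).
  exists (u @` [set n | (N <= n)%N], u @` [set n | (N <= n)%N]) => /=.
    by split; exists N => // n /= Nn; exists n.
  move=> [_ _] [/= [n /= Nn <-] [k /= Nk <-]].
  rewrite -ball_normE/= rnormE er ltcR (le_lt_trans (NP _ _ Nn Nk))//.
  by rewrite ltr_pdivrMr// ltr_pMr// ltr1n.
exists (lim (u @ \oo)) => e e0.
have /cvgrPdist_lt/(_ e%:C) := cvu; rewrite ltcR => /(_ e0)[N _ NP].
by exists N => m /NP /=; rewrite rnormE ltcR rdistC => /ltW.
Qed.

(** Completeness is asked for in terms of sequences and of a real-valued norm,
    the form in which the spaces below are built. *)
HB.factory Record Lmodule_isRBanach (R : realType) V of GRing.Lmodule R[i] V := {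
  rn : V -> R ;
  rnD : forall x y, rn (x + y) <= rn x + rn y ;
  rnZ : forall c x, rn (c *: x) = complex.Re `|c| * rn x ;
  rn_eq0 : forall x, rn x = 0 -> x = 0 ;
  rn_complete : forall u, rcauchy rn u -> exists l, rlim rn u l
}.

HB.builders Context R V of Lmodule_isRBanach R V.

Lemma cnD x y : (rn (x + y))%:C <= (rn x)%:C + (rn y)%:C :> R[i].
Proof. by rewrite -RCD lecR rnD. Qed.

Lemma cnZ (c : R[i]) x : (rn (c *: x))%:C = `|c| * (rn x)%:C :> R[i].
Proof. by rewrite rnZ RCM -cnormE. Qed.

Lemma cn_eq0 x : (rn x)%:C = 0 :> R[i] -> x = 0.
Proof. by move=> /complexI /rn_eq0. Qed.

HB.instance Definition _ := @Lmodule_isNormed.Build R[i] V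
  (fun x => (rn x)%:C) cnD cnZ cn_eq0.

Lemma cn_complete (F : set_system V) : ProperFilter F -> cauchy F -> cvg F.
Proof.
move=> FF /cauchyP cF.
have p0 n : 0 < (n.+1%:R^-1 : R)%:C by rewrite ltcR invr_gt0.
have /choice[u uP] n : exists x, F (ball x (n.+1%:R^-1 : R)%:C).
  by have [x Fx] := cF _ (p0 n); exists x.
have ub x y (e : R) : ball x e%:C y -> rn (x - y) <= e.
  by rewrite -ball_normE /= ltcR => /ltW.
have uC n k : rn (u n - u k) <= n.+1%:R^-1 + k.+1%:R^-1.
  have [y [yn yk]] := filter_ex (filterI (uP n) (uP k)).
  rewrite -(subrK y (u n)) -addrA (le_trans (rnD _ _))// lerD//; first exact: ub yn.
  by apply: ub; apply: ball_sym.
have [|l lP] := rn_complete (u := u).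
  move=> e e0; have [N NP] := natSinv_small (divr_gt0 e0 (ltr0Sn R 1)).
  exists N => m k Nm Nk; rewrite (le_trans (uC m k))//.
  by rewrite [leRHS]splitr lerD// ltW// NP.
apply/cvg_ex; exists l; apply/cvg_ballP => e e0.
have er : e = (complex.Re e)%:C by rewrite RRe_real// gtr0_real.
have re0 : 0 < complex.Re e / 2 by rewrite divr_gt0// -ltcR -er.
have re1 : 0 < complex.Re e / 4 by rewrite divr_gt0// -ltcR -er.
have [N1 N1P] := lP _ re1; have [N2 N2P] := natSinv_small re0.
pose n := maxn N1 N2; have := uP n; apply: filterS => y yn.
rewrite -ball_normE /= er ltcR -opprB.
have -> : rn (- (y - l)) = rn ((y - u n) + (u n - l)).
  by rewrite -scaleN1r rnZ normrN1 mul1r addrA subrK.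
have yn' : rn (y - u n) < complex.Re e / 2.
  rewrite (@le_lt_trans _ _ n.+1%:R^-1)//; last by rewrite N2P// leq_maxr.
  by apply: ub; apply: ball_sym.
rewrite (le_lt_trans (rnD _ _))//.
by have := N1P n (leq_maxl _ _); lra.
Qed.

HB.instance Definition _ := Uniform_isComplete.Build V cn_complete.

HB.end.

(** Equations between sums of the same terms in a commutative group, decided by
    comparing the multiplicity of each term. *)
Inductive gexpr := GVar of nat | GAdd of gexpr & gexpr | GOpp of gexpr | GZero.

Fixpoint gmult (x : gexpr) (i : nat) : int := match x with
  | GVar j => (i == j)%:Z
  | GAdd y z => gmult y i + gmult z i
  | GOpp y => - gmult y i
  | GZero => 0
  end.

Fixpoint geval (V : zmodType) (s : seq V) (x : gexpr) : V := match x with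
  | GVar j => s`_j
  | GAdd y z => geval s y + geval s z
  | GOpp y => - geval s y
  | GZero => 0
  end.

Lemma geval_mult (V : zmodType) (s : seq V) x :
  geval s x = \sum_(i < size s) s`_i *~ gmult x i.
Proof.
elim: x => [j|x IHx y IHy|x IHx|] /=.
- have [js|sj] := ltnP j (size s).
    rewrite (bigD1 (Ordinal js))//= eqxx mulr1z big1 ?addr0// => i ij.
    by rewrite -[_ == _]/(_ == val (Ordinal js)) val_eqE (negPf ij) mulr0z.
  rewrite nth_default// big1// => i _.
  by rewrite ltn_eqF ?mulr0z// (leq_trans (ltn_ord i)).
- by rewrite IHx IHy -big_split; apply: eq_bigr => i _; rewrite mulrzDr.
- by rewrite IHx -sumrN; apply: eq_bigr => i _; rewrite mulrNz.
- by rewrite big1// => i _; rewrite mulr0z.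
Qed.

Lemma geval_eq (V : zmodType) (s : seq V) x y :
  all (fun i => gmult x i == gmult y i) (iota 0 (size s)) ->
  geval s x = geval s y.
Proof.
move=> /allP h; rewrite !geval_mult; apply: eq_bigr => i _.
by rewrite (eqP (h i _))// mem_iota /=.
Qed.

Ltac gmem x s := match s with
  | nil => false
  | cons ?y _ => let _ := constr:(erefl y : x = y) in true
  | cons _ ?t => gmem x t end.
Ltac gatoms x s := lazymatch x with
  | GRing.add ?y ?z => let s := gatoms y s in gatoms z s
  | GRing.opp ?y => gatoms y s
  | GRing.zero => s
  | _ => let b := gmem x s in
         lazymatch b with true => s | false => constr:(cons x s) end
  end.
Ltac gindex x s := match s with
  | cons ?y _ => let _ := constr:(erefl y : x = y) in constr:(0%N)
  | cons _ ?t => let n := gindex x t in constr:(S n) end.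
Ltac greify x s := lazymatch x with
  | GRing.add ?y ?z => let a := greify y s in let b := greify z s in
                       constr:(GAdd a b)
  | GRing.opp ?y => let a := greify y s in constr:(GOpp a)
  | GRing.zero => constr:(GZero)
  | _ => let n := gindex x s in constr:(GVar n)
  end.
Ltac abel := lazymatch goal with |- @eq ?V ?x ?y =>
  let s := gatoms x (@nil V) in let s := gatoms y s in
  let a := greify x s in let b := greify y s in
  exact: (@geval_eq _ s a b isT) end.

(** * Hilbert spaces from quadratic forms *)

(** The difference f c - c * f 1 is additive and vanishes on the integers, so it
    is bounded everywhere, and a bounded additive function is 0. *)
Lemma additive_bounded_linear (R : realType) (f : R -> R) (M : R) :
  {morph f : x y / x + y} -> (forall c, 0 <= c <= 1 -> `|f c| <= M) ->
  forall c, f c = c * f 1.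
Proof.
move=> fD fM.
have f0 : f 0 = 0 by apply: (addrI (f 0)); rewrite -fD !addr0.
have fN x : f (- x) = - f x by apply: (addIr (f x)); rewrite -fD !addNr.
have fMn x n : f (x *+ n) = f x *+ n.
  by elim: n => [|n IH]; rewrite ?mulr0n// !mulrS fD IH.
have fMz x (m : int) : f (x *~ m) = f x *~ m.
  by case: m => n; rewrite ?NegzE ?mulrNz ?fN -!pmulrn fMn.
pose g x := f x - x * f 1.
have gM x : `|g x| <= M + `|f 1|.
  pose t := x - (Num.floor x)%:~R.
  have t01 : 0 <= t <= 1.
    have := @floor_itv R x; rewrite ?num_real// => /andP[a b].
    by rewrite /t subr_ge0 a/= lerBlDl -[in leRHS](intrD _ _ 1) ltW.
  have -> : g x = f t - t * f 1.
    by rewrite /g /t fD fN fMz -mulrzl; move: (_%:~R) => r; ring.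
  rewrite (le_trans (ler_normB _ _))// lerD ?fM//.
  by rewrite normrM ger0_norm ?ler_piMl//; case/andP: t01.
move=> c; apply/eqP; rewrite -subr_eq0 -/(g c); apply: contrapT => /negP gc.
have gn : 0 < `|g c| by rewrite normr_gt0.
have [n nP] : exists n : nat, M + `|f 1| < n%:R * `|g c|.
  exists (Num.truncn ((M + `|f 1|) / `|g c|)).+1.
  by rewrite -ltr_pdivrMr// truncnS_gt.
have := gM (c *+ n); rewrite leNgt => /negP; apply.
rewrite /g fMn mulrnAl -mulrnBl normrMn -mulr_natl.
exact: nP.
Qed.

(** By Jordan and von Neumann, a quadratic form that satisfies the
    parallelogram law comes from an inner product. This builds a Hilbert space
    whose norm is known as a supremum while its inner product is not. *)
HB.factory Record Lmodule_isRHilbert (R : realType) V of GRing.Lmodule R[i] V := {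
  qf : V -> R ;
  qf_ge0 : forall x, 0 <= qf x ;
  qfZ : forall c x, qf (c *: x) = complex.Re `|c| ^+ 2 * qf x ;
  qf_par : forall x y, qf (x + y) + qf (x - y) = 2 * qf x + 2 * qf y ;
  qf_eq0 : forall x, qf x = 0 -> x = 0 ;
  qf_complete : forall u, rcauchy qf u -> exists l, rlim qf u l
}.

HB.builders Context R V of Lmodule_isRHilbert R V.

Implicit Types (x y z : V).

Let qfN x : qf (- x) = qf x.
Proof. by rewrite -scaleN1r qfZ normrN1 /= expr1n mul1r. Qed.

Let qf0 : qf 0 = 0.
Proof. by rewrite -(scale0r (0 : V)) qfZ normr0 /= expr0n mul0r. Qed.

Let b x y : R := (qf (x + y) - qf (x - y)) / 4.

Let bC x y : b x y = b y x.
Proof. by rewrite /b (addrC x y) -[x - y]opprB qfN. Qed.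

Let b_half x z y : b x y + b z y = b (x + z) (y + y) / 2.
Proof.
have e1 := qf_par (x + y) (z + y); have e2 := qf_par (x - y) (z - y).
have -> : b (x + z) (y + y) = (qf (x + y + (z + y)) - qf (x - y + (z - y))) / 4.
  by rewrite /b; congr ((qf _ - qf _) / 4); [rewrite addrACA|rewrite opprD addrACA].
have d1 : x + y - (z + y) = x - z by rewrite opprD addrACA subrr addr0.
have d2 : x - y - (z - y) = x - z by rewrite opprB addrA subrK.
by move: e1 e2; rewrite /b d1 d2; lra.
Qed.

Let b0l y : b 0 y = 0.
Proof. by rewrite /b !add0r qfN subrr mul0r. Qed.

Let bDl x z y : b (x + z) y = b x y + b z y.
Proof.
rewrite b_half; have := b_half (x + z) 0 y.
by rewrite b0l !addr0.
Qed.

Let bDr x y z : b x (y + z) = b x y + b x z.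
Proof. by rewrite bC bDl !(bC x). Qed.

Let bxx x : b x x = qf x.
Proof.
rewrite /b subrr qf0 subr0 -[x + x]mulr2n -scaler_nat qfZ normr_nat /=.
rewrite -[X in X^+ 2]/(complex.Re (2%:R : R[i])) -(rmorph_nat (real_complex R)) /=.
by field.
Qed.

Let bZl (r : R) x y : b (r%:C *: x) y = r * b x y.
Proof.
pose M := (qf x + qf y) / 2.
rewrite [LHS](@additive_bounded_linear R (fun r => b (r%:C *: x) y) M).
- by rewrite scale1r.
- by move=> s t; rewrite RCD scalerDl bDl.
- move=> c /andP[c0 c1]; have e := qf_par (c%:C *: x) y.
  have h1 := qf_ge0 (c%:C *: x + y); have h2 := qf_ge0 (c%:C *: x - y).
  have h3 : qf (c%:C *: x) <= qf x.
    rewrite qfZ cnorm_RC ger0_norm// ler_piMl ?qf_ge0//.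
    by rewrite exprn_ile1.
  by rewrite /b /M ler_norml; apply/andP; split; lra.
Qed.

Let bi x y : b ('i *: x) ('i *: y) = b x y.
Proof. by rewrite /b -scalerDr -scalerBr !qfZ normCi expr1n !mul1r. Qed.

Let bil x y : b ('i *: x) y = - b x ('i *: y).
Proof.
rewrite -bi scalerA -expr2 sqrCi scaleN1r -[- x]scaleN1r.
by rewrite -(rmorphN1 (real_complex R)) bZl mulN1r.
Qed.

Let qf_cs x y : b x y <= Num.sqrt (qf x) * Num.sqrt (qf y).
Proof.
have [qx|qx] := eqVneq (qf x) 0.
  by rewrite (qf_eq0 qx) b0l qf0 sqrtr0 mul0r.
have [qy|qy] := eqVneq (qf y) 0.
  by rewrite (qf_eq0 qy) bC b0l qf0 sqrtr0 mulr0.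
set p := Num.sqrt (qf x); set q := Num.sqrt (qf y).
have pq : 0 < p * q.
  by rewrite mulr_gt0// sqrtr_gt0 lt_neqAle eq_sym ?qx ?qy qf_ge0.
have px : qf x = p ^+ 2 by rewrite sqr_sqrtr ?qf_ge0.
have qy' : qf y = q ^+ 2 by rewrite sqr_sqrtr ?qf_ge0.
have := qf_ge0 (q%:C *: x + (- p)%:C *: y).
rewrite -bxx !(bDl, bDr) (bC ((- p)%:C *: y)) !bZl !(bC _ (q%:C *: x)).
rewrite !(bC _ ((- p)%:C *: y)) !bZl !bxx (bC y x) px qy' => h.
rewrite -(ler_pM2l pq) -subr_ge0.
have -> : p * q * (p * q) - p * q * b x y =
  (q * (q * p ^+ 2) + - p * (q * b x y) + (q * (- p * b x y) + - p * (- p * q ^+ 2))) / 2.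
  by field.
by apply: divr_ge0 => //; move: h; rewrite !mulrA (mulrC (- p) q) => h; lra.
Qed.

Let n x := Num.sqrt (qf x).

Let nD x y : n (x + y) <= n x + n y.
Proof.
rewrite -(@ler_pXn2r _ 2) ?nnegrE ?addr_ge0 ?sqrtr_ge0// sqr_sqrtr ?qf_ge0//.
rewrite -bxx bDl !bDr (bC y x) !bxx sqrrD !sqr_sqrtr ?qf_ge0//.
by have := qf_cs x y; rewrite -/(n x) -/(n y); lra.
Qed.

Let nZ (c : R[i]) x : n (c *: x) = complex.Re `|c| * n x.
Proof. by rewrite /n qfZ sqrtrM ?exprn_ge0 ?cnorm_ge0// sqrtr_sqr ger0_norm ?cnorm_ge0. Qed.

Let n_eq0 x : n x = 0 -> x = 0.
Proof.
move=> h; apply: qf_eq0; apply/eqP; rewrite eq_le qf_ge0 andbT.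
by rewrite -sqrtr_eq0 -/(n x) h.
Qed.

Let n_complete u : rcauchy n u -> exists l, rlim n u l.
Proof.
move=> cu; have [|l lP] := qf_complete (u := u).
  move=> e e0; have [|N NP] := cu (Num.sqrt e); first by rewrite sqrtr_gt0.
  by exists N => m k Nm Nk; rewrite -ler_sqrt ?(ltW e0)//; exact: NP.
exists l => e e0; have [|N NP] := lP (e ^+ 2); first by rewrite exprn_gt0.
exists N => m Nm; rewrite -(@ler_pXn2r _ 2) ?nnegrE ?sqrtr_ge0 ?(ltW e0)//.
by rewrite sqr_sqrtr ?qf_ge0// NP.
Qed.

HB.instance Definition _ := Lmodule_isRBanach.Build R V nD nZ n_eq0 n_complete.

Let d x y : R[i] := Complex (b x y) (b x ('i *: y)).

Let dDl x y z : d (x + y) z = d x z + d y z.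
Proof. by rewrite /d !bDl. Qed.

Let dZl (c : R[i]) x y : d (c *: x) y = c * d x y.
Proof.
case: c => p q.
have -> : Complex p q = p%:C + q%:C * 'i.
  by apply/eqP; rewrite eq_complex /= !(mulr0, mulr1, subr0, addr0, add0r) !eqxx.
rewrite scalerDl dDl -scalerA mulrDl; congr (_ + _).
  rewrite /d !bZl; apply/eqP; rewrite eq_complex /=.
  by rewrite !mul0r subr0 addr0 !eqxx.
rewrite -mulrA /d !bZl !bil scalerA -expr2 sqrCi scaleN1r.
have -> : b x (- y) = - b x y.
  by rewrite bC -scaleN1r -(rmorphN1 (real_complex R)) bZl mulN1r bC.
rewrite opprK; apply/eqP; rewrite eq_complex /=.
by apply/andP; split; apply/eqP; ring.
Qed.

Let dC x y : d y x = (d x y)^*.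
Proof. by rewrite /d bC; apply: congr1; rewrite bC bil. Qed.

Let d_norm x : d x x = `|x| ^+ 2.
Proof.
have -> : `|x| = (n x)%:C by [].
rewrite -RCX sqr_sqrtr ?qf_ge0// /d bxx.
suff -> : b x ('i *: x) = 0 by [].
by have := bil x x; rewrite bC; lra.
Qed.

HB.instance Definition _ := CompleteNormedModule_isHilbert.Build R V
  dDl dZl dC d_norm.

HB.end.

(** * Inner products and adjoints *)

Section InnerProducts.
Variables (R : realType) (H : hilbertType R).
Implicit Types (x y z : H) (c : R[i]).

Lemma dotxx x : dot x x = (rnorm x ^+ 2)%:C.
Proof. by rewrite dot_norm rnormE RCX. Qed.

Lemma dot0l x : dot 0 x = 0.
Proof. by rewrite -(scale0r (0 : H)) dotZl mul0r. Qed.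

Lemma dot0r x : dot x 0 = 0.
Proof. by rewrite dotC dot0l conjC0. Qed.

Lemma dotNl x y : dot (- x) y = - dot x y.
Proof. by rewrite -scaleN1r dotZl mulN1r. Qed.

Lemma dotNr x y : dot x (- y) = - dot x y.
Proof. by rewrite dotC dotNl rmorphN /= -dotC. Qed.

Lemma dotBl x y z : dot (x - y) z = dot x z - dot y z.
Proof. by rewrite dotDl dotNl. Qed.

Lemma dot_suml (I : Type) (s : seq I) (P : pred I) (F : I -> H) y :
  dot (\sum_(i <- s | P i) F i) y = \sum_(i <- s | P i) dot (F i) y.
Proof.
by elim/big_rec2 : _ => [|i u v _ <-]; [exact: dot0l|exact: dotDl].
Qed.

Lemma dot_sumr (I : Type) (s : seq I) (P : pred I) (F : I -> H) y :
  dot y (\sum_(i <- s | P i) F i) = \sum_(i <- s | P i) dot y (F i).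
Proof.
by elim/big_rec2 : _ => [|i u v _ <-]; [exact: dot0r|exact: dotDr].
Qed.

Lemma cnorm_dot x y : complex.Re `|dot x y| <= rnorm x * rnorm y.
Proof. by rewrite -lecR RCM -cnormE -!rnormE cauchy_schwarz. Qed.

Lemma Re_dot_le x y : complex.Re (dot x y) <= rnorm x * rnorm y.
Proof. exact: le_trans (Re_le_cnorm _) (cnorm_dot x y). Qed.

Lemma rnormD_sqr x y :
  rnorm (x + y) ^+ 2 = rnorm x ^+ 2 + rnorm y ^+ 2 + 2 * complex.Re (dot x y).
Proof.
have := congr1 (@complex.Re R) (dotxx (x + y)).
by rewrite dotDl !dotDr !ReD (dotC x y) ReJ !dotxx /= => <-; ring.
Qed.

Lemma dot_injl x y : (forall z, dot x z = dot y z) -> x = y.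
Proof. by move=> h; apply: dot_inj => z; rewrite dotC h -dotC. Qed.

Lemma sqr_le_mul (a b : R) : 0 <= b -> a ^+ 2 <= b * a -> a <= b.
Proof.
move=> b0 h; rewrite leNgt; apply/negP => ba.
by have := le_lt_trans b0 ba => a0; nra.
Qed.

End InnerProducts.

Section Adjoint.
Variables (R : realType) (H1 H2 : hilbertType R).

Lemma adjoint_exists (T : H1 -> H2) (M : R) : linear T ->
  (forall x, rnorm (T x) <= M * rnorm x) ->
  exists S : H2 -> H1, [/\ linear S, forall x y, dot (T x) y = dot x (S y)
    & forall y, rnorm (S y) <= `|M| * rnorm y].
Proof.
move=> lT TM; have TM' x : rnorm (T x) <= `|M| * rnorm x.
  by rewrite (le_trans (TM x))// ler_wpM2r ?rnorm_ge0// ler_norm.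
have /choice[S SP] y : exists z, forall x, dot (T x) y = dot x z.
  apply: (@riesz R H1 (fun x => dot (T x) y) (`|M| * rnorm y)).
    by move=> c u v /=; rewrite lT dotDl dotZl.
  move=> x; rewrite cnormE rnormE -RCM lecR (le_trans (cnorm_dot _ _))//.
  by rewrite mulrAC ler_wpM2r ?rnorm_ge0.
exists S; split=> //.
  by move=> c u v; apply: dot_inj => x; rewrite -SP !(dotDr, dotZr) !SP.
move=> y; apply: sqr_le_mul; first by rewrite mulr_ge0 ?rnorm_ge0.
have -> : rnorm (S y) ^+ 2 = complex.Re (dot (T (S y)) y) by rewrite SP dotxx.
rewrite (le_trans (Re_dot_le _ _))// mulrAC.
by rewrite ler_wpM2r ?rnorm_ge0.
Qed.

End Adjoint.

Section GramSchmidt.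
Variables (R : realType) (H : hilbertType R).
Implicit Types (w v : H) (es ws : seq H).

(** The orthonormal family is used only through this expansion of inner
    products, in which one of the two vectors is arbitrary. *)
Lemma gram_schmidt ws : exists es, forall w v, w \in ws ->
  dot w v = \sum_(m <- es) dot w m * dot m v.
Proof.
suff [es [_ _ h]] : exists es, [/\ uniq es,
    {in es &, forall m m', dot m m' = (m == m')%:R}
  & {in ws, forall w, w = \sum_(m <- es) dot w m *: m}].
  exists es => w v /h {1}->; rewrite dot_suml; apply: eq_bigr => m _.
  by rewrite dotZl.
elim: ws => [|w ws [es [ue oe he]]]; first by exists [::].
pose r := w - \sum_(m <- es) dot w m *: m.
have sumE m u : m \in es -> \sum_(m' <- es) dot u m' * dot m' m = dot u m.
  move=> me; rewrite (bigD1_seq m)//= (oe m m me me) eqxx mulr1 big_seq_cond big1 ?addr0//.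
  by move=> m' /andP[m'e /negPf nm]; rewrite (oe m' m m'e me) nm mulr0.
have rm m : m \in es -> dot r m = 0.
  move=> me; rewrite /r dotBl dot_suml.
  under eq_bigr do rewrite dotZl.
  by rewrite sumE// subrr.
have [r0|rN] := eqVneq r 0.
  exists es; split => // u; rewrite inE => /predU1P[->|/he//].
  by apply/eqP; rewrite -subr_eq0 -/r r0.
have nr : rnorm r != 0 by apply: contra_neq rN => /rnorm_eq0.
pose m0 := (rnorm r)^-1%:C *: r.
have m00 : dot m0 m0 = 1.
  by rewrite dotxx /m0 rnormZr ger0_norm ?invr_ge0 ?rnorm_ge0// mulVf// expr1n.
have m0m m : m \in es -> dot m0 m = 0 by move=> me; rewrite dotZl rm// mulr0.
have mm0 m : m \in es -> dot m m0 = 0 by move=> me; rewrite dotC m0m// conjC0.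
have m0e : m0 \notin es.
  by apply/negP => /m0m; rewrite m00 => /eqP; rewrite oner_eq0.
exists (m0 :: es); split => /=.
- by rewrite m0e.
- move=> m m'; rewrite !inE => /predU1P[->|me] /predU1P[->|m'e].
  + by rewrite eqxx m00.
  + by rewrite m0m//; case: eqVneq m0e => // ->; rewrite m'e.
  + by rewrite mm0//; case: eqVneq m0e => // <-; rewrite me.
  + exact: oe.
- move=> u; rewrite inE big_cons => /predU1P[->|uw].
    have -> : dot w m0 *: m0 = r.
      have -> : dot w m0 = dot r m0.
        rewrite /r dotBl dot_suml big_seq big1 ?subr0// => m me.
        by rewrite dotZl mm0// mulr0.
      rewrite {1}/m0 dotZr conj_RC dotxx -RCM /m0 scalerA -RCM.
      by rewrite expr2 mulKf// divff// scale1r.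
    by rewrite /r subrK.
  have -> : dot u m0 = 0.
    rewrite (he _ uw) dot_suml big_seq big1// => m me.
    by rewrite dotZl mm0// mulr0.
  by rewrite scale0r add0r; exact: he.
Qed.

End GramSchmidt.

(** * Reproducing kernel Hilbert spaces *)

Section RealInequalities.
Variable R : realType.

Lemma real_cauchy_lim (u : nat -> R) : rcauchy (@Num.norm _ R) u ->
  exists l, rlim (@Num.norm _ R) u l.
Proof.
move=> cu; have cvu : cvgn u.
  apply: cauchy_cvg; apply/cauchy_ballP => e e0.
  have [N NP] := cu _ (divr_gt0 e0 (ltr0Sn R 1)).
  exists (u @` [set n | (N <= n)%N], u @` [set n | (N <= n)%N]) => /=.
    by split; exists N => // n /= Nn; exists n.
  move=> [_ _] [/= [n /= Nn <-] [k /= Nk <-]].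
  rewrite -ball_normE/= (le_lt_trans (NP _ _ Nn Nk))//.
  by rewrite ltr_pdivrMr// ltr_pMr// ltr1n.
exists (lim (u @ \oo)) => e e0.
have /cvgrPdist_lt/(_ e e0)[N _ NP] := cvu.
by exists N => m /NP /=; rewrite distrC => /ltW.
Qed.

Lemma cnorm_le_ReIm (c : R[i]) :
  complex.Re `|c| <= `|complex.Re c| + `|complex.Im c|.
Proof.
rewrite -lecR -cnormE RCD [X in `|X|](_ : c = (complex.Re c)%:C + 'i * (complex.Im c)%:C).
  rewrite (le_trans (ler_normD _ _))// normrM normCi mul1r.
  by rewrite !normRC.
by case: c => a b; apply/eqP; rewrite eq_complex /= !(mul0r, mulr0, mul1r, subr0, addr0, add0r) !eqxx.
Qed.

Lemma complex_cauchy_lim (u : nat -> R[i]) :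
  rcauchy (fun c : R[i] => complex.Re `|c|) u ->
  exists l, rlim (fun c : R[i] => complex.Re `|c|) u l.
Proof.
move=> cu.
have [|a aP] := @real_cauchy_lim (fun n => complex.Re (u n)).
  move=> e /cu[N NP]; exists N => m k Nm Nk; apply: le_trans (NP _ _ Nm Nk).
  by rewrite -ReB -lecR -cnormE normc_ge_Re.
have [|b bP] := @real_cauchy_lim (fun n => complex.Im (u n)).
  move=> e /cu[N NP]; exists N => m k Nm Nk; apply: le_trans (NP _ _ Nm Nk).
  have -> : complex.Im (u m) - complex.Im (u k) = complex.Re ('i * (u k - u m)).
    by case: (u m) (u k) => [? ?] [? ?] /=; ring.
  rewrite -lecR -cnormE distrC.
  by rewrite (le_trans (normc_ge_Re _))// normrM normCi mul1r.
exists (Complex a b) => e e0.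
have e2 : 0 < e / 2 by rewrite divr_gt0.
have [N1 h1] := aP _ e2; have [N2 h2] := bP _ e2.
exists (maxn N1 N2) => m; rewrite geq_max => /andP[m1 m2].
rewrite (le_trans (cnorm_le_ReIm _))//.
have := lerD (h1 _ m1) (h2 _ m2); rewrite -splitr.
by case: (u m) => ? ?.
Qed.

(** The discriminant of a nonnegative quadratic polynomial. *)
Lemma discr_le (a b c : R) : (forall t, 0 <= a + 2 * t * b + t ^+ 2 * c) ->
  b ^+ 2 <= a * c.
Proof.
move=> h; have a0 : 0 <= a by have := h 0; rewrite mulr0 !mul0r expr0n mul0r !addr0.
have c0 : 0 <= c.
  rewrite leNgt; apply/negP => cn.
  pose t := (`|b| + 1 + a) / - c.
  have nc : 0 < - c by rewrite oppr_gt0.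
  have tn : t * - c = `|b| + 1 + a by rewrite /t mulfVK// gt_eqF.
  have t0 : 0 <= t by rewrite divr_ge0 ?(ltW nc)// !addr_ge0.
  have := h (2 * t + 1); have := ler_norm b; have := normr_ge0 b.
  have e : t * c = - (`|b| + 1 + a) by rewrite -tn mulrN opprK.
  have -> : (2 * t + 1) ^+ 2 * c = 4 * t * (t * c) + 4 * (t * c) + c by ring.
  rewrite e; nra.
have [c00|cN] := eqVneq c 0.
  have [->|bN] := eqVneq b 0; first by rewrite expr0n/= mulr_ge0.
  have := h (- (a + 1) / (2 * b)); rewrite c00 mulr0 addr0.
  have -> : 2 * (- (a + 1) / (2 * b)) * b = - (a + 1) by field.
  by lra.
have cp : 0 < c by rewrite lt_neqAle eq_sym cN.
have := h (- b / c).
have -> : a + 2 * (- b / c) * b + (- b / c) ^+ 2 * c = a - b ^+ 2 / c by field.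
by rewrite subr_ge0 ler_pdivrMr.
Qed.

End RealInequalities.

Section Kernels.
Variables (R : realType) (X : Type).
Implicit Types (k : X -> X -> R[i]) (s t : seq (R[i] * X)) (f g : X -> R[i]).

Definition kform k s t : R[i] :=
  \sum_(p <- s) \sum_(r <- t) p.1 * r.1^* * k p.2 r.2.

Definition psd k := forall s, 0 <= kform k s s.

Definition herm k := forall x y, k y x = (k x y)^*.

Definition fscal (c : R[i]) s := [seq (c * p.1, p.2) | p <- s].

Lemma kform_catl k s s' t : kform k (s ++ s') t = kform k s t + kform k s' t.
Proof. by rewrite /kform big_cat. Qed.

Lemma kform_catr k s t t' : kform k s (t ++ t') = kform k s t + kform k s t'.
Proof.
by rewrite /kform -big_split; apply: eq_bigr => p _; rewrite big_cat.
Qed.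

Lemma kform_scall k c s t : kform k (fscal c s) t = c * kform k s t.
Proof.
rewrite /kform big_map mulr_sumr; apply: eq_bigr => p _ /=.
by rewrite mulr_sumr; apply: eq_bigr => r _; rewrite -!mulrA.
Qed.

Lemma kform_scalr k c s t : kform k s (fscal c t) = c^* * kform k s t.
Proof.
rewrite /kform mulr_sumr; apply: eq_bigr => p _ /=; rewrite big_map mulr_sumr.
by apply: eq_bigr => r _ /=; rewrite rmorphM /= !mulrA (mulrC p.1).
Qed.

Lemma kformC k s t : herm k -> kform k t s = (kform k s t)^*.
Proof.
move=> hk; rewrite /kform exchange_big rmorph_sum; apply: eq_bigr => p _ /=.
rewrite rmorph_sum; apply: eq_bigr => r _ /=.
by rewrite !rmorphM /= conjCK hk (mulrC r.1).
Qed.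

(** The value that the inner product of f with the formal combination s of
    kernel functions has to take; it is conjugate linear in s. *)
Definition keval f s : R[i] := \sum_(p <- s) p.1^* * f p.2.

Lemma keval_cat f s t : keval f (s ++ t) = keval f s + keval f t.
Proof. by rewrite /keval big_cat. Qed.

Lemma keval_scal f c s : keval f (fscal c s) = c^* * keval f s.
Proof.
rewrite /keval big_map mulr_sumr; apply: eq_bigr => p _ /=.
by rewrite rmorphM /= mulrA.
Qed.

Lemma kevalD f g s : keval (f + g) s = keval f s + keval g s.
Proof. by rewrite /keval -big_split; apply: eq_bigr => p _; rewrite /= -mulrDr. Qed.

Lemma kevalZ c f s : keval (c *: f) s = c * keval f s.
Proof.
rewrite /keval mulr_sumr; apply: eq_bigr => p _.
by rewrite mulrCA; congr (_ * _).
Qed.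

Definition kvec k s : X -> R[i] := fun y => \sum_(p <- s) p.1 * k p.2 y.

Lemma keval_kvec k s t : keval (kvec k s) t = kform k s t.
Proof.
rewrite /keval /kform exchange_big; apply: eq_bigr => r _ /=.
by rewrite mulr_sumr; apply: eq_bigr => p _; rewrite mulrCA mulrA.
Qed.

Record pkernel := PKernel {
  pk :> X -> X -> R[i] ; pk_herm : herm pk ; pk_psd : psd pk }.

End Kernels.

Section RKHS.
Variables (R : realType) (X : Type) (k : pkernel R X).
Implicit Types (s t : seq (R[i] * X)) (f g : X -> R[i]).

Let q s : R := complex.Re (kform k s s).

Let q_ge0 s : 0 <= q s.
Proof. by rewrite -ler0c -ge0_RRe ?pk_psd. Qed.

Let qE s : kform k s s = (q s)%:C.
Proof. by apply: ge0_RRe; exact: pk_psd. Qed.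

Let q_cat s t : q (s ++ t) = q s + q t + 2 * complex.Re (kform k s t).
Proof.
rewrite /q !(kform_catl, kform_catr) !ReD (kformC s t) ?ReJ; last exact: pk_herm.
by ring.
Qed.

Let q_scal c s : q (fscal c s) = complex.Re `|c| ^+ 2 * q s.
Proof.
by rewrite {1}/q kform_scall kform_scalr mulrA -normCK cnormE -RCX ReZ.
Qed.

(* The function f is bounded with square norm at most M. *)
Let bd (M : R) f := forall s, 2 * complex.Re (keval f s) - q s <= M.

Let bd_ge0 M f : bd M f -> 0 <= M.
Proof.
by move=> /(_ [::]); rewrite /q /keval /kform !big_nil /= mulr0 subrr.
Qed.

Let bd_sq M f s : bd M f -> complex.Re `|keval f s| ^+ 2 <= M * q s.
Proof.
move=> fM; set z := keval f s.
pose c : R[i] := z / `|z|.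
have cz : c^* * z = `|z|.
  rewrite /c; have [->|z0] := eqVneq z 0; first by rewrite mulr0 normr0.
  rewrite rmorphM /= fmorphV /= [`|z|^*]conj_Creal ?normr_real//.
  by rewrite mulrAC (mulrC z^*) -normCK expr2 mulfK// normr_eq0.
have c1 : complex.Re `|c| <= 1.
  rewrite /c; have [->|z0] := eqVneq z 0; first by rewrite mul0r normr0.
  by rewrite normrM normfV normr_id divff// normr_eq0.
apply: discr_le => r; have := fM (fscal (- r%:C * c) s).
rewrite keval_scal rmorphM /= rmorphN /= conj_RC -mulrA cz -RCN ReZ q_scal.
rewrite cnormM cnorm_RC normrN exprMn real_normK ?num_real//.
have : r ^+ 2 * complex.Re `|c| ^+ 2 * q s <= r ^+ 2 * q s.
  rewrite ler_wpM2r ?q_ge0// ler_piMr ?sqr_ge0// exprn_ile1 ?cnorm_ge0//.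
by rewrite -[Normc.normc z]/(complex.Re `|z|); lra.
Qed.

Let sq_bd M f : 0 <= M ->
  (forall s, complex.Re `|keval f s| ^+ 2 <= M * q s) -> bd M f.
Proof.
move=> M0 fM s; have := fM s; have := Re_le_cnorm (keval f s).
have := cnorm_ge0 (keval f s); have := q_ge0 s.
move: (complex.Re `|keval f s|) (complex.Re (keval f s)) (q s).
move=> a b c c0 a0 ba ac.
have h : (2 * a) ^+ 2 <= (M + c) ^+ 2.
  have := sqr_ge0 (M - c); nra.
have : 2 * a <= M + c.
  by rewrite -(@ler_pXn2r _ 2) ?nnegrE ?addr_ge0 ?mulr_ge0.
by lra.
Qed.

(** The Hilbert space of the kernel, without a completion: it consists of the
    functions f for which 2 Re <f, s> - |s|^2 is bounded over the formal
    combinations s, and the least upper bound is the square of the norm. It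
    provides vectors with any prescribed positive matrix of inner products. *)
Definition rkhs_pred : {pred X -> R[i]} := fun f => `[< exists M, bd M f >].

Lemma rkhs_submod : submod_closed rkhs_pred.
Proof.
split.
  apply/asboolP; exists 0; apply: sq_bd => // s.
  by rewrite /keval big1 ?normr0 ?expr0n/= ?mul0r// => p _; rewrite mulr0.
move=> c f g /asboolP[M fM] /asboolP[N gN]; apply/asboolP.
exists (2 * (complex.Re `|c| ^+ 2 * M + N)); apply: sq_bd => [|s].
  by rewrite mulr_ge0 ?addr_ge0 ?mulr_ge0 ?(bd_ge0 fM) ?(bd_ge0 gN) ?exprn_ge0 ?cnorm_ge0.
rewrite kevalD kevalZ.
have h : complex.Re `|c * keval f s + keval g s| <=
    complex.Re `|c| * complex.Re `|keval f s| + complex.Re `|keval g s|.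
  by rewrite -cnormM cnormD.
have := bd_sq s fM; have := bd_sq s gN; move: h.
have := cnorm_ge0 (c * keval f s + keval g s).
move: (complex.Re `|c|) (complex.Re `|keval f s|) (complex.Re `|keval g s|)
  (complex.Re `| _ |) => a b d e e0 eabd gb fb.
apply: (@le_trans _ _ ((a * b + d) ^+ 2)).
  by rewrite ler_pXn2r ?nnegrE// (le_trans e0).
have := sqr_ge0 (a * b - d).
have : a ^+ 2 * b ^+ 2 <= a ^+ 2 * (M * q s) by rewrite ler_wpM2l ?sqr_ge0.
by nra.
Qed.

HB.instance Definition _ :=
  GRing.isSubmodClosed.Build R[i] (X -> R[i]) rkhs_pred rkhs_submod.

Record rkhs := Rkhs { rkhs_fun :> X -> R[i] ; _ : rkhs_fun \in rkhs_pred }.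

HB.instance Definition _ := [isSub for rkhs_fun].
HB.instance Definition _ := [Choice of rkhs by <:].
HB.instance Definition _ := [SubChoice_isSubLmodule of rkhs by <:].

Implicit Types (u v : rkhs).

Lemma rkhsP u v : (forall x, u x = v x) -> u = v.
Proof. by move=> E; apply/val_inj/funext. Qed.

Let Qset f := [set 2 * complex.Re (keval f s) - q s | s in [set: seq (R[i] * X)]].
Let Q u := sup (Qset u).

Let Qhas u : has_sup (Qset u).
Proof.
split; first by exists (2 * complex.Re (keval u [::]) - q [::]), [::].
by case: u => f /= /asboolP[M fM]; exists M => _ [s _ <-].
Qed.

Let Qbd u : bd (Q u) u.
Proof. by move=> s; apply: ub_le_sup; [case: (Qhas u)|exists s]. Qed.

Let Qle u M : bd M u -> Q u <= M.
Proof. by move=> h; apply: ge_sup; [case: (Qhas u)|move=> _ [s _ <-]]. Qed.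

Let Q_ge0 u : 0 <= Q u. Proof. exact: bd_ge0 (@Qbd u). Qed.

Let QZ_le (c : R[i]) u : Q (c *: u) <= complex.Re `|c| ^+ 2 * Q u.
Proof.
apply: Qle; apply: sq_bd => [|s]; first by rewrite mulr_ge0 ?exprn_ge0 ?cnorm_ge0.
rewrite kevalZ cnormM exprMn -[leRHS]mulrA ler_wpM2l ?exprn_ge0 ?cnorm_ge0//.
exact: bd_sq (@Qbd u).
Qed.

Let QZ (c : R[i]) u : Q (c *: u) = complex.Re `|c| ^+ 2 * Q u.
Proof. exact: homogeneous_of_le Q_ge0 QZ_le c u. Qed.

(* Combinations s and t for u + v and u - v give the combinations (s + t) / 2
   for u and (s - t) / 2 for v. *)
Let Qpar_le u v : Q (u + v) + Q (u - v) <= 2 * Q u + 2 * Q v.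
Proof.
rewrite -lerBrDr; apply: Qle => s; rewrite lerBrDr addrC -lerBrDr.
apply: Qle => t; rewrite lerBrDr.
have e1 := @Qbd u (fscal (2^-1 : R)%:C (s ++ t)).
have e2 := @Qbd v (fscal (2^-1 : R)%:C (s ++ fscal (-1) t)).
move: e1 e2; rewrite !(keval_scal, keval_cat, q_scal, q_cat) !(kevalD, conj_RC) !ReZ.
have -> : keval (- v) t = - keval v t by rewrite -scaleN1r kevalZ mulN1r.
rewrite kform_scalr cnorm_RC !conjN1 !mulN1r !ReD !ReN normrN1 /=.
rewrite ger0_norm ?invr_ge0//.
by rewrite expr1n mul1r !expr2; lra.
Qed.

Let Qpar u v : Q (u + v) + Q (u - v) = 2 * Q u + 2 * Q v.
Proof.
apply/eqP; rewrite eq_le Qpar_le andTb.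
have dbl w : Q (w + w) = 4 * Q w.
  have -> : w + w = (2 : R)%:C *: w by rewrite RCD scalerDl scale1r.
  by rewrite QZ cnorm_RC ger0_norm//; ring.
have := Qpar_le (u + v) (u - v).
rewrite addrACA subrr addr0 opprD opprK addrACA subrr add0r !dbl.
by lra.
Qed.

Let Qx u x : complex.Re `|u x| ^+ 2 <= Q u * q [:: (1, x)].
Proof.
have := bd_sq [:: (1, x)] (@Qbd u).
by rewrite {1}/keval big_seq1 conjC1 mul1r.
Qed.

Let Q_eq0 u : Q u = 0 -> u = 0.
Proof.
move=> u0; apply: rkhsP => x; have := Qx u x; rewrite u0 mul0r => h.
have : complex.Re `|u x| = 0.
  by apply/eqP; rewrite -sqrf_eq0 eq_le h sqr_ge0.
by move=> h'; apply/eqP; rewrite -normr_eq0 cnormE h'.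
Qed.

Let Q_complete (u : nat -> rkhs) : rcauchy Q u -> exists l, rlim Q u l.
Proof.
move=> cu.
have pw x : rcauchy (fun c : R[i] => complex.Re `|c|) (fun n => u n x).
  move=> e e0; pose d := q [:: (1, x)] + 1.
  have d0 : 0 < d by rewrite ltr_pwDr ?q_ge0.
  have [|N NP] := cu (e ^+ 2 / d); first by rewrite divr_gt0 ?exprn_gt0.
  exists N => m j Nm Nj.
  rewrite -(@ler_pXn2r _ 2) ?nnegrE ?(ltW e0) ?cnorm_ge0//.
  rewrite (le_trans (Qx (u m - u j) x))//.
  rewrite (@le_trans _ _ (e ^+ 2 / d * d))//; last by rewrite mulfVK// gt_eqF.
  by rewrite ler_pM ?Q_ge0 ?q_ge0 ?NP// lerDl.
have /choice[l lP] : forall x, exists c, rlim (fun c : R[i] => complex.Re `|c|) (fun n => u n x) c.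
  by move=> x; apply: complex_cauchy_lim.
have evl s : rlim (fun c : R[i] => complex.Re `|c|) (fun n => keval (u n) s) (keval l s).
  elim: s => [|p s IH] e e0.
    by exists 0%N => m _; rewrite /keval !big_nil subrr normr0 ltW.
  pose d := complex.Re `|p.1^*| + 1.
  have d0 : 0 < d by rewrite ltr_pwDr ?cnorm_ge0.
  have [N1 N1P] := IH _ (divr_gt0 e0 (ltr0Sn R 1)).
  have [|N2 N2P] := lP p.2 (e / 2 / d); first by rewrite !divr_gt0.
  exists (maxn N1 N2) => m; rewrite geq_max => /andP[m1 m2].
  rewrite /keval !big_cons -!/(keval _ _) opprD addrACA -mulrBr.
  rewrite (le_trans (cnormD _ _))// cnormM.
  rewrite [leRHS]splitr lerD ?N1P//.
  rewrite (@le_trans _ _ (d * (e / 2 / d)))//; last by rewrite mulrC mulfVK// gt_eqF.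
  by rewrite ler_pM ?cnorm_ge0 ?N2P// lerDl.
have lim_bd (e : R) : 0 < e -> exists N, forall m, (N <= m)%N -> bd e (val (u m) - l).
  move=> e0; have [N NP] := cu e e0; exists N => m Nm s.
  apply/ler_addgt0Pr => d d0.
  have [N' N'P] := evl s _ (divr_gt0 d0 (ltr0Sn R 1)).
  pose j := maxn N N'.
  have h1 := @Qbd (u m - u j) s; have h2 := NP m j Nm (leq_maxl _ _).
  have h3 := N'P j (leq_maxr _ _); have h4 := Re_le_cnorm (keval (u j) s - keval l s).
  have ev f g : keval (f - g) s = keval f s - keval g s.
    by rewrite kevalD -scaleN1r kevalZ mulN1r.
  move: h1 h4; rewrite (ev (val (u m)) (val (u j))) (ev (val (u m)) l) !ReB; lra.
have [N0 N0P] := lim_bd 1 ltr01.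
have lpred : l \in rkhs_pred.
  have : val (u N0) \in rkhs_pred by exact: valP.
  have : val (u N0) - l \in rkhs_pred by apply/asboolP; exists 1; apply: N0P.
  move=> h1 h2; have -> : l = val (u N0) - (val (u N0) - l) by rewrite opprB addrC subrK.
  exact: rpredB.
exists (Rkhs lpred) => e /lim_bd[N NP]; exists N => m Nm.
by apply: Qle; exact: NP.
Qed.

HB.instance Definition _ := Lmodule_isRHilbert.Build R rkhs
  Q_ge0 QZ Qpar Q_eq0 Q_complete.

Lemma kvec_rkhs s : kvec k s \in rkhs_pred.
Proof.
apply/asboolP; exists (q s) => t; rewrite keval_kvec.
have := q_ge0 (s ++ fscal (-1) t); rewrite q_cat q_scal kform_scalr.
by rewrite rmorphN1 mulN1r ReN normrN1 /= expr1n mul1r; lra.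
Qed.

Definition rvec s : rkhs := Rkhs (kvec_rkhs s).

Let rnQ u : rnorm u ^+ 2 = Q u.
Proof. by rewrite -[RHS]sqr_sqrtr ?Q_ge0. Qed.

(* Both inequalities between the two sides come from this one, because adding
   s and then -s changes nothing. *)
Let Q_add_le u s :
  Q (u + rvec s) <= Q u + 2 * complex.Re (keval u s) + q s.
Proof.
apply: Qle => t; have := @Qbd u (t ++ fscal (-1) s).
rewrite (kevalD u) q_cat q_scal kform_scalr keval_cat keval_scal (keval_kvec k s t).
rewrite (kformC t s (@pk_herm _ _ k)) conjN1 !mulN1r !(ReD, ReN) ReJ.
by rewrite normrN1 /= expr1n mul1r; lra.
Qed.

Let Q_add u s : Q (u + rvec s) = Q u + 2 * complex.Re (keval u s) + q s.
Proof.
apply/eqP; rewrite eq_le Q_add_le andTb.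
have := Q_add_le (u + rvec s) (fscal (-1) s).
have -> : u + rvec s + rvec (fscal (-1) s) = u.
  rewrite -addrA -[RHS]addr0; congr (_ + _); apply: rkhsP => y.
  rewrite -[LHS]/(kvec k s y + kvec k (fscal (-1) s) y) /kvec big_map -big_split.
  by rewrite big1// => p _ /=; rewrite mulN1r mulNr subrr.
rewrite (kevalD u) q_scal !keval_scal (keval_kvec k s s) conjN1 !mulN1r.
by rewrite normrN1 /= expr1n mul1r ReD !ReN -/(q s); lra.
Qed.

Lemma rkhs_rnorm s : rnorm (rvec s) ^+ 2 = complex.Re (kform k s s).
Proof.
rewrite rnQ; have := Q_add 0 s; rewrite add0r => ->.
rewrite -rnQ rnorm0 expr0n /= add0r /keval big1 ?mulr0 ?add0r//.
by move=> p _; rewrite mulr0.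
Qed.

(** The reproducing property. *)
Lemma rkhs_dot u s : dot u (rvec s) = keval u s.
Proof.
have reE v : complex.Re (dot v (rvec s)) = complex.Re (keval v s).
  have := rnormD_sqr v (rvec s); rewrite rkhs_rnorm !rnQ Q_add; lra.
have := reE u; have := reE ((- 'i) *: u).
rewrite dotZl (kevalZ (- 'i) u).
case: (dot u _) (keval u s) => a b [a' b'] /=; rewrite !(oppr0, mul0r, mulN1r, sub0r, opprK).
by move=> -> ->.
Qed.

Lemma rkhs_rnorm_le u M : 0 <= M ->
  (forall s, complex.Re `|keval u s| <= M * rnorm (rvec s)) -> rnorm u <= M.
Proof.
move=> M0 h; rewrite -(@ler_pXn2r _ 2) ?nnegrE ?rnorm_ge0// rnQ.
apply: Qle; apply: sq_bd => [|s]; first by rewrite exprn_ge0.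
by rewrite -[q s]rkhs_rnorm -exprMn ler_pXn2r ?nnegrE ?cnorm_ge0 ?mulr_ge0 ?rnorm_ge0.
Qed.

Lemma rkhs_mem f M : 0 <= M ->
  (forall s, complex.Re `|keval f s| <= M * rnorm (rvec s)) -> f \in rkhs_pred.
Proof.
move=> M0 h; apply/asboolP; exists (M ^+ 2); apply: sq_bd => [|s].
  by rewrite exprn_ge0.
by rewrite -[q s]rkhs_rnorm -exprMn ler_pXn2r ?nnegrE ?cnorm_ge0 ?mulr_ge0 ?rnorm_ge0.
Qed.

Definition relem x : rkhs := rvec [:: (1, x)].

Lemma rkhs_dot_elem u x : dot u (relem x) = u x.
Proof. by rewrite rkhs_dot /keval big_seq1 conjC1 mul1r. Qed.

Lemma dot_elem x y : dot (relem x) (relem y) = k x y.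
Proof. by rewrite rkhs_dot_elem /= /kvec big_seq1 mul1r. Qed.

End RKHS.

(** * Positive kernels and operators given on generators *)

Section PositiveKernels.
Variable R : realType.
Implicit Types X Y : Type.

Lemma psd_ext X (k l : X -> X -> R[i]) : (forall x y, k x y = l x y) ->
  psd k -> psd l.
Proof.
move=> kl pk s; rewrite (_ : kform l s s = kform k s s)//.
by apply: eq_bigr => p _; apply: eq_bigr => r _; rewrite kl.
Qed.

Lemma psd_gram X (H : hilbertType R) (e : X -> H) :
  psd (fun x y => dot (e x) (e y)).
Proof.
move=> s; rewrite (_ : kform _ s s =
  dot (\sum_(p <- s) p.1 *: e p.2) (\sum_(p <- s) p.1 *: e p.2)).
  by rewrite dotxx ler0c exprn_ge0 ?rnorm_ge0.
rewrite dot_suml; apply: eq_bigr => p _; rewrite dot_sumr.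
by apply: eq_bigr => r _; rewrite dotZl dotZr mulrA.
Qed.

Lemma psd_comp X Y (f : X -> Y) (k : Y -> Y -> R[i]) :
  psd k -> psd (fun x y => k (f x) (f y)).
Proof.
move=> pk s; have := pk [seq (p.1, f p.2) | p <- s].
rewrite /kform big_map.
by under eq_bigr do rewrite big_map.
Qed.

(** The kernel of an orthogonal direct sum. *)
Lemma psd_dsum (I : Type) X (k : I -> X -> X -> R[i]) :
  (forall i, psd (k i)) ->
  psd (fun x y : I * X => if `[< x.1 = y.1 >] then k x.1 x.2 y.2 else 0).
Proof.
move=> pk; pose T := {classic I} : eqType.
move=> s; pose idx := undup [seq (p.2.1 : T) | p <- s].
have idxP p : List.In p s -> (p.2.1 : T) \in idx.
  rewrite mem_undup; elim: s {idx} => //= q s IH [->|/IH h].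
    by rewrite inE eqxx.
  by rewrite inE h orbT.
have -> : kform (fun x y : I * X => if `[< x.1 = y.1 >] then k x.1 x.2 y.2 else 0) s s
   = \sum_(i <- idx) kform (k i)
       [seq (p.1, p.2.2) | p <- s & (p.2.1 : T) == i]
       [seq (p.1, p.2.2) | p <- s & (p.2.1 : T) == i].
  rewrite /kform.
  have split_idx (F : R[i] * (I * X) -> R[i]) (t : seq (R[i] * (I * X))) :
      (forall p, List.In p t -> (p.2.1 : T) \in idx) ->
      \sum_(p <- t) F p = \sum_(i <- idx) \sum_(p <- t | (p.2.1 : T) == i) F p.
    elim: t => [_|p t IH h]; first by rewrite big_nil big1// => i _; rewrite big_nil.
    rewrite big_cons IH; last by move=> q qt; apply: h; right.
    rewrite (bigD1_seq (p.2.1 : T)) ?undup_uniq//=; last by apply: h; left.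
    rewrite [in RHS](bigD1_seq (p.2.1 : T)) ?undup_uniq//=; last by apply: h; left.
    rewrite [in RHS]big_cons eqxx -!addrA; congr (_ + (_ + _)).
    apply: eq_bigr => i /negPf ni; rewrite [in RHS]big_cons.
    by rewrite eq_sym in ni; rewrite ni.
  rewrite split_idx//; apply: eq_bigr => i _.
  rewrite big_map big_filter; apply: eq_bigr => p /eqP pi.
  rewrite big_map big_filter [RHS]big_mkcond /=; apply: eq_bigr => r _.
  rewrite pi; case: asboolP => [->|ne]; first by rewrite eqxx.
  by case: eqP => [e|_]; [case: ne|rewrite mulr0].
by apply: sumr_ge0 => i _; apply: pk.
Qed.

(** The Schur product theorem. Only finitely many vectors enter a value of the
    quadratic form, and over an orthonormal basis of their span the product
    kernel splits into a sum of copies of k with rescaled coefficients. *)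
Lemma psd_schur X (H : hilbertType R) (k : X -> X -> R[i]) (e : X -> H) :
  psd k -> psd (fun x y => k x y * dot (e x) (e y)).
Proof.
move=> pk s; have [es esP] := gram_schmidt [seq e p.2 | p <- s].
have inE p : List.In p s -> e p.2 \in [seq e p.2 | p <- s].
  elim: (s) => //= q t IH [->|/IH h]; first by rewrite mem_head.
  by rewrite seq.inE h orbT.
have -> : kform (fun x y => k x y * dot (e x) (e y)) s s = \sum_(m <- es)
    kform k [seq (p.1 * dot (e p.2) m, p.2) | p <- s]
            [seq (p.1 * dot (e p.2) m, p.2) | p <- s].
  rewrite {1}/kform.
  transitivity (\sum_(p <- s) \sum_(m <- es) \sum_(r <- s)
     (p.1 * dot (e p.2) m) * (r.1 * dot (e r.2) m)^* * k p.2 r.2).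
    have eq_In (t : seq (R[i] * X)) (F G : R[i] * X -> R[i]) :
        (forall p, List.In p t -> F p = G p) -> \sum_(p <- t) F p = \sum_(p <- t) G p.
      elim: t => [|p t IH] h; first by rewrite !big_nil.
      by rewrite !big_cons IH ?h//; [left|move=> q qt; apply: h; right].
    apply: eq_In => p ps; rewrite exchange_big /=; apply: eq_bigr => r _.
    rewrite (esP _ _ (inE p ps)) !mulr_sumr; apply: eq_bigr => m _.
    rewrite rmorphM /= -dotC.
    move: (dot _ m) (dot m _) (k _ _) => a b c; ring.
  rewrite exchange_big /=; apply: eq_bigr => m _; rewrite /kform big_map.
  by apply: eq_bigr => p _; rewrite big_map.
by apply: sumr_ge0 => m _; apply: pk.
Qed.

(** This is how boundedness of an operator that is given on generators is
    expressed. *)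
Lemma psd_subgram X (H H' : hilbertType R) (M : R) (e : X -> H) (T : X -> H') :
  psd (fun x y => (M ^+ 2)%:C * dot (e x) (e y) - dot (T x) (T y)) <->
  forall s : seq (R[i] * X),
    rnorm (\sum_(p <- s) p.1 *: T p.2) ^+ 2 <=
    M ^+ 2 * rnorm (\sum_(p <- s) p.1 *: e p.2) ^+ 2.
Proof.
have E (s : seq (R[i] * X)) :
    kform (fun x y => (M ^+ 2)%:C * dot (e x) (e y) - dot (T x) (T y)) s s =
    (M ^+ 2 * rnorm (\sum_(p <- s) p.1 *: e p.2) ^+ 2
      - rnorm (\sum_(p <- s) p.1 *: T p.2) ^+ 2)%:C.
  rewrite RCB RCM -!dotxx !dot_suml mulr_sumr -sumrB; apply: eq_bigr => p _.
  rewrite !dot_sumr mulr_sumr -sumrB; apply: eq_bigr => r _.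
  rewrite !dotZl !dotZr; move: (dot _ _) (dot (T _) _) => a b; ring.
by split=> h s; have := h s; rewrite E ?ler0c subr_ge0.
Qed.

End PositiveKernels.

Section OperatorsOnGenerators.
Variables (R : realType) (X : Type) (H : hilbertType R) (e : X -> H).

Definition total_family := forall v, (forall x, dot v (e x) = 0) -> v = 0.

Let gram : pkernel R X.
Proof.
apply: (@PKernel R X (fun x y => dot (e x) (e y))).
- by move=> x y; rewrite -dotC.
- exact: psd_gram.
Defined.

Let keval_dot (v : H) s :
  keval (fun x => dot v (e x)) s = dot v (\sum_(p <- s) p.1 *: e p.2).
Proof. by rewrite dot_sumr; apply: eq_bigr => p _; rewrite dotZr. Qed.

Let rnorm_rvec s : rnorm (rvec gram s) = rnorm (\sum_(p <- s) p.1 *: e p.2).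
Proof.
apply/eqP; rewrite -(@eqrXn2 _ 2) ?rnorm_ge0//; apply/eqP.
rewrite rkhs_rnorm; apply: complexI; rewrite -dotxx -ge0_RRe; last exact: (pk_psd gram).
rewrite dot_suml; apply: eq_bigr => p _; rewrite dot_sumr.
by apply: eq_bigr => r _; rewrite dotZl dotZr mulrA.
Qed.

Variables (T : X -> H) (M : R).
Hypotheses (M0 : 0 <= M)
  (TM : psd (fun x y => (M ^+ 2)%:C * dot (e x) (e y) - dot (T x) (T y))).

Let TM' s : rnorm (\sum_(p <- s) p.1 *: T p.2) <=
  M * rnorm (\sum_(p <- s) p.1 *: e p.2).
Proof.
rewrite -(@ler_pXn2r _ 2) ?nnegrE ?mulr_ge0 ?rnorm_ge0// exprMn.
by move/psd_subgram : TM; apply.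
Qed.

(** The operator is obtained without any passage to the limit. Both w |->
    <w, T x> and w |-> <w, e x> map H into the reproducing kernel space of
    the family e; the operator is the adjoint of the first map after the
    second one. *)
Lemma bop_ext_exists : exists F : bop H, (forall x, F (e x) = T x) /\
  forall v, rnorm (F v) <= M * rnorm v.
Proof.
have memT w : (fun x => dot w (T x)) \in rkhs_pred gram.
  apply: (@rkhs_mem _ _ _ _ (rnorm w * M)) => [|s].
    by rewrite mulr_ge0 ?rnorm_ge0.
  have -> : keval (fun x => dot w (T x)) s = dot w (\sum_(p <- s) p.1 *: T p.2).
    by rewrite dot_sumr; apply: eq_bigr => p _; rewrite dotZr.
  rewrite (le_trans (cnorm_dot _ _))// -mulrA ler_wpM2l ?rnorm_ge0//.
  by rewrite rnorm_rvec TM'.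
have meme v : (fun x => dot v (e x)) \in rkhs_pred gram.
  apply: (@rkhs_mem _ _ _ _ (rnorm v)) => [|s]; first exact: rnorm_ge0.
  by rewrite keval_dot (le_trans (cnorm_dot _ _))// rnorm_rvec.
pose A w : rkhs gram := Rkhs (memT w).
pose E v : rkhs gram := Rkhs (meme v).
have lA : linear A.
  by move=> c u v; apply: rkhsP => x /=; rewrite dotDl dotZl.
have lE : linear E.
  by move=> c u v; apply: rkhsP => x /=; rewrite dotDl dotZl.
have nA w : rnorm (A w) <= M * rnorm w.
  apply: rkhs_rnorm_le => [|s]; first by rewrite mulr_ge0 ?rnorm_ge0.
  have -> : keval (A w) s = dot w (\sum_(p <- s) p.1 *: T p.2).
    by rewrite dot_sumr; apply: eq_bigr => p _; rewrite dotZr.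
  rewrite (le_trans (cnorm_dot _ _))// mulrAC mulrC ler_wpM2r ?rnorm_ge0//.
  by rewrite rnorm_rvec TM'.
have nE v : rnorm (E v) <= rnorm v.
  apply: rkhs_rnorm_le => [|s]; first exact: rnorm_ge0.
  by rewrite keval_dot (le_trans (cnorm_dot _ _))// rnorm_rvec.
have [S [lS SA nS]] := adjoint_exists lA nA.
rewrite ger0_norm// in nS.
have nF v : rnorm (S (E v)) <= M * rnorm v.
  by rewrite (le_trans (nS _))// ler_wpM2l // nE.
have Fop : S \o E \in @bounded_op R H.
  apply/asboolP; split; first by move=> c u v /=; rewrite lE lS.
  by exists M => v /=; rewrite !rnormE -RCM lecR nF.
exists (Bop Fop); split => [x|v]; last exact: nF.
apply: dot_inj => w /=; rewrite -SA.
have -> : E (e x) = relem gram x.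
  by apply: rkhsP => y; rewrite -[RHS]rkhs_dot_elem dot_elem.
by rewrite rkhs_dot_elem.
Qed.

Definition bop_ext : bop H := projT1 (cid bop_ext_exists).

Lemma bop_extE x : bop_ext (e x) = T x.
Proof. by rewrite /bop_ext; case: cid => F []. Qed.

Lemma bop_ext_le v : rnorm (bop_ext v) <= M * rnorm v.
Proof. by rewrite /bop_ext; case: cid => F []. Qed.

End OperatorsOnGenerators.

Section TotalFamilies.
Variables (R : realType) (X : Type) (H : hilbertType R) (e : X -> H).
Hypothesis te : total_family e.
Implicit Types S T : bop H.

Lemma total_inj (u v : H) : (forall x, dot u (e x) = dot v (e x)) -> u = v.
Proof.
by move=> h; apply/eqP; rewrite -subr_eq0; apply/eqP/te => x; rewrite dotBl h subrr.
Qed.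

(** Generators determine an operator although no density is known: the adjoints
    agree because the family separates points. *)
Lemma bop_total_eq S T : (forall x, S (e x) = T (e x)) -> S = T.
Proof.
move=> h; apply: (can_inj (@adjK R H)); apply: bopP => v.
by apply: total_inj => x; rewrite -!adjPr h.
Qed.

Lemma bop_total_adj S T :
  (forall x y, dot (T (e x)) (e y) = dot (e x) (S (e y))) -> adj T = S.
Proof.
move=> h; apply: bop_total_eq => y; apply: total_inj => x.
by rewrite dotC -adjP h -dotC.
Qed.

(** A bound on combinations of the generators is a bound everywhere: the
    operator that extends the values on generators with this bound is T. *)
Lemma bop_total_le T (M : R) : 0 <= M ->
  psd (fun x y => (M ^+ 2)%:C * dot (e x) (e y) - dot (T (e x)) (T (e y))) ->
  forall v, rnorm (T v) <= M * rnorm v.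
Proof.
move=> M0 h v; have -> : T = bop_ext M0 h; last exact: bop_ext_le.
by apply: bop_total_eq => x; rewrite bop_extE.
Qed.

End TotalFamilies.

Lemma total_relem (R : realType) (X : Type) (k : pkernel R X) : total_family (relem k).
Proof. by move=> v h; apply: rkhsP => x; rewrite -rkhs_dot_elem h. Qed.

(** * The C*-algebra of bounded operators *)

Section OperatorNorm.
Variables (R : realType) (H : hilbertType R).
Implicit Types (S T : bop H) (x y : H).

Let onset T := [set rnorm (T x) | x in [set x | rnorm x <= 1]].

Lemma bop_rbounded T : exists2 M : R, 0 <= M & forall x, rnorm (T x) <= M * rnorm x.
Proof.
have [M TM] := bop_bounded T; exists `|M| => // x.
rewrite (@le_trans _ _ (M * rnorm x))//; last by rewrite ler_wpM2r ?rnorm_ge0 ?ler_norm.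
by rewrite -lecR RCM -!rnormE TM.
Qed.

Let onset_has T : has_sup (onset T).
Proof.
split; first by exists (rnorm (T 0)), 0 => //=; rewrite rnorm0.
have [M M0 TM] := bop_rbounded T; exists M => _ [x /= x1 <-].
by rewrite (le_trans (TM x))// ler_piMr.
Qed.

Lemma opnorm_ge0 T : 0 <= opnorm T.
Proof.
apply: (@le_trans _ _ (rnorm (T 0))); first exact: rnorm_ge0.
by apply: ub_le_sup; [case: (onset_has T)|exists 0 => //=; rewrite rnorm0].
Qed.

Lemma opnormP T x : rnorm (T x) <= opnorm T * rnorm x.
Proof.
have [x0|xN] := eqVneq (rnorm x) 0.
  by rewrite (rnorm_eq0 x0) linear0 !rnorm0 mulr0.
have xp : 0 < rnorm x by rewrite lt_neqAle eq_sym xN rnorm_ge0.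
rewrite -ler_pdivrMr//; apply: ub_le_sup; first by case: (onset_has T).
exists ((rnorm x)^-1%:C *: x) => /=.
  by rewrite rnormZr ger0_norm ?invr_ge0 ?rnorm_ge0// mulVf.
by rewrite linearZ rnormZr ger0_norm ?invr_ge0 ?rnorm_ge0// mulrC.
Qed.

Lemma opnorm_le T M : 0 <= M -> (forall x, rnorm (T x) <= M * rnorm x) ->
  opnorm T <= M.
Proof.
move=> M0 TM; apply: ge_sup; first by case: (onset_has T).
by move=> _ [x /= x1 <-]; rewrite (le_trans (TM x))// ler_piMr.
Qed.

Lemma opnormD S T : opnorm (S + T) <= opnorm S + opnorm T.
Proof.
apply: opnorm_le => [|x]; first by rewrite addr_ge0 ?opnorm_ge0.
by rewrite bopDE (le_trans (rnormD _ _))// mulrDl lerD ?opnormP.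
Qed.

Let opnormZ_le (c : R[i]) T : opnorm (c *: T) <= complex.Re `|c| * opnorm T.
Proof.
apply: opnorm_le => [|x]; first by rewrite mulr_ge0 ?opnorm_ge0 ?cnorm_ge0.
by rewrite bopZE rnormZ -mulrA ler_wpM2l ?cnorm_ge0 ?opnormP.
Qed.

Lemma opnorm0 : opnorm (0 : bop H) = 0.
Proof.
apply/eqP; rewrite eq_le opnorm_ge0 andbT.
by apply: opnorm_le => // x; rewrite mul0r -[_ x]/(0 : H) rnorm0.
Qed.

Lemma opnormZ (c : R[i]) T : opnorm (c *: T) = complex.Re `|c| * opnorm T.
Proof. exact: (@homogeneous_of_le _ _ _ 0 opnorm_ge0 opnormZ_le). Qed.

Lemma opnorm_eq0 T : opnorm T = 0 -> T = 0.
Proof.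
move=> T0; apply: bopP => x; rewrite -[RHS]/(0 : H); apply: rnorm_eq0; apply/eqP.
by rewrite eq_le rnorm_ge0 andbT -(mul0r (rnorm x)) -T0 opnormP.
Qed.

Lemma opnormM S T : opnorm (smul S T) <= opnorm S * opnorm T.
Proof.
apply: opnorm_le => [|x]; first by rewrite mulr_ge0 ?opnorm_ge0.
by rewrite /= (le_trans (opnormP _ _))// -mulrA ler_wpM2l ?opnorm_ge0 ?opnormP.
Qed.

Let opnorm_sq_le T : opnorm T ^+ 2 <= opnorm (smul (star T) T).
Proof.
set K := opnorm (smul _ _); have K0 : 0 <= K := opnorm_ge0 _.
rewrite -[K]sqr_sqrtr// ler_pXn2r ?nnegrE ?opnorm_ge0 ?sqrtr_ge0//.
apply: opnorm_le => [|x]; first exact: sqrtr_ge0.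
rewrite -(@ler_pXn2r _ 2) ?nnegrE ?mulr_ge0 ?sqrtr_ge0 ?rnorm_ge0//.
rewrite exprMn sqr_sqrtr//.
have -> : rnorm (T x) ^+ 2 = complex.Re (dot (smul (star T) T x) x).
  by rewrite [_ x]/= dotC -adjP -dotC dotxx.
rewrite (le_trans (Re_dot_le _ _))// expr2 mulrA.
by rewrite ler_wpM2r ?rnorm_ge0 ?opnormP.
Qed.

Let opnorm_adj_le T : opnorm T <= opnorm (star T).
Proof.
have [T0|TN] := eqVneq (opnorm T) 0; first by rewrite T0 opnorm_ge0.
have Tp : 0 < opnorm T by rewrite lt_neqAle eq_sym TN opnorm_ge0.
rewrite -(ler_pM2r Tp) -expr2; apply: le_trans (opnorm_sq_le T) _.
exact: opnormM.
Qed.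

Lemma opnorm_adj T : opnorm (adj T) = opnorm T.
Proof.
apply/eqP; rewrite eq_le -[X in _ <= opnorm X]adjK -{1}[T]adjK.
by rewrite !opnorm_adj_le -[adj T]/(star T) {2}/star /= adjK opnorm_adj_le.
Qed.

Lemma opnorm_star_mul T : opnorm (smul (star T) T) = opnorm T ^+ 2.
Proof.
apply/eqP; rewrite eq_le opnorm_sq_le andbT (le_trans (opnormM _ _))//.
by rewrite -[star T]/(adj T) opnorm_adj expr2.
Qed.

Lemma bop_complete (u : nat -> bop H) : rcauchy (@opnorm R H) u ->
  exists l, rlim (@opnorm R H) u l.
Proof.
move=> cu.
have pw x : rcauchy (@rnorm R H) (fun n => u n x).
  move=> e e0; pose d := rnorm x + 1.
  have d0 : 0 < d by rewrite ltr_pwDr ?rnorm_ge0.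
  have [N NP] := cu _ (divr_gt0 e0 d0).
  exists N => m j Nm Nj; rewrite (le_trans (opnormP (u m - u j) x))//.
  rewrite (@le_trans _ _ (e / d * d))//; last by rewrite mulfVK// gt_eqF.
  by rewrite ler_pM ?opnorm_ge0 ?rnorm_ge0 ?NP// lerDl.
have /choice[l lP] : forall x, exists y, rlim (@rnorm R H) (fun n => u n x) y.
  by move=> x; exact: rcauchy_lim (pw x).
have ll : linear l.
  move=> c x y; apply: rnorm_small => e e0.
  pose d := complex.Re `|c| + 1.
  have d0 : 0 < d by rewrite ltr_pwDr ?cnorm_ge0.
  have e3 : 0 < e / 3 by rewrite divr_gt0.
  have [N1 N1P] := lP (c *: x + y) _ e3.
  have [|N2 N2P] := lP x (e / 3 / d); first by rewrite divr_gt0.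
  have [N3 N3P] := lP y _ e3.
  pose n := maxn N1 (maxn N2 N3).
  have h1 := N1P n (leq_maxl _ _).
  have h2 := N2P n (leq_trans (leq_maxl _ _) (leq_maxr _ _)).
  have h3 := N3P n (leq_trans (leq_maxr _ _) (leq_maxr _ _)).
  have -> : l (c *: x + y) - (c *: l x + l y) =
     - (u n (c *: x + y) - l (c *: x + y)) + (c *: (u n x - l x) + (u n y - l y)).
    have -> : c *: (u n x - l x) + (u n y - l y) = u n (c *: x + y) - (c *: l x + l y).
      by rewrite linearP scalerBr opprD addrACA.
    by rewrite opprB addrA subrK.
  rewrite (le_trans (rnormD _ _))// rnormN.
  have h4 : rnorm (c *: (u n x - l x)) <= e / 3.
    rewrite rnormZ (@le_trans _ _ (d * (e / 3 / d)))//.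
      by rewrite ler_pM ?cnorm_ge0 ?rnorm_ge0// lerDl.
    by rewrite mulrC mulfVK// gt_eqF.
  have h5 := rnormD (c *: (u n x - l x)) (u n y - l y).
  by lra.
have lim_bd (e : R) : 0 < e -> exists N, forall m, (N <= m)%N -> forall x,
    rnorm (u m x - l x) <= e * rnorm x.
  move=> e0; have [N NP] := cu e e0; exists N => m Nm x.
  apply/ler_addgt0Pr => d d0; have [N' N'P] := lP x d d0.
  pose j := maxn N N'.
  rewrite (le_trans (rdistD (u j x) _ _))// lerD ?N'P ?leq_maxr//.
  rewrite (le_trans (opnormP (u m - u j) x))// ler_wpM2r ?rnorm_ge0//.
  by rewrite NP// leq_maxl.
have [N0 N0P] := lim_bd 1 ltr01.
have lop : l \in @bounded_op R H.
  apply/asboolP; split=> //; have [M M0 uM] := bop_rbounded (u N0).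
  exists (1 + M) => x; rewrite !rnormE -RCM lecR.
  rewrite -[l x](subrK (u N0 x)) (le_trans (rnormD _ _))// mulrDl lerD ?uM//.
  by rewrite rdistC N0P.
exists (Bop lop) => e e0; have [N NP] := lim_bd e e0; exists N => m Nm.
by apply: opnorm_le => [|x]; [exact: ltW|exact: NP].
Qed.

HB.instance Definition _ := Lmodule_isRBanach.Build R (bop H)
  opnormD opnormZ opnorm_eq0 bop_complete.

Lemma rnorm_bop T : rnorm T = opnorm T. Proof. by []. Qed.

Let bop_norm_smul S T : `|smul S T| <= `|S| * `|T|.
Proof. by rewrite !rnormE -RCM lecR !rnorm_bop opnormM. Qed.

Let bop_norm_star T : `|smul (star T) T| = `|T| ^+ 2.
Proof. by rewrite !rnormE -RCX !rnorm_bop opnorm_star_mul. Qed.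

HB.instance Definition _ := StarAlgebra_isCStar.Build R (bop H)
  bop_norm_smul bop_norm_star.

End OperatorNorm.

(** * Square roots and representations of C*-algebras *)

Section StarAlgebraArithmetic.
Variables (R : realType) (A : starAlgType R).
Implicit Types x y z : A.

Lemma smulNl x y : smul (- x) y = - smul x y.
Proof. by rewrite -scaleN1r smulZl scaleN1r. Qed.
Lemma smulNr x y : smul x (- y) = - smul x y.
Proof. by rewrite -scaleN1r smulZr scaleN1r. Qed.
Lemma smulBl x y z : smul (x - y) z = smul x z - smul y z.
Proof. by rewrite smulDl smulNl. Qed.
Lemma smulBr x y z : smul x (y - z) = smul x y - smul x z.
Proof. by rewrite smulDr smulNr. Qed.
Lemma starN x : star (- x) = - star x.
Proof. by rewrite -scaleN1r starZ conjN1 scaleN1r. Qed.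
Lemma starB x y : star (x - y) = star x - star y.
Proof. by rewrite starD starN. Qed.
Lemma starZr (r : R) x : star (r%:C *: x) = r%:C *: star x.
Proof. by rewrite starZ conj_RC. Qed.
Lemma smul_suml (I : Type) (s : seq I) (P : pred I) (F : I -> A) y :
  smul (\sum_(i <- s | P i) F i) y = \sum_(i <- s | P i) smul (F i) y.
Proof. by elim/big_rec2 : _ => [|i u v _ <-]; rewrite ?smul0l ?smulDl. Qed.
Lemma smul_sumr (I : Type) (s : seq I) (P : pred I) (F : I -> A) y :
  smul y (\sum_(i <- s | P i) F i) = \sum_(i <- s | P i) smul y (F i).
Proof. by elim/big_rec2 : _ => [|i u v _ <-]; rewrite ?smul0r ?smulDr. Qed.
Lemma star_sum (I : Type) (s : seq I) (P : pred I) (F : I -> A) :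
  star (\sum_(i <- s | P i) F i) = \sum_(i <- s | P i) star (F i).
Proof. by elim/big_rec2 : _ => [|i u v _ <-]; rewrite ?star0 ?starD. Qed.

End StarAlgebraArithmetic.

Section SquareRoots.
Variables (R : realType) (A : cstarAlgType R).
Implicit Types x y z k : A.

Lemma rnorm_smul x y : rnorm (smul x y) <= rnorm x * rnorm y.
Proof. by rewrite -lecR RCM -!rnormE norm_smul. Qed.

Lemma rnorm_star_smul x : rnorm (smul (star x) x) = rnorm x ^+ 2.
Proof. by apply: complexI; rewrite RCX -!rnormE norm_star_smul. Qed.

Lemma rnorm_star x : rnorm (star x) = rnorm x.
Proof.
suff le y : rnorm y <= rnorm (star y).
  by apply/eqP; rewrite eq_le le -{2}(starK x) le.
have [->|yN] := eqVneq (rnorm y) 0; first exact: rnorm_ge0.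
have yp : 0 < rnorm y by rewrite lt_neqAle eq_sym yN rnorm_ge0.
by rewrite -(ler_pM2r yp) -expr2 -rnorm_star_smul rnorm_smul.
Qed.

Lemma rnorm_smul_star x : rnorm (smul x (star x)) = rnorm x ^+ 2.
Proof. by rewrite -{1}(starK x) rnorm_star_smul rnorm_star. Qed.

Lemma rnorm_sa_sqr x : star x = x -> rnorm (smul x x) = rnorm x ^+ 2.
Proof. by move=> sx; rewrite -{1}sx rnorm_star_smul. Qed.

(** The square root of 1 - y, written as 1 - k so that no unit is needed: the
    fixed point equation k = (y + k^2) / 2 says (1 - k)^2 = 1 - y. *)
Lemma sqrt_one_minus y (r : R) : rnorm y <= r -> r < 1 ->
  exists k, [/\ rnorm k <= r, k + k = y + smul k k, star y = y -> star k = k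
    & forall z, smul z y = smul y z -> smul z k = smul k z].
Proof.
move=> yr r1; have r0 : 0 <= r := le_trans (rnorm_ge0 _) yr.
pose h : R[i] := (2^-1 : R)%:C.
have nh x : rnorm (h *: x) = rnorm x / 2.
  by rewrite rnormZr ger0_norm ?invr_ge0// mulrC.
pose fix u n := if n is n'.+1 then h *: (y + smul (u n') (u n')) else 0.
have uS n : u n.+1 = h *: (y + smul (u n) (u n)) by [].
have ur n : rnorm (u n) <= r.
  elim: n => [|n IH]; first by rewrite /= rnorm0.
  rewrite uS nh ler_pdivrMr// (le_trans (rnormD _ _))//.
  have := rnorm_smul (u n) (u n); have := rnorm_ge0 (u n); nra.
have sqB a b : smul a a - smul b b = smul a (a - b) + smul (a - b) b.
  by rewrite smulBr smulBl addrA subrK.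
have step n m : rnorm (u n.+1 - u m.+1) <= r * rnorm (u n - u m).
  rewrite !uS -scalerBr nh opprD addrACA subrr add0r sqB ler_pdivrMr//.
  rewrite (le_trans (rnormD _ _))//.
  have := rnorm_smul (u n) (u n - u m); have := rnorm_smul (u n - u m) (u m).
  have := rnorm_ge0 (u n - u m); have := ur n; have := ur m.
  have := rnorm_ge0 (u n); have := rnorm_ge0 (u m); nra.
have geo n m : rnorm (u (n + m)%N - u n) <= r ^+ n.
  elim: n => [|n IH].
    by rewrite add0n expr0 /= subr0 (le_trans (ur m))// ltW.
  by rewrite addSn (le_trans (step _ _))// exprS ler_wpM2l.
have rn0 e : 0 < e -> exists N, r ^+ N <= e.
  move=> e0; have : (fun n => r ^+ n) @ \oo --> (0 : R).
    by apply: cvg_expr; rewrite ger0_norm.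
  move/cvgrPdist_le/(_ e e0) => [N _ /(_ N (leqnn N))] /=.
  by rewrite sub0r normrN ger0_norm ?exprn_ge0// => h'; exists N.
have [|k kP] := @rcauchy_lim R A u.
  move=> e e0; have [N NP] := rn0 _ (divr_gt0 e0 (ltr0Sn R 1)).
  exists N => m j Nm Nj; rewrite (le_trans (rdistD (u N) _ _))// [leRHS]splitr.
  rewrite lerD//; apply: le_trans NP.
    by have := geo N (m - N)%N; rewrite subnKC.
  by have := geo N (j - N)%N; rewrite subnKC// rdistC.
have lim_eq (f g : A -> A) (M : R) : 0 <= M ->
    (forall n, f (u n) = g (u n)) ->
    (forall n, rnorm (f (u n) - f k) <= M * rnorm (u n - k)) ->
    (forall n, rnorm (g (u n) - g k) <= M * rnorm (u n - k)) -> f k = g k.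
  move=> M0 fg fM gM; apply: rnorm_small => e e0.
  have d0 : 0 < 2 * (M + 1) by rewrite mulr_gt0// ltr_pwDr.
  have [N NP] := kP _ (divr_gt0 e0 d0); have {NP} := NP N (leqnn N).
  rewrite ler_pdivlMr// => NP.
  rewrite (le_trans (rdistD (f (u N)) _ _))//.
  have := fM N; have := gM N; rewrite -fg (rdistC (f (u N)) (f k)).
  have := rnorm_ge0 (u N - k); nra.
have kr : rnorm k <= r.
  apply/ler_addgt0Pr => e e0; have [N NP] := kP e e0.
  have := NP N (leqnn N); have := ur N; have := rnormD (u N) (k - u N).
  by rewrite addrC subrK (rdistC k); lra.
exists k; split=> //.
- have kE : k = h *: (y + smul k k).
    apply: rnorm_small => e e0.
    have [N NP] := kP _ (divr_gt0 e0 (ltr0Sn R 1)).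
    rewrite (le_trans (rdistD (u N.+1) _ _))// [leRHS]splitr lerD//.
      by rewrite rdistC NP.
    rewrite uS -scalerBr nh opprD addrACA subrr add0r sqB.
    rewrite (le_trans _ (NP N (leqnn N)))// ler_pdivrMr//.
    rewrite (le_trans (rnormD _ _))//.
    have := rnorm_smul (u N) (u N - k); have := rnorm_smul (u N - k) k.
    have := rnorm_ge0 (u N - k); have := ur N; have := rnorm_ge0 (u N).
    have := rnorm_ge0 k; nra.
  have -> : k + k = (2 : R)%:C *: k by rewrite RCD scalerDl scale1r.
  by rewrite {1}kE scalerA -RCM mulfV// scale1r.
- move=> sy; apply: (lim_eq star id 1) => // n; rewrite ?mul1r//.
    elim: n => [|n IH]; first by rewrite /= star0.
    by rewrite uS starZr starD starM IH sy.
  by rewrite -starB rnorm_star.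
- move=> z zy; apply: (lim_eq (smul z) (fun x => smul x z) (rnorm z)).
  + exact: rnorm_ge0.
  + elim=> [|n IH]; first by rewrite /= smul0r smul0l.
    rewrite uS smulZr smulZl smulDr smulDl zy; congr (_ *: (_ + _)).
    by rewrite smulA IH -smulA IH smulA.
  + by move=> n; rewrite -smulBr rnorm_smul.
  + by move=> n; rewrite -smulBl (le_trans (rnorm_smul _ _))// mulrC.
Qed.

(** A *-representation decreases norms: for |a| < 1 write 1 - a^* a = (1 - k)^2
    and read off |x|^2 - |pi a x|^2 = |x - pi k x|^2. *)
Lemma star_hom_le (H : hilbertType R) (pi : {linear A -> bop H}) a (x : H) :
  star_hom pi -> rnorm (pi a x) <= rnorm a * rnorm x.
Proof.
move=> [piM piS].
have small b : rnorm b < 1 -> rnorm (pi b x) <= rnorm x.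
  move=> b1; have hb : rnorm (smul (star b) b) <= rnorm b ^+ 2 by rewrite rnorm_star_smul.
  have [|k [_ kE + _]] := sqrt_one_minus hb.
    by rewrite exprn_ilt1 ?rnorm_ge0.
  rewrite starM starK => /(_ erefl) sk.
  have e1 : complex.Re (dot (pi (smul (star b) b) x) x) = rnorm (pi b x) ^+ 2.
    by rewrite piM piS /= dotC -adjP -dotC dotxx.
  have e2 : complex.Re (dot (pi (smul k k) x) x) = rnorm (pi k x) ^+ 2.
    by rewrite -{1}sk piM piS /= dotC -adjP -dotC dotxx.
  have e3 : 2 * complex.Re (dot (pi k x) x) = rnorm (pi b x) ^+ 2 + rnorm (pi k x) ^+ 2.
    rewrite -e1 -e2 -ReD -dotDl -bopDE -linearD -kE linearD bopDE dotDl ReD; ring.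
  rewrite -(@ler_pXn2r _ 2) ?nnegrE ?rnorm_ge0//.
  have := sqr_ge0 (rnorm (x - pi k x)); rewrite rnormD_sqr rnormN dotNr dotC ReN ReJ; lra.
have [a0|aN] := eqVneq (rnorm a) 0.
  by rewrite (rnorm_eq0 a0) linear0 rnorm0 mul0r -[(0 : bop H) x]/(0 : H) rnorm0.
have ap : 0 < rnorm a by rewrite lt_neqAle eq_sym aN rnorm_ge0.
rewrite -subr_le0; apply/ler_addgt0Pr => e e0; rewrite add0r.
pose s := rnorm a + e / (rnorm x + 1).
have x1 : 0 < rnorm x + 1 by rewrite ltr_pwDr ?rnorm_ge0.
have d0 : 0 < e / (rnorm x + 1) by rewrite divr_gt0.
have s0 : 0 < s by rewrite addr_gt0.
have := small (s^-1%:C *: a).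
rewrite linearZ bopZE !rnormZr ger0_norm ?invr_ge0 ?(ltW s0)// mulrC.
rewrite ltr_pdivrMr// mul1r ltrDl => /(_ d0).
rewrite mulrC ler_pdivrMr// => h.
have : e / (rnorm x + 1) * (rnorm x + 1) = e by rewrite mulfVK// gt_eqF.
by move: h; rewrite /s mulrDr; move: (e / _) d0 => q q0; nra.
Qed.

End SquareRoots.

(** * Positive elements *)

Section Positivity.
Variables (R : realType) (U : cstarAlgType R) (e : U).
Hypotheses (mul1x : forall x, smul e x = x) (mulx1 : forall x, smul x e = x).
Hypothesis norm_one : rnorm e = 1.
Implicit Types (x y z a b c d k n r s w : U) (t : R).

Local Notation "x ** y" := (smul x y) (at level 40, left associativity).
Local Notation sc t := (t%:C *: e).

Let star1 : star e = e.
Proof. by rewrite -[star e]mulx1 -{2}(starK e) -starM mulx1 starK. Qed.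

Let star_sc t : star (sc t) = sc t.
Proof. by rewrite starZr star1. Qed.

Let scD t t' : sc (t + t') = sc t + sc t'.
Proof. by rewrite RCD scalerDl. Qed.

Let scB t t' : sc (t - t') = sc t - sc t'.
Proof. by rewrite RCB scalerBl. Qed.

Let norm_sc t : rnorm (sc t) = `|t|.
Proof. by rewrite rnormZr norm_one mulr1. Qed.

Let mulscx t x : sc t ** x = t%:C *: x.
Proof. by rewrite smulZl mul1x. Qed.

Let mulxsc t x : x ** sc t = t%:C *: x.
Proof. by rewrite smulZr mulx1. Qed.

Let scale_sc t t' : t%:C *: sc t' = sc (t * t').
Proof. by rewrite scalerA RCM. Qed.

(** Positivity expressed by norms alone: the spectrum of x lies in the disc of
    centre t and radius t. In this form sums of positive elements are visibly
    positive, and the work goes into the positivity of squares x^* x. *)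
Definition pos x := star x = x /\ exists t, rnorm (sc t - x) <= t.

Lemma pos_sa x : pos x -> star x = x. Proof. by case. Qed.

Lemma posD x y : pos x -> pos y -> pos (x + y).
Proof.
move=> [sx [t tx]] [sy [t' ty]]; split; first by rewrite starD sx sy.
exists (t + t'); rewrite scD opprD addrACA (le_trans (rnormD _ _))// lerD//.
Qed.

Lemma posZ t x : 0 <= t -> pos x -> pos (t%:C *: x).
Proof.
move=> t0 [sx [t' tx]]; split; first by rewrite starZr sx.
exists (t * t'); rewrite -scale_sc -scalerBr rnormZr ger0_norm//.
by rewrite ler_wpM2l.
Qed.

Lemma pos_sc_sub w t : star w = w -> rnorm w <= t -> pos (sc t - w).
Proof.
move=> sw wt; split; first by rewrite starB star_sc sw.
by exists t; rewrite opprB addrC subrK.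
Qed.

Lemma pos_sc t : 0 <= t -> pos (sc t).
Proof. by move=> t0; rewrite -[sc t]subr0; apply: pos_sc_sub; rewrite ?star0 ?rnorm0. Qed.

(** The iteration for the square root of 1 - y needs |y| < 1, hence the strictly
    positive t; an exact root of x is a limit of these. *)
Lemma pos_sqrt x t : pos x -> 0 < t ->
  exists r, [/\ pos r, r ** r = x + sc t
    & forall z, z ** x = x ** z -> z ** r = r ** z].
Proof.
move=> [sx [t' tx]] t0; have t'0 : 0 <= t' := le_trans (rnorm_ge0 _) tx.
pose m := t' + t; have m0 : 0 < m by rewrite ltr_wpDl.
pose y := m^-1%:C *: (sc t' - x).
have [||k [nk0 kE sk ck]] := @sqrt_one_minus R U y (t' / m).
- by rewrite rnormZr ger0_norm ?invr_ge0 ?(ltW m0)// mulrC ler_wpM2r ?invr_ge0 ?(ltW m0).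
- by rewrite ltr_pdivrMr// mul1r ltrDl.
have sk' : star k = k by apply: sk; rewrite starZr starB star_sc sx.
have nk : rnorm k <= 1.
  by rewrite (le_trans nk0)// ler_pdivrMr// mul1r lerDl ltW.
exists ((Num.sqrt m)%:C *: (e - k)); split.
- by apply: posZ; rewrite ?sqrtr_ge0// -[e]scale1r; apply: pos_sc_sub.
- rewrite smulZl smulZr scalerA -RCM -expr2 sqr_sqrtr ?(ltW m0)//.
  rewrite smulBl !smulBr !mul1x mulx1.
  have -> : e - k - (k - k ** k) = e - y.
    by rewrite -(addrK (k ** k) y) -kE; abel.
  rewrite scalerBr /y scalerA -RCM divff ?gt_eqF// scale1r.
  by rewrite /m scD; abel.
- move=> z zx; rewrite smulZl smulZr smulBl smulBr mul1x mulx1 ck//.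
  by rewrite /y smulZl smulZr smulBl smulBr mulscx mulxsc zx.
Qed.

(** The element u = r + i s satisfies u^* u = r^2 + s^2, and r is its real
    part. *)
Lemma sum_squares_ge r s : star r = r -> star s = s -> r ** s = s ** r ->
  rnorm r ^+ 2 <= rnorm (r ** r + s ** s).
Proof.
move=> sr ss rs; pose u := r + 'i *: s.
have su : star u = r - 'i *: s.
  rewrite starD starZ sr ss; congr (_ + _); rewrite -scaleNr; congr (_ *: _).
  by apply/eqP; rewrite eq_complex /= oppr0 !eqxx.
have uu : star u ** u = r ** r + s ** s.
  rewrite su smulBl !smulDr !smulZl !smulZr rs scalerA -expr2 sqrCi scaleN1r.
  by abel.
have r2 : r + r = u + star u by rewrite su /u; abel.
rewrite -uu rnorm_star_smul ler_pXn2r ?nnegrE ?rnorm_ge0//.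
have := rnormD u (star u); rewrite -r2 rnorm_star.
have -> : r + r = (2 : R)%:C *: r by rewrite RCD scalerDl scale1r.
by rewrite rnormZr ger0_norm//; lra.
Qed.

(** After scaling, |k| < 1 and 1 - k^2 = s^2 with s self-adjoint. The two squares
    k^2 and s^2 add up to 1, so |1 - k^2| = |s|^2 is at most 1. *)
Lemma pos_sqr k : star k = k -> pos (k ** k).
Proof.
move=> sk; pose m := rnorm k + 1.
have m0 : 0 < m by rewrite ltr_pwDr ?rnorm_ge0.
pose k' := m^-1%:C *: k; pose y := k' ** k'.
have sk' : star k' = k' by rewrite starZr sk.
have nk : rnorm k' <= rnorm k / m.
  by rewrite rnormZr ger0_norm ?invr_ge0 ?(ltW m0)// mulrC.
have nk1 : rnorm k / m < 1 by rewrite ltr_pdivrMr// mul1r ltrDl.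
have [||q [_ qE sq cq]] := @sqrt_one_minus R U y ((rnorm k / m) ^+ 2).
- by rewrite rnorm_sa_sqr// ler_pXn2r ?nnegrE ?rnorm_ge0// divr_ge0 ?rnorm_ge0 ?(ltW m0).
- by rewrite exprn_ilt1 ?divr_ge0 ?rnorm_ge0 ?(ltW m0).
have sy : star y = y by rewrite starM sk'.
pose s := e - q; have ss : star s = s by rewrite starB star1 sq.
have sE : s ** s = e - y.
  rewrite smulBl !smulBr !mul1x mulx1.
  by rewrite -(addrK (q ** q) y) -qE; abel.
have sk'c : k' ** s = s ** k'.
  by rewrite smulBr smulBl mulx1 mul1x cq// /y smulA.
have := sum_squares_ge ss sk' (esym sk'c).
rewrite -(rnorm_sa_sqr ss) sE subrK norm_one => ny.
split; first by rewrite starM sk.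
exists (m ^+ 2).
have -> : sc (m ^+ 2) - k ** k = (m ^+ 2)%:C *: (e - y).
  rewrite scalerBr; congr (_ - _).
  rewrite /y smulZl smulZr !scalerA -!RCM expr2 mulrA mulfK ?gt_eqF// divff ?gt_eqF//.
  by rewrite scale1r.
by rewrite rnormZr ger0_norm ?sqr_ge0// ler_piMr ?sqr_ge0.
Qed.

(** Let r and s be commuting square roots of a and t - a, up to small multiples
    of 1. Then r^2 + s^2 is close to t and dominates r^2 in norm. *)
Lemma pos_le_norm a t : pos a -> pos (sc t - a) -> rnorm a <= t.
Proof.
move=> pa pb; apply/ler_addgt0Pr => t' t'0.
have t3 : 0 < t' / 3 by rewrite divr_gt0.
have [r [/pos_sa sr rr cr]] := pos_sqrt pa t3.
have [s [/pos_sa ss s2 cs]] := pos_sqrt pb t3.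
have rs : r ** s = s ** r.
  apply: cs; rewrite smulBr smulBl mulxsc mulscx; congr (_ - _).
  by apply/esym; apply: cr.
have := sum_squares_ge sr ss rs; rewrite -(rnorm_sa_sqr sr) rr s2.
have -> : a + sc (t' / 3) + (sc t - a + sc (t' / 3)) = sc (t + t' / 3 + t' / 3).
  by rewrite !scD; abel.
rewrite norm_sc => h.
have := rnormD (a + sc (t' / 3)) (- sc (t' / 3)).
rewrite addrK rnormN norm_sc (ger0_norm (ltW t3)).
have : rnorm (sc t - a) + rnorm a >= t.
  by rewrite (le_trans _ (rnormD _ _))// subrK norm_sc ler_norm.
have t0 : 0 <= t + t' / 3 + t' / 3.
  have : pos (sc t) by have := posD pb pa; rewrite subrK.
  move=> [_ [u]]; rewrite -scB norm_sc => hu.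
  by have := ler_norm (u - t); lra.
by move: h; rewrite ger0_norm//; lra.
Qed.

Lemma pos_add_le_norm a b t : pos a -> pos b -> rnorm (a + b) <= t ->
  rnorm a <= t.
Proof.
move=> pa pb nab; apply: pos_le_norm => //.
have -> : sc t - a = sc t - (a + b) + b by rewrite opprD addrA subrK.
apply: posD => //; apply: pos_sc_sub => //.
by rewrite starD (pos_sa pa) (pos_sa pb).
Qed.

(** The radius in the definition of positivity can be taken to be |x| + 1 for all
    the elements x + t with t at most 1, so it survives the limit. *)
Lemma pos_closed x : star x = x -> (forall t, 0 < t -> pos (x + sc t)) -> pos x.
Proof.
move=> sx px; split=> //; exists (rnorm x + 1); apply/ler_addgt0Pr => t t0.
pose t' := Num.min t 1; have t'0 : 0 < t' by rewrite lt_min t0 ltr01.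
have t'1 : t' <= 1 by rewrite ge_min lexx orbT.
have t't : t' <= t by rewrite ge_min lexx.
have h : rnorm (sc (rnorm x + 1) - (x + sc t')) <= rnorm x + 1.
  apply: pos_le_norm; last first.
    by rewrite opprB addrC subrK; exact: px.
  apply: pos_sc_sub; first by rewrite starD sx star_sc.
  by rewrite (le_trans (rnormD _ _))// lerD// norm_sc ger0_norm ?(ltW t'0).
have -> : sc (rnorm x + 1) - x = sc (rnorm x + 1) - (x + sc t') + sc t'.
  by rewrite opprD addrA subrK.
by rewrite (le_trans (rnormD _ _))// lerD// norm_sc ger0_norm ?(ltW t'0).
Qed.

(** Commuting square roots of a + q and b + q have a self-adjoint product, whose
    square is close to a b. *)
Lemma posM a b : pos a -> pos b -> a ** b = b ** a -> pos (a ** b).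
Proof.
move=> pa pb ab; apply: pos_closed.
  by rewrite starM (pos_sa pa) (pos_sa pb).
move=> t t0; pose C := rnorm a + rnorm b + 1.
have C0 : 0 < C by rewrite ltr_pwDr ?addr_ge0 ?rnorm_ge0.
pose q := Num.min 1 (t / C).
have q0 : 0 < q by rewrite lt_min ltr01 divr_gt0.
have q1 : q <= 1 by rewrite ge_min lexx.
have qC : q * C <= t by rewrite -ler_pdivlMr// ge_min lexx orbT.
have [r [/pos_sa sr rr cr]] := pos_sqrt pa q0.
have [s [/pos_sa ss s2 cs]] := pos_sqrt pb q0.
have rs : r ** s = s ** r by apply: cs; apply/esym/cr; rewrite ab.
pose w := q%:C *: (a + b) + sc (q ^+ 2).
have e1 : (r ** s) ** (r ** s) = a ** b + w.
  have -> : (r ** s) ** (r ** s) = (r ** r) ** (s ** s).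
    by rewrite -!smulA; congr (_ ** _); rewrite !smulA rs.
  rewrite rr s2 smulDl !smulDr mulscx !mulxsc scale_sc -expr2 /w scalerDr.
  by abel.
have -> : a ** b + sc t = (r ** s) ** (r ** s) + (sc t - w).
  by rewrite e1; abel.
apply: posD; first by apply: pos_sqr; rewrite starM sr ss rs.
apply: pos_sc_sub.
  by rewrite starD star_sc starZr starD (pos_sa pa) (pos_sa pb).
rewrite (le_trans (rnormD _ _))// rnormZr norm_sc ger0_norm ?(ltW q0)//.
rewrite ger0_norm ?sqr_ge0//; have := rnormD a b; move: qC; rewrite /C; nra.
Qed.

Fixpoint pw d N : U := if N is N'.+1 then pw d N' ** d else e.

Lemma pw_comm d x N : x ** d = d ** x -> x ** pw d N = pw d N ** x.
Proof.
move=> xd; elim: N => [|N IH] /=; first by rewrite mulx1 mul1x.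
by rewrite smulA IH -smulA xd smulA.
Qed.

Lemma pwD d N M : pw d (N + M) = pw d N ** pw d M.
Proof.
elim: M => [|M IH]; first by rewrite addn0 mulx1.
by rewrite addnS /= IH smulA.
Qed.

Lemma pos_pw d N : pos d -> pos (pw d N).
Proof.
move=> pd; elim: N => [|N IH] /=; first by have := pos_sc (@ler01 R); rewrite scale1r.
by apply: posM => //; rewrite pw_comm.
Qed.

Lemma rnorm_pw d m : star d = d -> rnorm d = 1 -> rnorm (pw d (2 ^ m)) = 1.
Proof.
move=> sd nd; have sp N : star (pw d N) = pw d N.
  elim: N => [|N IH] //=; by rewrite starM IH sd pw_comm.
elim: m => [|m IH]; first by rewrite expn0 /= mul1x.
by rewrite expnS mul2n -addnn pwD rnorm_sa_sqr// IH expr1n.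
Qed.

(** For 0 <= d <= 1 the element d^N (1 - d) has norm at most 1/N, because it is
    the smallest of the N terms of the telescoping sum of the d^i (1 - d). *)
Lemma pw_telescope d N : pos d -> pos (e - d) ->
  N%:R * rnorm (pw d N ** (e - d)) <= 1.
Proof.
move=> pd pd'; pose T i := pw d i ** (e - d).
have dc x i : x ** d = d ** x -> x ** pw d i = pw d i ** x by exact: pw_comm.
have cc : d ** (e - d) = (e - d) ** d.
  by rewrite smulBr smulBl mulx1 mul1x.
have pT i : pos (T i).
  by apply: posM (pos_pw _ pd) pd' _; rewrite dc.
have TS i : T i - T i.+1 = T i ** (e - d).
  rewrite /T /= -!smulA -smulBr; congr (_ ** _).
  by rewrite [in RHS]smulBl mul1x.
have pK i : pos (e - pw d i - (i%:R : R)%:C *: T i).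
  elim: i => [|i IH]; first by rewrite /= subrr sub0r scale0r oppr0 -(scale0r e); exact: pos_sc.
  have -> : e - pw d i.+1 - (i.+1%:R : R)%:C *: T i.+1 =
      (e - pw d i - (i%:R : R)%:C *: T i) + (i.+1%:R : R)%:C *: (T i - T i.+1).
    have -> : pw d i.+1 = pw d i - T i by rewrite /T /= smulBr mulx1; abel.
    rewrite scalerBr; have -> : (i.+1%:R : R)%:C *: T i = (i%:R : R)%:C *: T i + T i.
      by rewrite -addn1 natrD RCD scalerDl scale1r.
    by abel.
  apply: posD => //; apply: posZ; first exact: ler0n.
  by rewrite TS; apply: posM => //; rewrite /T smulA (dc _ _ (esym cc)).
have pN : pos (sc 1 - (N%:R : R)%:C *: T N).
  have -> : sc 1 - (N%:R : R)%:C *: T N = (e - pw d N - (N%:R : R)%:C *: T N) + pw d N.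
    by rewrite scale1r; abel.
  by apply: posD (pK N) _; apply: pos_pw.
have := pos_le_norm (posZ (ler0n R N) (pT N)) pN.
by rewrite rnormZr ger0_norm// ler0n.
Qed.

(** With y = a + i b for self-adjoint a and b, the sum is 2 (a^2 + b^2). *)
Lemma pos_sum_star y : pos (star y ** y + y ** star y).
Proof.
pose h : R[i] := (2^-1 : R)%:C.
pose a := h *: (y + star y); pose b := ('i * h) *: (y - star y).
have sa : star a = a by rewrite starZr starD starK addrC.
have sb : star b = b.
  rewrite starZ starB starK -opprB scalerN -scaleNr; congr (_ *: _).
  by rewrite conjM conj_i conj_RC -mulNr opprK.
have -> : star y ** y + y ** star y = (2 : R)%:C *: (a ** a + b ** b).
  rewrite !smulZl !smulZr !scalerA.
  have -> : 'i * h * ('i * h) = - (h * h).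
    by rewrite mulrACA -expr2 sqrCi mulN1r.
  rewrite scaleNr -scalerBr scalerA.
  have -> : (y + star y) ** (y + star y) - (y - star y) ** (y - star y) =
     (2 : R)%:C *: (star y ** y + y ** star y).
    rewrite !(smulDl, smulDr, smulNl, smulNr) RCD scalerDl !scale1r.
    by abel.
  rewrite scalerA -!RCM.
  by rewrite (_ : 2 * (2^-1 * 2^-1) * 2 = 1) ?scale1r//; field.
by apply: posZ => //; apply: posD; apply: pos_sqr.
Qed.

(** Suppose h = x^* x has a negative spectral value; let - al be the lowest one.
    A high power n of a suitable affine function of h is an approximate
    eigenvector, n h is close to - al n, so that for y = x n the element y^* y
    is close to - al n^2. Since y^* y + y y^* is positive, y y^* is nearly
    positive, and so is (y n)(y n)^*. But the square of y y^* is close to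
    - al (y n)(y n)^*: two positive elements with almost no sum, although the
    first of them has norm close to al^2. *)
Lemma pos_star_mul x : pos (star x ** x).
Proof.
set h := star x ** x; have sh : star h = h by rewrite starM starK.
pose A := [set t | 0 <= t /\ pos (h + sc t)].
have A0 : A !=set0.
  exists (rnorm h); split; first exact: rnorm_ge0.
  by rewrite addrC -[h]opprK; apply: pos_sc_sub; rewrite ?rnormN// starN sh.
have iA : has_inf A by split=> //; exists 0 => t [].
pose al := inf A.
have al0 : 0 <= al by apply: lb_le_inf => // t [].
have pc : pos (h + sc al).
  apply: pos_closed; first by rewrite starD sh star_sc.
  move=> t t0; have [t' [t'0 pt'] t't] := inf_adherent t0 iA.
  have -> : h + sc al + sc t = h + sc t' + sc (al + t - t').
    by rewrite scB scD; abel.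
  by apply: posD => //; apply: pos_sc; rewrite subr_ge0 ltW.
have [al00|alN] := eqVneq al 0; first by move: pc; rewrite al00 scale0r addr0.
have alp : 0 < al by rewrite lt_neqAle eq_sym alN.
exfalso; pose c := h + sc al; pose T := rnorm c + 1.
have T0 : 0 < T by rewrite ltr_pwDr ?rnorm_ge0.
pose d := T^-1%:C *: (sc T - c).
have scc : star c = c := pos_sa pc.
have TT : T^-1 * T = 1 by rewrite mulVf// gt_eqF.
have dE : e - d = T^-1%:C *: c.
  by rewrite /d scalerBr scale_sc TT scale1r; abel.
have pd : pos d.
  apply: posZ; first by rewrite invr_ge0 ltW.
  by apply: pos_sc_sub => //; rewrite lerDl.
have pd' : pos (e - d) by rewrite dE; apply: posZ => //; rewrite invr_ge0 ltW.
have nd1 : rnorm d <= 1.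
  by apply: pos_le_norm => //; rewrite scale1r.
have nd : rnorm d = 1.
  apply/eqP; rewrite eq_le nd1 leNgt; apply/negP => dlt.
  have nT : rnorm (sc T - c) < T.
    have -> : sc T - c = T%:C *: d by rewrite scalerA -RCM mulrC TT scale1r.
    by rewrite rnormZr gtr0_norm// gtr_pMr.
  pose q := Num.min (T - rnorm (sc T - c)) al.
  have q0 : 0 < q by rewrite lt_min subr_gt0 nT alp.
  have qal : q <= al by rewrite ge_min lexx orbT.
  have qT : q <= T - rnorm (sc T - c) by rewrite ge_min lexx.
  have : A (al - q).
    split; first by rewrite subr_ge0.
    split; first by rewrite starD sh star_sc.
    exists (T - q); have -> : sc (T - q) - (h + sc (al - q)) = sc T - c.
      by rewrite !scB /c; abel.
    by lra.
  by move/(ge_inf (proj2 iA)); rewrite -/al lerBrDr gerDl leNgt q0.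
pose et := al / 10; have et0 : 0 < et by rewrite divr_gt0.
have [m mP] : exists m, T / (2 ^ m)%:R <= et.
  have [N NP] := natSinv_small (divr_gt0 et0 T0).
  exists N; have := NP N (leqnn N); rewrite ltr_pdivlMr// mulrC => /ltW.
  apply: le_trans; rewrite ler_wpM2l ?(ltW T0)// lef_pV2 ?posrE ?ltr0n ?expn_gt0//.
  by rewrite ler_nat ltn_expl.
pose n := pw d (2 ^ m).
have sn : star n = n by apply: pos_sa; apply: pos_pw.
have nn : rnorm n = 1 by apply: rnorm_pw => //; apply: pos_sa.
have nc : rnorm (n ** c) <= et.
  apply: le_trans mP; rewrite ler_pdivlMr ?ltr0n ?expn_gt0// mulrC.
  have := pw_telescope (2 ^ m) pd pd'; rewrite dE smulZr rnormZr.
  rewrite ger0_norm ?invr_ge0 ?(ltW T0)// mulrCA => h1.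
  by rewrite -(@ler_pM2l _ T^-1) ?invr_gt0// TT.
(* Near positivity of (x n)(x n)^*, for n and for n^2. *)
have near n' : star n' = n' -> rnorm n' <= 1 -> rnorm (n' ** c) <= et ->
    star (x ** n') ** (x ** n') = n' ** c ** n' - al%:C *: (n' ** n') /\
    pos (x ** n' ** star (x ** n') + sc et) /\ rnorm (n' ** c ** n') <= et.
  move=> sn' nn' nc'; set y := x ** n'; set v := n' ** c ** n'.
  have vet : rnorm v <= et.
    rewrite (le_trans (rnorm_smul _ _))// -[leRHS]mulr1.
    by rewrite ler_pM ?rnorm_ge0.
  have yy : star y ** y = v - al%:C *: (n' ** n').
    rewrite /v /c smulDr smulDl mulxsc smulZl addrK.
    by rewrite /y starM sn' /h !smulA.
  split=> //; split=> //.
  have -> : y ** star y + sc et = star y ** y + y ** star y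
      + (al%:C *: (n' ** n') + (sc et - v)).
    by rewrite yy; abel.
  apply: posD (pos_sum_star y) _; apply: posD.
    by apply: posZ => //; apply: pos_sqr.
  by apply: pos_sc_sub => //; rewrite /v !starM scc sn' smulA.
have snn : star (n ** n) = n ** n by rewrite starM sn.
have nnn : rnorm (n ** n) = 1 by rewrite rnorm_sa_sqr// nn expr1n.
have nn1 : rnorm n <= 1 by rewrite nn.
have nnn1 : rnorm (n ** n) <= 1 by rewrite nnn.
have [yy [_ vet]] := near n sn nn1 nc.
have [|_ [pyn _]] := near (n ** n) snn nnn1.
  rewrite -smulA (le_trans (rnorm_smul _ _))// nn mul1r.
  exact: nc.
set y := x ** n in yy; set v := n ** c ** n in yy vet.
pose z := y ** star y; have sz : star z = z by rewrite starM starK.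
have zz : z ** z = y ** v ** star y - al%:C *: (y ** n ** star (y ** n)).
  have -> : z ** z = y ** (star y ** y) ** star y by rewrite /z !smulA.
  rewrite yy smulBr smulBl smulZr smulZl; congr (_ - _ *: _).
  by rewrite starM sn !smulA.
have ny : rnorm y ^+ 2 = rnorm (v - al%:C *: (n ** n)).
  by rewrite -yy rnorm_star_smul.
have nal : rnorm (al%:C *: (n ** n)) = al by rewrite rnormZr nnn mulr1 gtr0_norm.
have ny1 : rnorm y ^+ 2 <= al + et.
  by rewrite ny (le_trans (rnormD _ _))// rnormN nal addrC lerD2l.
have ny2 : al - et <= rnorm y ^+ 2.
  have := rnormD (v - (v - al%:C *: (n ** n))) 0.
  have := rnormD v (- (v - al%:C *: (n ** n))).
  have -> : v - (v - al%:C *: (n ** n)) = al%:C *: (n ** n) by abel.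
  by rewrite rnormN nal -ny; lra.
have pz : pos (z ** z) by apply: pos_sqr.
have pz2 : pos (al%:C *: (y ** n ** star (y ** n) + sc et)).
  by apply: posZ => //; move: pyn; rewrite smulA.
have := pos_add_le_norm (t := rnorm y ^+ 2 * et + al * et) pz pz2.
rewrite rnorm_sa_sqr// rnorm_smul_star => H.
have hz : rnorm (z ** z + al%:C *: (y ** n ** star (y ** n) + sc et)) <=
    rnorm y ^+ 2 * et + al * et.
  rewrite zz scalerDr scale_sc.
  have -> : y ** v ** star y - al%:C *: (y ** n ** star (y ** n)) +
     (al%:C *: (y ** n ** star (y ** n)) + sc (al * et)) =
     y ** v ** star y + sc (al * et) by abel.
  rewrite (le_trans (rnormD _ _))// lerD//; last first.
    by rewrite norm_sc ger0_norm// mulr_ge0// ltW.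
  rewrite (le_trans (rnorm_smul _ _))// rnorm_star expr2 mulrAC.
  rewrite ler_wpM2r ?rnorm_ge0//.
  rewrite (le_trans (rnorm_smul _ _))// ler_wpM2l ?rnorm_ge0//.
move: (H hz); rewrite /et in ny1 ny2 *; move: (rnorm y ^+ 2) ny1 ny2 => Y; nra.
Qed.

End Positivity.

(** * The Hahn-Banach theorem *)

Section HahnBanach.
Variables (R : realType) (V : lmodType R[i]).
Implicit Types (p q : V -> R) (x y z : V) (t : R).

Definition sublinear p := (forall x y, p (x + y) <= p x + p y) /\
  (forall t x, 0 <= t -> p (t%:C *: x) = t * p x).

Lemma sublinear0 p : sublinear p -> p 0 = 0.
Proof. by move=> [_ pZ]; rewrite -(scale0r (0 : V)) (pZ 0) ?mul0r. Qed.

Lemma sublinearN p x : sublinear p -> - p (- x) <= p x.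
Proof.
move=> sp; have := sublinear0 sp; rewrite -(subrr x) => p0.
by have := sp.1 x (- x); lra.
Qed.

(* The largest sublinear functional below q that is additive along x. *)
Let dir q x y := inf [set q (y + t%:C *: x) - t * q x | t in [set t | 0 <= t]].

Let dir_has q x y : sublinear q ->
  has_inf [set q (y + t%:C *: x) - t * q x | t in [set t | 0 <= t]].
Proof.
move=> sq; split; first by exists (q (y + 0%:C *: x) - 0 * q x), 0 => /=.
exists (- q (- y)) => _ [t /= t0 <-].
have := sq.1 (y + t%:C *: x) (- y); rewrite addrAC subrr add0r sq.2//; lra.
Qed.

Let dir_le q x y t : sublinear q -> 0 <= t ->
  dir q x y <= q (y + t%:C *: x) - t * q x.
Proof.
by move=> sq t0; apply: ge_inf; [case: (dir_has x y sq)|exists t].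
Qed.

Let dir_sublinear q x : sublinear q -> sublinear (dir q x).
Proof.
move=> sq; split=> [y z|t y t0].
  apply/ler_addgt0Pr => e e0; have e2 : 0 < e / 2 by rewrite divr_gt0.
  have [_ [t /= t0 <-] ht] := inf_adherent e2 (dir_has x y sq).
  have [_ [u /= u0 <-] hu] := inf_adherent e2 (dir_has x z sq).
  have := dir_le x (y + z) sq (addr_ge0 t0 u0).
  have := sq.1 (y + t%:C *: x) (z + u%:C *: x).
  have -> : y + t%:C *: x + (z + u%:C *: x) = y + z + (t + u)%:C *: x.
    by rewrite RCD scalerDl; abel.
  rewrite -/(dir q x y) in ht; rewrite -/(dir q x z) in hu; lra.
have le (s : R) w : 0 < s -> dir q x (s%:C *: w) <= s * dir q x w.
  move=> s0; rewrite mulrC -ler_pdivrMr//; apply: lb_le_inf; first by case: (dir_has x w sq).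
  move=> _ [u /= u0 <-]; rewrite ler_pdivrMr//.
  have su : 0 <= s * u by rewrite mulr_ge0// ltW.
  have := dir_le x (s%:C *: w) sq su.
  by rewrite RCM -scalerA -scalerDr sq.2 ?(ltW s0)//; lra.
have [->|tN] := eqVneq t 0.
  rewrite scale0r mul0r; apply/eqP; rewrite eq_le; apply/andP; split.
    by have := dir_le x 0 sq (lexx 0); rewrite scale0r addr0 (sublinear0 sq) mul0r subr0.
  apply: lb_le_inf; first by case: (dir_has x 0 sq).
  by move=> _ [u /= u0 <-]; rewrite add0r sq.2// subrr.
have tp : 0 < t by rewrite lt_neqAle eq_sym tN.
apply/eqP; rewrite eq_le le// andTb.
have tV : 0 < t^-1 by rewrite invr_gt0.
have := le _ (t%:C *: y) tV; rewrite scalerA -RCM mulVf// scale1r.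
by rewrite mulrC ler_pdivlMr// mulrC.
Qed.

Let minimal_linear q : sublinear q ->
  (forall q', sublinear q' -> (forall x, q' x <= q x) -> q' = q) ->
  (forall x y, q (x + y) = q x + q y) /\ (forall t x, q (t%:C *: x) = t * q x).
Proof.
move=> sq mq.
have dq x : dir q x = q.
  apply: mq; first exact: dir_sublinear.
  move=> y; have := dir_le x y sq (lexx 0).
  by rewrite scale0r addr0 mul0r subr0.
have qD x y : q (x + y) = q x + q y.
  apply/eqP; rewrite eq_le sq.1 andTb.
  have := dir_le x y sq ler01; rewrite dq scale1r mul1r (addrC y); lra.
split=> // t x; have [t0|t0] := leP 0 t; first exact: sq.2.
have q0 := sublinear0 sq.
have := qD (t%:C *: x) ((- t)%:C *: x).
rewrite -scalerDl -RCD subrr scale0r q0 (sq.2 (- t)) ?oppr_ge0 ?ltW//; lra.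
Qed.

(** A minimal sublinear functional is linear, which replaces the usual step by
    step extension of a functional from subspaces. *)
Theorem hahn_banach p x0 : sublinear p -> exists f : V -> R,
  [/\ forall x y, f (x + y) = f x + f y, forall t x, f (t%:C *: x) = t * f x,
      forall x, f x <= p x & f x0 = p x0].
Proof.
move=> sp; pose p' := dir p x0.
have sp' : sublinear p' by exact: dir_sublinear.
have p'p x : p' x <= p x.
  by have := dir_le x0 x sp (lexx 0); rewrite scale0r addr0 mul0r subr0.
pose T := {q : V -> R | sublinear q /\ forall x, q x <= p' x}.
pose le (q r : T) := `[< forall x, sval r x <= sval q x >].
have [||||[q [sq qp]] qmin] := @Zorn T le.
- by move=> q; apply/asboolP.
- move=> q r s /asboolP qr /asboolP rs; apply/asboolP => x.
  exact: le_trans (rs x) (qr x).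
- move=> [q hq] [r hr] /asboolP /= qr /asboolP /= rq; apply: eq_exist => /=.
  by apply/funext => x; apply/eqP; rewrite eq_le rq qr.
- move=> A totA; have [[a Aa]|nA] := pselect (exists a, A a); last first.
    have hp' : sublinear p' /\ forall x, p' x <= p' x by [].
    by exists (exist _ p' hp') => s As; case: nA; exists s.
  pose m x := inf [set sval s x | s in A].
  have hm x : has_inf [set sval s x | s in A].
    split; first by exists (sval a x), a.
    exists (- p' (- x)) => _ [s As <-]; have [ss sp2] := svalP s.
    by have := sublinearN x ss; have := sp2 (- x); lra.
  have mle x s : A s -> m x <= sval s x.
    by move=> As; apply: ge_inf; [case: (hm x)|exists s].
  have sm : sublinear m.
    split=> [x y|t x t0].
      apply/ler_addgt0Pr => e e0; have e2 : 0 < e / 2 by rewrite divr_gt0.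
      have [_ [s As <-] hs] := inf_adherent e2 (hm x).
      have [_ [r Ar <-] hr] := inf_adherent e2 (hm y).
      rewrite -/(m x) in hs; rewrite -/(m y) in hr.
      have [/asboolP sr|/asboolP rs] := totA s r As Ar.
        have := mle (x + y) r Ar; have := (svalP r).1.1 x y; have := sr x; lra.
      have := mle (x + y) s As; have := (svalP s).1.1 x y; have := rs y; lra.
    have [->|tN] := eqVneq t 0.
      rewrite mul0r scale0r; apply/eqP; rewrite eq_le; apply/andP; split.
        by rewrite (le_trans (mle 0 a Aa))// (sublinear0 (svalP a).1).
      apply: lb_le_inf; first by case: (hm 0).
      by move=> _ [s As <-]; rewrite (sublinear0 (svalP s).1).
    have tp : 0 < t by rewrite lt_neqAle eq_sym tN.
    apply/eqP; rewrite eq_le; apply/andP; split.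
      rewrite mulrC -ler_pdivrMr//; apply: lb_le_inf; first by case: (hm x).
      move=> _ [s As <-]; rewrite ler_pdivrMr// mulrC -(svalP s).1.2//.
      exact: mle.
    apply: lb_le_inf; first by case: (hm (t%:C *: x)).
    move=> _ [s As <-]; rewrite (svalP s).1.2// ler_wpM2l//; exact: mle.
  have hm' : sublinear m /\ forall x, m x <= p' x.
    by split=> // x; apply: le_trans (mle x a Aa) _; exact: (svalP a).2.
  by exists (exist _ m hm') => s As; apply/asboolP => x /=; exact: mle.
have [qD qZ] : (forall x y, q (x + y) = q x + q y) /\
    (forall t x, q (t%:C *: x) = t * q x).
  apply: minimal_linear => // r sr rq.
  have hr : sublinear r /\ forall x, r x <= p' x.
    by split=> // x; exact: le_trans (rq x) (qp x).
  have := qmin (exist _ r hr); have h : le (exist _ q (conj sq qp)) (exist _ r hr).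
    by apply/asboolP.
  by move=> /(_ h) /(congr1 sval).
exists q; split=> //; first by move=> x; exact: le_trans (qp x) (p'p x).
apply/eqP; rewrite eq_le (le_trans (qp _) (p'p _)) andTb.
have := qp (- x0); have := dir_le x0 (- x0) sp ler01.
rewrite scale1r addNr mul1r (sublinear0 sp) sub0r -/p'.
have := qZ (-1) x0; rewrite RCN scaleN1r; lra.
Qed.

End HahnBanach.

(** * States and the GNS construction *)

Section States.
Variables (R : realType) (U : cstarAlgType R) (e : U).
Hypotheses (mul1x : forall x, smul e x = x) (mulx1 : forall x, smul x e = x).
Hypothesis norm_one : rnorm e = 1.
Implicit Types (x y z a b w : U) (t : R) (phi : U -> R[i]).

Local Notation "x ** y" := (smul x y) (at level 40, left associativity).
Local Notation sc t := (t%:C *: e).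
Local Notation pos := (pos e).

Definition is_state phi := [/\ scalar phi, forall x, phi (star x) = (phi x)^*,
  forall x, 0 <= phi (star x ** x) & phi e = 1].

Let posD := @posD R U e.
Let pos_sc := @pos_sc R U e mulx1.
Let pos_sc_sub := @pos_sc_sub R U e mulx1.
Let posZ := @posZ R U e.
Let pos_star_mul := @pos_star_mul R U e mul1x mulx1 norm_one.

Let pos_sc_ge0 t : pos (sc t) -> 0 <= t.
Proof.
move=> [_ [u]]; rewrite -scalerBl -RCB rnormZr norm_one mulr1 => hu.
by have := ler_norm (u - t); lra.
Qed.

Let re x := (2^-1 : R)%:C *: (x + star x).

Let reD x y : re (x + y) = re x + re y.
Proof. by rewrite /re starD -scalerDr; congr (_ *: _); abel. Qed.

Let reZ t x : re (t%:C *: x) = t%:C *: re x.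
Proof. by rewrite /re starZr -scalerDr !scalerA mulrC. Qed.

Let star_re x : star (re x) = re x.
Proof. by rewrite /re starZr starD starK addrC. Qed.

Let re_sa x : star x = x -> re x = x.
Proof.
move=> sx; rewrite /re sx; have -> : x + x = (2 : R)%:C *: x by rewrite RCD scalerDl scale1r.
by rewrite scalerA -RCM mulVf// scale1r.
Qed.

(* The largest spectral value of the self-adjoint part of x. *)
Let top x := inf [set t | pos (sc t - re x)].

Let top_has x : has_inf [set t | pos (sc t - re x)].
Proof.
split; first by exists (rnorm (re x)); apply: pos_sc_sub.
exists (- rnorm (re x)) => t /= pt.
have : pos (sc (t + rnorm (re x))).
  have -> : sc (t + rnorm (re x)) = sc t - re x + (sc (rnorm (re x)) - - re x).
    by rewrite RCD scalerDl; abel.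
  apply: posD => //; apply: pos_sc_sub => //; last by rewrite rnormN.
  by rewrite starN star_re.
by move=> /pos_sc_ge0; lra.
Qed.

Let top_le x t : pos (sc t - re x) -> top x <= t.
Proof. by move=> h; apply: ge_inf; [case: (top_has x)|]. Qed.

Let top_sublinear : sublinear top.
Proof.
split=> [x y|t x t0].
  apply/ler_addgt0Pr => d d0; have d2 : 0 < d / 2 by rewrite divr_gt0.
  have [t pt ht] := inf_adherent d2 (top_has x).
  have [u pu hu] := inf_adherent d2 (top_has y).
  have : top (x + y) <= t + u.
    apply: top_le; rewrite reD RCD scalerDl.
    have -> : sc t + sc u - (re x + re y) = sc t - re x + (sc u - re y) by abel.
    exact: posD.
  rewrite -/(top x) in ht; rewrite -/(top y) in hu; lra.
have le (s : R) w : 0 < s -> top (s%:C *: w) <= s * top w.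
  move=> s0; rewrite mulrC -ler_pdivrMr//; apply: lb_le_inf; first by case: (top_has w).
  move=> u /= pu; rewrite ler_pdivrMr// mulrC; apply: top_le.
  by rewrite reZ RCM -scalerA -scalerBr; apply: posZ => //; apply: ltW.
have [->|tN] := eqVneq t 0.
  rewrite scale0r mul0r; have re0 : re 0 = 0 by rewrite /re star0 addr0 scaler0.
  apply/eqP; rewrite eq_le; apply/andP; split.
    by apply: top_le; rewrite re0 subr0; apply: pos_sc.
  apply: lb_le_inf; first by case: (top_has 0).
  by move=> u /=; rewrite re0 subr0 => /pos_sc_ge0.
have tp : 0 < t by rewrite lt_neqAle eq_sym tN.
apply/eqP; rewrite eq_le le// andTb.
have tV : 0 < t^-1 by rewrite invr_gt0.
have := le _ (t%:C *: x) tV; rewrite scalerA -RCM mulVf// scale1r.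
by rewrite mulrC ler_pdivlMr// mulrC.
Qed.

(** A real functional below the largest spectral value of the self-adjoint part
    is positive and takes the value 1 at the unit; its complexification is a
    state. The theorem of Hahn and Banach makes it attain this value at b^* b,
    where it is |b|^2. *)
Theorem state_exists b : exists phi, is_state phi /\
  phi (star b ** b) = (rnorm b ^+ 2)%:C.
Proof.
have [f [fD fZ fp fb]] := hahn_banach (star b ** b) top_sublinear.
have f0 : f 0 = 0 by rewrite -(scale0r (0 : U)) (fZ 0) mul0r.
have fN x : f (- x) = - f x.
  by rewrite -scaleN1r -(rmorphN1 (real_complex R)) fZ mulN1r.
have f_skew x : re x = 0 -> f x = 0.
  move=> rx; have rNx : re (- x) = 0 by rewrite -scaleN1r -(rmorphN1 (real_complex R)) reZ rx scaler0.
  have t0 y : re y = 0 -> f y <= 0.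
    move=> ry; rewrite (le_trans (fp _))//; apply: top_le.
    by rewrite ry subr0; apply: pos_sc.
  by have := t0 x rx; have := t0 (- x) rNx; rewrite fN; lra.
have fstar x : f (star x) = f x.
  apply/eqP; rewrite -subr_eq0 -fN -fD; apply/eqP/f_skew.
  rewrite /re starD starK starN.
  have -> : star x - x + (x - star x) = 0 by abel.
  by rewrite scaler0.
have fpos x : pos x -> 0 <= f x.
  move=> px; have : f (- x) <= 0.
    rewrite (le_trans (fp _))//; apply: top_le.
    have -> : re (- x) = - x by rewrite re_sa// starN (pos_sa px).
    by rewrite scale0r sub0r opprK.
  by rewrite fN; lra.
have sas : star (star b ** b) = star b ** b by rewrite starM starK.
have star1 : star e = e by have := pos_sa (pos_sc (@ler01 R)); rewrite scale1r.
have fe : f e = 1.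
  have h1 : f e <= 1.
    rewrite (le_trans (fp _))//; apply: top_le; rewrite re_sa// scale1r subrr.
    by have := pos_sc (lexx (0 : R)); rewrite scale0r.
  have h2 : f (- e) <= -1.
    rewrite (le_trans (fp _))//; apply: top_le; rewrite re_sa ?starN ?star1//.
    rewrite RCN scaleN1r subrr.
    by have := pos_sc (lexx (0 : R)); rewrite scale0r.
  by move: h2; rewrite fN; lra.
pose phi x : R[i] := Complex (f x) (- f ('i *: x)).
have fI x : f ('i *: ('i *: x)) = - f x.
  by rewrite scalerA -expr2 sqrCi scaleN1r fN.
exists phi; split; first split.
- move=> c x y; rewrite /phi !scalerDr !fD.
  have -> : c = (complex.Re c)%:C + (complex.Im c)%:C * 'i.
    by case: c => p q; apply/eqP; rewrite eq_complex /= !(mulr0, mulr1, mul0r, subr0, addr0, add0r) !eqxx.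
  move: (complex.Re c) (complex.Im c) => p q.
  rewrite !scalerA mulrDr !scalerDl !fD.
  have -> : 'i * (q%:C * 'i) = - q%:C :> R[i].
    by rewrite mulrCA -expr2 sqrCi mulrN1.
  rewrite -!scalerA scaleNr fN (scalerA 'i) (mulrC 'i) -!scalerA !fZ.
  apply/eqP; rewrite eq_complex /=.
  by apply/andP; split; apply/eqP; ring.
- move=> x; rewrite /phi fstar.
  have -> : f ('i *: star x) = - f ('i *: x).
    rewrite -(fstar ('i *: x)) -fN; congr f.
    by rewrite starZ conj_i scaleNr opprK.
  by apply/eqP; rewrite eq_complex /= !eqxx.
- move=> x; have sx : f ('i *: (star x ** x)) = 0.
    by apply: f_skew; rewrite /re starZ conj_i starM starK scaleNr subrr scaler0.
  have -> : phi (star x ** x) = (f (star x ** x))%:C by rewrite /phi sx oppr0.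
  by rewrite ler0c fpos//; apply: pos_star_mul.
- have -> : phi e = (f e)%:C; last by rewrite fe.
  rewrite /phi (f_skew ('i *: e)) ?oppr0//.
  by rewrite /re starZ conj_i star1 scaleNr subrr scaler0.
- have -> : phi (star b ** b) = (f (star b ** b))%:C.
    rewrite /phi (f_skew ('i *: (star b ** b))) ?oppr0//.
    by rewrite /re starZ conj_i sas scaleNr subrr scaler0.
  rewrite fb; suff -> : top (star b ** b) = rnorm b ^+ 2 by [].
  rewrite -rnorm_star_smul; apply/eqP; rewrite eq_le; apply/andP; split.
    by apply: top_le; rewrite re_sa//; apply: pos_sc_sub.
  apply: lb_le_inf; first by case: (top_has (star b ** b)).
  move=> t /=; rewrite re_sa// => h; apply: (pos_le_norm mul1x mulx1 norm_one) h.
  by apply: pos_star_mul.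
Qed.

(* As w = r^2 up to a small multiple of 1, the value is nearly phi of the square
   of r z. *)
Let state_ge0 phi w z : is_state phi -> pos w -> 0 <= phi (star z ** w ** z).
Proof.
move=> [lphi cphi pphi _] pw.
have phiD x y : phi (x + y) = phi x + phi y.
  by rewrite -[x]scale1r lphi mul1r scale1r.
have phi0 : phi 0 = 0 by apply: (addrI (phi 0)); rewrite -phiD !addr0.
have phiZ c x : phi (c *: x) = c * phi x.
  by rewrite -[c *: x]addr0 lphi phi0 addr0.
have real x : star x = x -> phi x = (complex.Re (phi x))%:C.
  move=> sx; have := cphi x; rewrite sx; case: (phi x) => p q /eqP.
  by rewrite eq_complex /= eqxx /= => /eqP q0; apply/eqP; rewrite eq_complex /= eqxx; apply/eqP; lra.
have zw : star (star z ** w ** z) = star z ** w ** z.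
  by rewrite !starM starK (pos_sa pw) smulA.
rewrite (real _ zw) ler0c; apply/ler_addgt0Pr => d d0.
pose q := complex.Re (phi (star z ** z)).
have q0 : 0 <= q by rewrite -ler0c -ge0_RRe.
have h0 : 0 < d / (q + 1) by rewrite divr_gt0// ltr_pwDr.
have [r [/pos_sa sr rr _]] := pos_sqrt mul1x mulx1 pw h0.
have := pphi (r ** z); rewrite starM sr smulA -(smulA (star z)) rr.
rewrite smulDr smulDl smulZr smulZl mulx1 phiD phiZ (real _ zw).
rewrite [phi (star z ** z)]ge0_RRe// -RCM -RCD ler0c -/q => /le_trans; apply.
rewrite lerD2l mulrAC ler_pdivrMr ?ltr_pwDr// ler_wpM2l ?(ltW d0)// lerDl//.
Qed.

(** The representations of all states are placed on one space, generated by the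
    pairs of a state and a vector. Left multiplication by a is bounded there by
    the norm of a, because |a|^2 - a^* a is positive, and a state that attains
    |a|^2 at a^* a shows that the bound is sharp. *)
Theorem gns : exists (H : hilbertType R) (rho : {linear U -> bop H}),
  star_hom rho /\ forall a, opnorm (rho a) = rnorm a.
Proof.
pose S := {phi : U -> R[i] | is_state phi}.
have stD (p : S) x y : sval p (x + y) = sval p x + sval p y.
  by have [lp _ _ _] := svalP p; rewrite -[x]scale1r lp mul1r scale1r.
have st0 (p : S) : sval p 0 = 0 by apply: (addrI (sval p 0)); rewrite -stD !addr0.
have stZ (p : S) c x : sval p (c *: x) = c * sval p x.
  by have [lp _ _ _] := svalP p; rewrite -[c *: x]addr0 lp st0 addr0.
pose kf (w : U) (p q : S * U) : R[i] :=
  if `[< p.1 = q.1 >] then sval p.1 (star q.2 ** w ** p.2) else 0.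
have st_sum (p : S) (I : Type) (s : seq I) (F : I -> U) :
    sval p (\sum_(i <- s) F i) = \sum_(i <- s) sval p (F i).
  by elim/big_rec2 : _ => [|i u v _ <-]; rewrite ?st0 ?stD.
have kf_psd w : pos w -> psd (kf w).
  move=> pw; apply: (@psd_dsum R S U (fun p x y => sval p (star y ** w ** x))) => p s.
  have := state_ge0 (\sum_(i <- s) i.1 *: i.2) (svalP p) pw.
  rewrite /kform star_sum smul_suml smul_suml st_sum exchange_big /=.
  set l := \sum_(i <- s) _; set r := \sum_(i <- s) _ => h.
  suff <- : l = r by [].
  apply: eq_bigr => i _; rewrite smul_sumr st_sum; apply: eq_bigr => j _.
  by rewrite starZ !smulZl smulZr !stZ mulrA (mulrC (i.1^*)).
have pe : pos e by have := pos_sc (@ler01 R); rewrite scale1r.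
have herm_k : herm (kf e).
  move=> p q; rewrite /kf; case: asboolP => [pq|pq].
    rewrite asboolT; last by rewrite pq.
    have [_ <- _ _] := svalP p.1; rewrite pq; congr (sval _ _).
    by rewrite !starM starK (pos_sa pe) smulA.
  by rewrite asboolF ?conjC0// => qp; apply: pq.
pose k := PKernel herm_k (kf_psd e pe).
pose H : hilbertType R := rkhs k.
pose el (p : S * U) : H := relem k p.
have dot_el p q : dot (el p) (el q) = kf e p q by exact: dot_elem.
have el_total : total_family el by exact: total_relem.
pose T (a : U) (p : S * U) : H := el (p.1, a ** p.2).
have bound a : psd (fun p q => ((rnorm a) ^+ 2)%:C * dot (el p) (el q)
    - dot (T a p) (T a q)).
  pose w := (rnorm a ^+ 2)%:C *: e - star a ** a.
  apply: psd_ext (kf_psd w _); last first.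
    by apply: pos_sc_sub => //; rewrite ?starM ?starK// rnorm_star_smul.
  move=> p q; rewrite !dot_el /kf /=; case: asboolP => [pq|_]; last first.
    by rewrite mulr0 subrr.
  have -> : star (a ** q.2) ** e ** (a ** p.2) = star q.2 ** (star a ** a) ** p.2.
    by rewrite starM mulx1 !smulA.
  by rewrite /w smulBr smulBl smulZr smulZl stD -scaleN1r !stZ mulN1r.
pose rho0 a : bop H := bop_ext (rnorm_ge0 a) (bound a).
have rhoE a p : rho0 a (el p) = el (p.1, a ** p.2) by exact: bop_extE.
have el_lin p c x y : el (p, c *: x + y) = c *: el (p, x) + el (p, y).
  apply: (total_inj el_total) => q; rewrite dotDl dotZl !dot_el /kf /=.
  case: asboolP => _; last by rewrite mulr0 addr0.
  by rewrite smulDr smulZr stD stZ.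
have lrho : linear rho0.
  move=> c a b; apply: (bop_total_eq el_total) => p.
  by rewrite bopDE bopZE !rhoE smulDl smulZl el_lin.
pose rho : {linear U -> bop H} := HB.pack rho0
  (GRing.isLinear.Build R[i] U (bop H) *:%R rho0 lrho).
exists H, rho; split; first split.
- move=> a b; apply: (bop_total_eq el_total) => p.
  by rewrite /= rhoE rhoE rhoE /= smulA.
- move=> a; apply/esym; apply: (bop_total_adj el_total) => p q.
  rewrite !rhoE !dot_el /kf /=; case: asboolP => // _.
  by rewrite starM starK !mulx1 smulA.
- move=> a; apply/eqP; rewrite eq_le; apply/andP; split.
    apply: opnorm_le => [|v]; first exact: rnorm_ge0.
    exact: bop_ext_le.
  have [phi [sphi phia]] := state_exists a.
  pose p : S := exist _ phi sphi.
  have n1 : rnorm (el (p, e)) = 1.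
    apply/eqP; rewrite -(@eqrXn2 _ 2) ?rnorm_ge0// expr1n; apply/eqP/complexI.
    rewrite -dotxx dot_el /kf asboolT//= (pos_sa pe) !mulx1.
    by case: (sphi).
  have := opnormP (rho0 a) (el (p, e)); rewrite n1 mulr1 => /le_trans h.
  rewrite -(@ler_pXn2r _ 2) ?nnegrE ?rnorm_ge0 ?opnorm_ge0//.
  rewrite (@le_trans _ _ (rnorm (rho0 a (el (p, e))) ^+ 2))//; last first.
    by rewrite ler_pXn2r ?nnegrE ?rnorm_ge0 ?opnorm_ge0// h.
  rewrite le_eqVlt; apply/orP; left; apply/eqP/complexI.
  by rewrite -dotxx rhoE dot_el /kf asboolT//= !mulx1 -phia.
Qed.

End States.

(** * The unitization *)

Definition unitization (R : realType) (A : cstarAlgType R) : Type :=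
  (A * R[i])%type.

Section Unitization.
Variables (R : realType) (A : cstarAlgType R).
Local Notation U := (unitization A).
Implicit Types (x y z : U) (a b c : A).

HB.instance Definition _ := Choice.copy U (A * R[i])%type.
HB.instance Definition _ := GRing.Lmodule.copy U (A * R[i])%type.

Let umul x y : U := (smul x.1 y.1 + y.2 *: x.1 + x.2 *: y.1, x.2 * y.2).
Let ustar x : U := (star x.1, x.2^*).

Let UP x y : x.1 = y.1 -> x.2 = y.2 -> x = y.
Proof. by case: x y => [? ?] [? ?] /= -> ->. Qed.

Let umulA : associative umul.
Proof.
move=> x y z; apply: UP; rewrite /= ?mulrA//.
rewrite !(smulDl, smulDr, smulZl, smulZr, scalerDr) !scalerA smulA.
by rewrite (mulrC z.2 y.2) (mulrC z.2 x.2); abel.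
Qed.

Let umulDl : left_distributive umul +%R.
Proof.
move=> x y z; apply: UP; rewrite /= ?mulrDl//.
by rewrite smulDl scalerDr scalerDl; abel.
Qed.

Let umulDr : right_distributive umul +%R.
Proof.
move=> x y z; apply: UP; rewrite /= ?mulrDr//.
by rewrite smulDr scalerDr scalerDl; abel.
Qed.

Let umulZl (l : R[i]) x y : umul (l *: x) y = l *: umul x y.
Proof.
apply: UP => /=; last exact: (esym (mulrA l x.2 y.2)).
by rewrite smulZl !scalerDr !scalerA (mulrC l).
Qed.

Let umulZr (l : R[i]) x y : umul x (l *: y) = l *: umul x y.
Proof.
apply: UP => /=; last exact: (mulrCA x.2 l y.2).
by rewrite smulZr !scalerDr !scalerA (mulrC l x.2).
Qed.

Let ustarK : involutive ustar.
Proof. by move=> x; apply: UP; rewrite /= ?starK ?conjCK. Qed.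

Let ustarD : {morph ustar : x y / x + y}.
Proof. by move=> x y; apply: UP; rewrite /= ?starD// rmorphD. Qed.

Let ustarZ (l : R[i]) x : ustar (l *: x) = l^* *: ustar x.
Proof. by apply: UP => /=; [exact: starZ|exact: (conjM l x.2)]. Qed.

Let ustarM x y : ustar (umul x y) = umul (ustar y) (ustar x).
Proof.
apply: UP; rewrite /= ?conjM ?(mulrC x.2^*)//.
by rewrite !starD !starZ starM; abel.
Qed.

HB.instance Definition _ := Lmodule_isStarAlgebra.Build R U
  umulA umulDl umulDr umulZl umulZr ustarK ustarD ustarZ ustarM.

(* The left multiplication by x on A. *)
Let lm x c : A := smul x.1 c + x.2 *: c.

Let lmD x y c : lm (x + y) c = lm x c + lm y c.
Proof. by rewrite /lm smulDl scalerDl; abel. Qed.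
Let lmZ (l : R[i]) x c : lm (l *: x) c = l *: lm x c.
Proof. by rewrite /lm smulZl scalerDr scalerA. Qed.
Let lmM x y c : lm (smul x y) c = lm x (lm y c).
Proof.
rewrite /lm /= !(smulDl, smulDr, smulZl, smulZr, scalerDr) !scalerA smulA.
by abel.
Qed.
Let lmZr x (l : R[i]) c : lm x (l *: c) = l *: lm x c.
Proof. by rewrite /lm smulZr scalerDr !scalerA mulrC. Qed.
Let lm_star x c d : smul (star (lm x c)) d = smul (star c) (lm (star x) d).
Proof. by rewrite /lm starD starM starZ smulDl smulDr smulZl smulZr smulA. Qed.

Let lset x := [set rnorm (lm x c) | c in [set c | rnorm c <= 1]].
Let ln x : R := sup (lset x).

Let lset_has x : has_sup (lset x).
Proof.
split; first by exists (rnorm (lm x 0)), 0 => //=; rewrite rnorm0.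
exists (rnorm x.1 + complex.Re `|x.2|) => _ [c /= c1 <-].
rewrite (le_trans (rnormD _ _))// rnormZ lerD//.
  by rewrite (le_trans (rnorm_smul _ _))// ler_piMr ?rnorm_ge0.
by rewrite ler_piMr ?cnorm_ge0.
Qed.

Let ln_ge0 x : 0 <= ln x.
Proof.
apply: (@le_trans _ _ (rnorm (lm x 0))); first exact: rnorm_ge0.
by apply: ub_le_sup; [case: (lset_has x)|exists 0 => //=; rewrite rnorm0].
Qed.

Let lnP x c : rnorm (lm x c) <= ln x * rnorm c.
Proof.
have [c0|cN] := eqVneq (rnorm c) 0.
  by rewrite (rnorm_eq0 c0) /lm smul0r scaler0 addr0 !rnorm0 mulr0.
have cp : 0 < rnorm c by rewrite lt_neqAle eq_sym cN rnorm_ge0.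
rewrite -ler_pdivrMr//; apply: ub_le_sup; first by case: (lset_has x).
exists ((rnorm c)^-1%:C *: c) => /=.
  by rewrite rnormZr ger0_norm ?invr_ge0 ?rnorm_ge0// mulVf.
by rewrite lmZr rnormZr ger0_norm ?invr_ge0 ?rnorm_ge0// mulrC.
Qed.

Let ln_le x M : 0 <= M -> (forall c, rnorm (lm x c) <= M * rnorm c) -> ln x <= M.
Proof.
move=> M0 xM; apply: ge_sup; first by case: (lset_has x).
by move=> _ [c /= c1 <-]; rewrite (le_trans (xM c))// ler_piMr.
Qed.

Let ln_le_sum x : ln x <= rnorm x.1 + complex.Re `|x.2|.
Proof.
apply: ln_le => [|c]; first by rewrite addr_ge0 ?rnorm_ge0 ?cnorm_ge0.
by rewrite (le_trans (rnormD _ _))// rnormZ mulrDl lerD// rnorm_smul.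
Qed.

Let lnD x y : ln (x + y) <= ln x + ln y.
Proof.
apply: ln_le => [|c]; first by rewrite addr_ge0.
by rewrite lmD (le_trans (rnormD _ _))// mulrDl lerD ?lnP.
Qed.

Let lnM x y : ln (smul x y) <= ln x * ln y.
Proof.
apply: ln_le => [|c]; first by rewrite mulr_ge0.
by rewrite lmM (le_trans (lnP _ _))// -mulrA ler_wpM2l.
Qed.

Let lnZ_le (l : R[i]) x : ln (l *: x) <= complex.Re `|l| * ln x.
Proof.
apply: ln_le => [|c]; first by rewrite mulr_ge0 ?cnorm_ge0.
by rewrite lmZ rnormZ -mulrA ler_wpM2l ?cnorm_ge0.
Qed.

Let ln_sq_le x : ln x ^+ 2 <= ln (smul (star x) x).
Proof.
set K := ln (smul _ _); have K0 : 0 <= K := ln_ge0 _.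
rewrite -[K]sqr_sqrtr// ler_pXn2r ?nnegrE ?sqrtr_ge0//.
apply: ln_le => [|c]; first exact: sqrtr_ge0.
rewrite -(@ler_pXn2r _ 2) ?nnegrE ?mulr_ge0 ?sqrtr_ge0 ?rnorm_ge0//.
rewrite exprMn sqr_sqrtr// -rnorm_star_smul lm_star -lmM.
rewrite (le_trans (rnorm_smul _ _))// rnorm_star mulrC expr2 mulrA.
by rewrite ler_wpM2r ?rnorm_ge0// lnP.
Qed.

Let ln_star_le x : ln x <= ln (star x).
Proof.
have [->|xN] := eqVneq (ln x) 0; first exact: ln_ge0.
have xp : 0 < ln x by rewrite lt_neqAle eq_sym xN ln_ge0.
by rewrite -(ler_pM2r xp) -expr2 (le_trans (ln_sq_le x))// lnM.
Qed.

Let ln_star x : ln (star x) = ln x.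
Proof.
by apply/eqP; rewrite eq_le ln_star_le andbT -{2}(starK x) ln_star_le.
Qed.

Let ln_star_mul x : ln (smul (star x) x) = ln x ^+ 2.
Proof.
by apply/eqP; rewrite eq_le ln_sq_le andbT (le_trans (lnM _ _))// ln_star expr2.
Qed.

Let n00 : complex.Re `|0 : R[i]| = 0. Proof. by rewrite normr0. Qed.
Let n11 : complex.Re `|1 : R[i]| = 1. Proof. by rewrite normr1. Qed.

Let ln_sc (l : R[i]) : ln ((0, l) : U) <= complex.Re `|l|.
Proof. by apply: le_trans (ln_le_sum _) _; rewrite rnorm0 add0r. Qed.

(* The norm of A is recovered by applying the multiplication by a to a^*. *)
Let ln_base a : ln ((a, 0) : U) = rnorm a.
Proof.
apply/eqP; rewrite eq_le; apply/andP; split.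
  by apply: le_trans (ln_le_sum _) _; rewrite n00 addr0.
have := lnP ((a, 0) : U) (star a); rewrite /lm /= scale0r addr0 rnorm_smul_star rnorm_star.
have [->|aN] := eqVneq (rnorm a) 0; first by rewrite ln_ge0.
by rewrite expr2 ler_pM2r// lt_neqAle eq_sym aN rnorm_ge0.
Qed.

(** When A has a unit the left multiplications do not see all of its
    unitization, so the norm also records the scalar part. *)
Let un x : R := Num.max (ln x) (complex.Re `|x.2|).

Let un_ln x : ln x <= un x. Proof. by rewrite le_max lexx. Qed.
Let un_sc x : complex.Re `|x.2| <= un x. Proof. by rewrite le_max lexx orbT. Qed.
Let un_ge0 x : 0 <= un x. Proof. by rewrite le_max ln_ge0. Qed.

Let unD x y : un (x + y) <= un x + un y.
Proof.
rewrite {1}/un ge_max; apply/andP; split.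
  by rewrite (le_trans (lnD _ _))// lerD.
by rewrite /= (le_trans (cnormD _ _))// lerD.
Qed.

Let unZ_le (l : R[i]) x : un (l *: x) <= complex.Re `|l| * un x.
Proof.
rewrite {1}/un ge_max; apply/andP; split.
  by rewrite (le_trans (lnZ_le _ _))// ler_wpM2l ?cnorm_ge0.
by rewrite -[(l *: x).2]/(l * x.2) cnormM ler_wpM2l ?cnorm_ge0.
Qed.

Let un_base_le x : rnorm x.1 <= un x + un x.
Proof.
rewrite -ln_base; have -> : ((x.1, 0) : U) = x + ((0, - x.2) : U).
  by apply: UP => /=; [rewrite addr0|rewrite subrr].
apply: le_trans (lnD _ _) _; apply: lerD => //.
by apply: le_trans (ln_sc _) _; rewrite normrN.
Qed.

Let un_le x : un x <= rnorm x.1 + complex.Re `|x.2|.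
Proof. by rewrite ge_max ln_le_sum lerDr rnorm_ge0. Qed.

Let un_eq0 x : un x = 0 -> x = 0.
Proof.
move=> x0; have h := un_base_le x; have h' := un_sc x; rewrite x0 addr0 in h h'.
apply: UP => /=; first by apply: rnorm_eq0; apply/eqP; rewrite eq_le h rnorm_ge0.
by apply/eqP; rewrite -normr_eq0 cnormE (_ : complex.Re _ = 0)//; apply/eqP; rewrite eq_le h' cnorm_ge0.
Qed.

Let unZ (l : R[i]) x : un (l *: x) = complex.Re `|l| * un x.
Proof. exact: (@homogeneous_of_le _ _ _ 0 un_ge0 unZ_le). Qed.

Let un_complete (u : nat -> U) : rcauchy un u -> exists l, rlim un u l.
Proof.
move=> cu.
have [|a aP] := @rcauchy_lim R A (fun n => (u n).1).
  move=> e e0; have [N NP] := cu _ (divr_gt0 e0 (ltr0Sn R 1)).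
  exists N => m k Nm Nk; have := un_base_le (u m - u k).
  by move=> /le_trans; apply; rewrite [leRHS]splitr lerD ?NP.
have [|l lP] := @complex_cauchy_lim R (fun n => (u n).2).
  move=> e /cu[N NP]; exists N => m k Nm Nk.
  exact: le_trans (un_sc (u m - u k)) (NP m k Nm Nk).
exists (a, l) => e e0; have e2 : 0 < e / 2 by rewrite divr_gt0.
have [N1 h1] := aP _ e2; have [N2 h2] := lP _ e2.
exists (maxn N1 N2) => m; rewrite geq_max => /andP[m1 m2].
by rewrite (le_trans (un_le _))// [leRHS]splitr lerD ?h1 ?h2.
Qed.

HB.instance Definition _ := Lmodule_isRBanach.Build R U unD unZ un_eq0 un_complete.

Let rnorm_u x : rnorm x = un x. Proof. by []. Qed.

Let unM x y : un (smul x y) <= un x * un y.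
Proof.
rewrite {1}/un ge_max; apply/andP; split.
  by rewrite (le_trans (lnM _ _))// ler_pM.
by rewrite -[(smul x y).2]/(x.2 * y.2) cnormM ler_pM ?cnorm_ge0.
Qed.

Let un_star_mul x : un (smul (star x) x) = un x ^+ 2.
Proof.
rewrite {1}/un ln_star_mul -[(smul (star x) x).2]/(x.2^* * x.2).
rewrite cnormM cnorm_conj -expr2 /un /Num.max.
have h : (ln x ^+ 2 < complex.Re `|x.2| ^+ 2) = (ln x < complex.Re `|x.2|).
  by rewrite ltr_pXn2r ?nnegrE ?cnorm_ge0.
by rewrite h; case: ifP.
Qed.

Let unorm_smul x y : `|smul x y| <= `|x| * `|y|.
Proof. by rewrite !rnormE -RCM lecR !rnorm_u unM. Qed.

Let unorm_star x : `|smul (star x) x| = `|x| ^+ 2.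
Proof. by rewrite !rnormE -RCX !rnorm_u un_star_mul. Qed.

HB.instance Definition _ := StarAlgebra_isCStar.Build R U unorm_smul unorm_star.

Definition unit_one : U := (0, 1).

Lemma unit_mul1x x : smul unit_one x = x.
Proof. by apply: UP; rewrite /= ?mul1r// smul0l scaler0 scale1r !add0r. Qed.

Lemma unit_mulx1 x : smul x unit_one = x.
Proof. by apply: UP; rewrite /= ?mulr1// smul0r scaler0 scale1r addr0 add0r. Qed.

Lemma unit_norm_one : rnorm unit_one = 1.
Proof.
rewrite rnorm_u /un /unit_one n11; apply/eqP; rewrite eq_le ge_max le_max lexx orbT !andbT.
by apply: le_trans (ln_sc _) _; rewrite n11.
Qed.

Lemma unit_base a : rnorm ((a, 0) : U) = rnorm a.
Proof.
rewrite rnorm_u /un ln_base n00.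
by apply/eqP; rewrite eq_le ge_max le_max lexx rnorm_ge0.
Qed.

(** The unitization supplies the unit that states and their representations need. *)
Theorem gelfand_naimark : exists (H : hilbertType R) (rho : {linear A -> bop H}),
  star_hom rho /\ forall a, opnorm (rho a) = rnorm a.
Proof.
have [H [rho [[rM rS] rN]]] := gns unit_mul1x unit_mulx1 unit_norm_one.
pose i a : U := (a, 0).
have li : linear (rho \o i).
  move=> c a b /=; rewrite -linearP; congr (rho _).
  by apply: UP => //=; rewrite addr0; apply/esym/mulr0.
pose r : {linear A -> bop H} := HB.pack (rho \o i)
  (GRing.isLinear.Build R[i] A (bop H) *:%R (rho \o i) li).
exists H, r; split; first split.
- move=> a b /=; rewrite -rM; congr (rho _).
  by apply: UP; rewrite //= ?mulr0// !scale0r !addr0.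
- by move=> a /=; rewrite -rS; congr (rho _); apply: UP; rewrite //= conjC0.
- by move=> a /=; rewrite rN unit_base.
Qed.

End Unitization.

(** * Tensor products and square summable functions *)

Section BoundedGram.
Variables (R : realType) (H : hilbertType R).

Lemma rnorm_comb (X : Type) (T : bop H) (e : X -> H) (s : seq (R[i] * X)) :
  \sum_(p <- s) p.1 *: T (e p.2) = T (\sum_(p <- s) p.1 *: e p.2).
Proof. by rewrite linear_sum; apply: eq_bigr => p _; rewrite linearZ. Qed.

(** The form in which the boundedness of an operator enters the Schur product
    theorem and orthogonal sums. *)
Lemma psd_bop (X : Type) (e : X -> H) (T : bop H) M : (forall v, rnorm (T v) <= M * rnorm v) -> 0 <= M ->
  psd (fun x y => (M ^+ 2)%:C * dot (e x) (e y) - dot (T (e x)) (T (e y))).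
Proof.
move=> TM M0; apply/psd_subgram => s; rewrite rnorm_comb -exprMn.
by rewrite ler_pXn2r ?nnegrE ?mulr_ge0 ?rnorm_ge0.
Qed.

End BoundedGram.

Section HilbertTensor.
Variables (R : realType) (L K : hilbertType R).
Implicit Types (l : L) (k : K) (S : bop L) (T : bop K).

Let tker (p q : L * K) : R[i] := dot p.1 q.1 * dot p.2 q.2.

Let tker_herm : herm tker.
Proof. by move=> p q; rewrite /tker conjM -!dotC. Qed.

Let tker_psd : psd tker.
Proof. by apply: psd_schur (@psd_gram R _ L fst). Qed.

Let tkernel := PKernel tker_herm tker_psd.

(** The Hilbert space tensor product: its kernel is the entrywise product of the
    Gram kernels of L and K. *)
Definition htens : hilbertType R := rkhs tkernel.

Definition tel l k : htens := relem tkernel (l, k).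

Lemma dot_tel l k l' k' : dot (tel l k) (tel l' k') = dot l l' * dot k k'.
Proof. exact: dot_elem. Qed.

Lemma tel_full : total_family (fun p : L * K => tel p.1 p.2).
Proof. by move=> v h; apply: (@total_relem _ _ tkernel) => -[l k]; exact: (h (l, k)). Qed.

Lemma tel_linl c l l' k : tel (c *: l + l') k = c *: tel l k + tel l' k.
Proof.
apply: (total_inj tel_full) => -[m n].
by rewrite dotDl dotZl !dot_tel dotDl dotZl mulrDl mulrA.
Qed.

Lemma tel_linr c l k k' : tel l (c *: k + k') = c *: tel l k + tel l k'.
Proof.
apply: (total_inj tel_full) => -[m n].
by rewrite dotDl dotZl !dot_tel dotDl dotZl mulrDr mulrCA.
Qed.

Lemma rnorm_tel l k : rnorm (tel l k) = rnorm l * rnorm k.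
Proof.
apply/eqP; rewrite -(@eqrXn2 _ 2) ?mulr_ge0 ?rnorm_ge0//; apply/eqP/complexI.
by rewrite -dotxx dot_tel !dotxx exprMn [RHS]RCM.
Qed.

(** A vector v of the tensor product and an l in L define a bounded functional
    k |-> <l (x) k, v> on K, which is given by a vector of K. *)
Lemma tel_total (X : Type) (e : X -> K) : total_family e ->
  total_family (fun p : L * X => tel p.1 (e p.2)).
Proof.
move=> te v h; apply: tel_full => -[l k] /=.
have [z zP] : exists z, forall k, dot (tel l k) v = dot k z.
  apply: (@riesz R K (fun k => dot (tel l k) v) (rnorm l * rnorm v)).
    by move=> c a b /=; rewrite tel_linr dotDl dotZl.
  move=> k'; rewrite cnormE rnormE -RCM lecR (le_trans (cnorm_dot _ _))//.
  by rewrite rnorm_tel mulrAC.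
have z0 : z = 0.
  apply: te => x; rewrite dotC -zP -dotC; exact: (h (l, x)).
by rewrite dotC zP z0 dot0r conjC0.
Qed.

Lemma tensl_bound S : psd (fun p q : L * K =>
  (opnorm S ^+ 2)%:C * dot (tel p.1 p.2) (tel q.1 q.2)
    - dot (tel (S p.1) p.2) (tel (S q.1) q.2)).
Proof.
have := psd_bop (@fst L K) (opnormP S) (opnorm_ge0 S).
move=> /(@psd_schur R (L * K)%type K _ snd); apply: psd_ext => p q.
by rewrite !dot_tel mulrBl mulrA.
Qed.

Lemma tensr_bound T : psd (fun p q : L * K =>
  (opnorm T ^+ 2)%:C * dot (tel p.1 p.2) (tel q.1 q.2)
    - dot (tel p.1 (T p.2)) (tel q.1 (T q.2))).
Proof.
have := psd_bop (@snd L K) (opnormP T) (opnorm_ge0 T).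
move=> /(@psd_schur R (L * K)%type L _ fst); apply: psd_ext => p q.
by rewrite !dot_tel mulrBl -mulrA (mulrC (dot p.2 q.2)) (mulrC (dot (T _) _)).
Qed.

Definition tensl S : bop htens := bop_ext (opnorm_ge0 S) (tensl_bound S).
Definition tensr T : bop htens := bop_ext (opnorm_ge0 T) (tensr_bound T).

Lemma tenslE S l k : tensl S (tel l k) = tel (S l) k.
Proof. exact: (bop_extE (opnorm_ge0 S) (tensl_bound S) (l, k)). Qed.

Lemma tensrE T l k : tensr T (tel l k) = tel l (T k).
Proof. exact: (bop_extE (opnorm_ge0 T) (tensr_bound T) (l, k)). Qed.

Lemma tensr_le T v : rnorm (tensr T v) <= opnorm T * rnorm v.
Proof. exact: bop_ext_le. Qed.

Lemma tensl_linear : linear tensl.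
Proof.
move=> c S S'; apply: (bop_total_eq tel_full) => -[l k].
by rewrite bopDE bopZE !tenslE bopDE bopZE tel_linl.
Qed.

Lemma tensr_linear : linear tensr.
Proof.
move=> c T T'; apply: (bop_total_eq tel_full) => -[l k].
by rewrite bopDE bopZE !tensrE bopDE bopZE tel_linr.
Qed.

Lemma tenslM S S' : tensl (smul S S') = smul (tensl S) (tensl S').
Proof. by apply: (bop_total_eq tel_full) => -[l k]; rewrite /= !tenslE. Qed.

Lemma tensrM T T' : tensr (smul T T') = smul (tensr T) (tensr T').
Proof. by apply: (bop_total_eq tel_full) => -[l k]; rewrite /= !tensrE. Qed.

Lemma tensl_star S : tensl (star S) = star (tensl S).
Proof.
apply/esym/(bop_total_adj tel_full) => -[l k] [l' k'].
by rewrite !tenslE !dot_tel -adjP.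
Qed.

Lemma tensr_star T : tensr (star T) = star (tensr T).
Proof.
apply/esym/(bop_total_adj tel_full) => -[l k] [l' k'].
by rewrite !tensrE !dot_tel -adjP.
Qed.

Lemma tensC S T : smul (tensl S) (tensr T) = smul (tensr T) (tensl S).
Proof. by apply: (bop_total_eq tel_full) => -[l k]; rewrite /= !(tenslE, tensrE). Qed.

End HilbertTensor.

Section SquareSummable.
Variables (R : realType) (G : Type) (H : hilbertType R).
Implicit Types (s t : G) (h : H).

Let lker (p q : G * H) : R[i] := if `[< p.1 = q.1 >] then dot p.2 q.2 else 0.

Let lker_herm : herm lker.
Proof.
move=> p q; rewrite /lker; case: asboolP => [pq|pq].
  by rewrite asboolT// -dotC.
by rewrite asboolF ?conjC0// => qp; apply: pq.
Qed.

Let lker_psd : psd lker.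
Proof. by apply: (@psd_dsum R G H (fun _ => @dot R H)) => _; exact: (@psd_gram R H H id). Qed.

Let lkernel := PKernel lker_herm lker_psd.

(** The Hilbert space of square summable H-valued functions on G, generated by
    the functions lel t h with value h at t and 0 elsewhere. *)
Definition hl2 : hilbertType R := rkhs lkernel.

Definition lel t h : hl2 := relem lkernel (t, h).

Lemma dot_lel s t h h' : dot (lel s h) (lel t h') = if `[< s = t >] then dot h h' else 0.
Proof. exact: dot_elem. Qed.

Lemma lel_total : total_family (fun p : G * H => lel p.1 p.2).
Proof. by move=> v h; apply: (@total_relem _ _ lkernel) => -[t k]; exact: (h (t, k)). Qed.

Lemma lel_lin t c h h' : lel t (c *: h + h') = c *: lel t h + lel t h'.
Proof.
apply: (total_inj lel_total) => -[s k]; rewrite dotDl dotZl !dot_lel.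
by case: asboolP => _; rewrite ?mulr0 ?addr0// dotDl dotZl.
Qed.

Lemma lel0 t : lel t 0 = 0.
Proof. by have := lel_lin t (-1) 0 0; rewrite scaler0 addr0 scaleN1r addNr. Qed.

Lemma lelD t h h' : lel t (h + h') = lel t h + lel t h'.
Proof. by have := lel_lin t 1 h h'; rewrite !scale1r. Qed.

Lemma lelZ t c h : lel t (c *: h) = c *: lel t h.
Proof. by have := lel_lin t c h 0; rewrite lel0 !addr0. Qed.

Lemma lel_sum t (I : Type) (s : seq I) (P : pred I) (F : I -> H) :
  lel t (\sum_(i <- s | P i) F i) = \sum_(i <- s | P i) lel t (F i).
Proof. by elim/big_rec2 : _ => [|i u v _ <-]; rewrite ?lel0 ?lelD. Qed.

Section Operators.
Variables (sigma : G -> G) (T : G -> bop H) (M : R).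
Hypotheses (sigma_inj : injective sigma) (M0 : 0 <= M)
  (TM : forall t h, rnorm (T t h) <= M * rnorm h).

Lemma lop_bound : psd (fun p q : G * H =>
  (M ^+ 2)%:C * dot (lel p.1 p.2) (lel q.1 q.2)
    - dot (lel (sigma p.1) (T p.1 p.2)) (lel (sigma q.1) (T q.1 q.2))).
Proof.
have := @psd_dsum R G H (fun t h h' => (M ^+ 2)%:C * dot h h' - dot (T t h) (T t h')).
have h t := psd_bop (@id H) (TM t) M0.
move=> /(_ h); apply: psd_ext => -[t k] [t' k'] /=; rewrite !dot_lel.
case: asboolP => [<-|tt']; first by rewrite asboolT.
by rewrite asboolF ?mulr0 ?subrr// => /sigma_inj.
Qed.

(** Translations, coefficients and their products in the regular representation
    are all of this form. *)
Definition lop : bop hl2 := bop_ext M0 lop_bound.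

Lemma lopE t h : lop (lel t h) = lel (sigma t) (T t h).
Proof. exact: (bop_extE M0 lop_bound (t, h)). Qed.

End Operators.

End SquareSummable.

(** * Crossed products and regular representations *)

Section SinglePoint.
Variables (R : realType) (G : groupType) (A : gStarAlgType G R).
Implicit Types (s t : G) (a b : A) (f g : Cc A).

Lemma Cc1_subproof s a : (fun t => if t == s then a else 0) \in @finsupp R G A.
Proof.
apply/asboolP; apply: sub_finite_set (finite_set1 s) => t /=.
by case: ifP => [/eqP|_ /eqP].

Qed.

Definition Cc1 s a : Cc A := MkCc (Cc1_subproof s a).

Lemma Cc1E s a t : Cc1 s a t = if t == s then a else 0. Proof. by []. Qed.

Lemma Cc1_lin s (c : R[i]) a b : Cc1 s (c *: a + b) = c *: Cc1 s a + Cc1 s b.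
Proof.
apply: CcP => t; rewrite CcDE CcZE !Cc1E.
by case: eqP; rewrite ?scaler0 ?addr0.
Qed.

Lemma Cc_sum_val (I : Type) (r : seq I) (P : pred I) (F : I -> Cc A) t :
  (\sum_(i <- r | P i) F i : Cc A) t = \sum_(i <- r | P i) F i t.
Proof. by elim/big_rec2 : _ => // i u v _ <-. Qed.

Definition Cc_supp f : seq G :=
  undup (projT1 (cid (proj1 (finite_seqP _) (Cc_finsupp f)))).

Lemma Cc_suppP f t : f t != 0 -> t \in Cc_supp f.
Proof.
rewrite /Cc_supp; case: cid => r /= rE ft.
by have : [set t | f t != 0] t by []; rewrite rE mem_undup.
Qed.

Lemma Cc_supp_uniq f : uniq (Cc_supp f). Proof. exact: undup_uniq. Qed.

Lemma Cc_decomp f (r : seq G) : uniq r -> (forall t, f t != 0 -> t \in r) ->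
  f = \sum_(s <- r) Cc1 s (f s).
Proof.
move=> ur fr; apply: CcP => t; rewrite Cc_sum_val.
have [tr|tr] := boolP (t \in r).
  rewrite (bigD1_seq t)//= eqxx big1 ?addr0// => s /negPf st.
  by rewrite eq_sym st.
rewrite big_seq big1 => [|s sr]; last first.
  by rewrite Cc1E; case: eqVneq sr => // <-; rewrite (negPf tr).
by apply/eqP; apply: contraNT tr; exact: fr.
Qed.

Lemma Cc_indP (P : Cc A -> Prop) : P 0 -> (forall f g, P f -> P g -> P (f + g)) ->
  (forall s a, P (Cc1 s a)) -> forall f, P f.
Proof.
move=> P0 PD P1 f; rewrite (Cc_decomp (Cc_supp_uniq f) (@Cc_suppP f)).
by elim/big_rec : _ => // s u _; apply: PD.
Qed.

Lemma Cc1M s t a b : smul (Cc1 s a) (Cc1 t b) = Cc1 (s * t)%g (smul a (act s b)).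
Proof.
apply: CcP => r; rewrite Cc_mulE (@fsum_setT _ _ [set s]).
  rewrite fsbig_set1 !Cc1E eqxx.
  have -> : (s^-1 * r == t)%g = (r == s * t)%g.
    by apply/eqP/eqP => [<-|->]; rewrite ?mulVKg ?mulKg.
  by case: eqP => // _; rewrite act0 smul0r.
move=> q qs; have -> : Cc1 s a q = 0 by rewrite Cc1E; case: eqP.
exact: smul0l.
Qed.

Lemma Cc1_star s a : star (Cc1 s a) = Cc1 s^-1%g (act s^-1%g (star a)).
Proof.
apply: CcP => t; rewrite -[LHS]/(act t (star (Cc1 s a t^-1%g))) !Cc1E.
have -> : (t^-1 == s)%g = (t == s^-1)%g.
  by apply/eqP/eqP => [<-|->]; rewrite invgK.
by case: eqP => [->//|_]; rewrite star0 act0.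
Qed.

End SinglePoint.

Section ActionIsometric.
Variables (R : realType) (G : groupType) (A : gCstarAlgType G R).

(** An automorphism of a C*-algebra is isometric: compose an isometric
    representation with it. *)
Lemma rnorm_act (g : G) (a : A) : rnorm (act g a) <= rnorm a.
Proof.
have [H [rho [[rM rS] rN]]] := gelfand_naimark A.
have lr : linear (rho \o act g).
  by move=> c x y /=; rewrite actD actZ linearP.
pose r : {linear A -> bop H} := HB.pack (rho \o act g)
  (GRing.isLinear.Build R[i] A (bop H) *:%R (rho \o act g) lr).
have sr : star_hom r.
  by split=> [x y|x]; rewrite /= ?act_smul ?act_star ?rM ?rS.
rewrite -rN; apply: opnorm_le => [|v]; first exact: rnorm_ge0.
exact: (star_hom_le a v sr).
Qed.

End ActionIsometric.

Section RegularRepresentation.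
Variables (R : realType) (G : groupType) (A : gCstarAlgType G R).
Variables (H : hilbertType R) (pi : {linear A -> bop H}).
Hypothesis pi_hom : star_hom pi.
Implicit Types (s t r : G) (a b : A) (h : H) (f g : Cc A).

Let pi_le s t a h : rnorm (pi (act (s * t)^-1%g a) h) <= rnorm a * rnorm h.
Proof.
apply: le_trans (star_hom_le _ _ pi_hom) _.
by rewrite ler_wpM2r ?rnorm_ge0 ?rnorm_act.
Qed.

Let mulgL_inj s : injective (fun t => (s * t)%g).
Proof. exact: mulgI. Qed.

(** The image of a delta_s in the regular representation induced by pi. *)
Definition regop s a : bop (hl2 G H) :=
  lop (@mulgL_inj s) (rnorm_ge0 a) (fun t => pi_le s t a).

Lemma regopE s a t h :
  regop s a (lel t h) = lel (s * t)%g (pi (act (s * t)^-1%g a) h).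
Proof. exact: lopE. Qed.

Let eq_lel (S T : bop (hl2 G H)) : (forall t h, S (lel t h) = T (lel t h)) -> S = T.
Proof. by move=> E; apply: (bop_total_eq (@lel_total R G H)) => -[t h]; exact: E. Qed.

Lemma regop_linear s : linear (regop s).
Proof.
move=> c a b; apply: eq_lel => t h; rewrite bopDE bopZE !regopE.
by rewrite actD actZ linearP bopDE bopZE lel_lin.
Qed.

Lemma regop0 s : regop s 0 = 0.
Proof.
apply: eq_lel => t h; rewrite regopE act0 linear0.
by rewrite -[(0 : bop H) h]/(0 : H) lel0.
Qed.

Lemma regopM s t a b :
  smul (regop s a) (regop t b) = regop (s * t)%g (smul a (act s b)).
Proof.
apply: eq_lel => r h /=; rewrite !regopE mulgA act_smul pi_hom.1 /= -actM.
suff -> : ((s * t * r)^-1 * s)%g = (t * r)^-1%g by [].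
by rewrite -mulgA invgM mulgVK.
Qed.

Lemma regop_star s a : star (regop s a) = regop s^-1%g (act s^-1%g (star a)).
Proof.
apply: (bop_total_adj (@lel_total R G H)) => -[t h] [r k]; rewrite !regopE !dot_lel /=.
have -> : `[< (s * t)%g = r >] = `[< t = (s^-1 * r)%g >].
  by apply: asbool_equiv_eq; split=> [<-|->]; rewrite ?mulKg ?mulVKg.
case: asboolP => // ->; rewrite mulVKg adjP -[adj _]/(star _) -pi_hom.2 -act_star.
by rewrite -actM invgM invgK mulgK.
Qed.

Definition regrep f : bop (hl2 G H) := \sum_(s \in [set: G]) regop s (f s).

Lemma regrepE f (r : seq G) : uniq r -> (forall t, f t != 0 -> t \in r) ->
  regrep f = \sum_(s <- r) regop s (f s).
Proof.
move=> ur fr; rewrite /regrep (@fsum_setT _ _ [set` r]); last first.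
  move=> s /= sr; have -> : f s = 0; last exact: regop0.
  by apply/eqP; apply: contrapT => /negP /fr.
by rewrite -fsbig_seq.
Qed.

Lemma regrep1 s a : regrep (Cc1 s a) = regop s a.
Proof.
rewrite (@regrepE _ [:: s])//; last first.
  by move=> t; rewrite Cc1E inE; case: ifP => // _ /eqP.
by rewrite big_seq1 Cc1E eqxx.
Qed.

Lemma regrep_linear : linear regrep.
Proof.
move=> c f g.
pose r := undup (Cc_supp f ++ Cc_supp g).
have ur : uniq r by exact: undup_uniq.
rewrite (@regrepE (c *: f + g) r)//; last first.
  move=> t; apply: contra_neqT; rewrite mem_undup mem_cat negb_or => /andP[tf tg].
  have [/eqP f0|fN] := boolP (f t == 0); last by rewrite Cc_suppP in tf.
  have [/eqP g0|gN] := boolP (g t == 0); last by rewrite Cc_suppP in tg.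
  by rewrite CcDE CcZE f0 g0 scaler0 addr0.
rewrite (@regrepE f r)//; last first.
  by move=> t ft; rewrite mem_undup mem_cat Cc_suppP.
rewrite (@regrepE g r)//; last first.
  by move=> t gt; rewrite mem_undup mem_cat (Cc_suppP gt) orbT.
rewrite scaler_sumr -big_split; apply: eq_bigr => s _; exact: regop_linear.
Qed.

Definition regrep_lin : {linear Cc A -> bop (hl2 G H)} := HB.pack regrep
  (GRing.isLinear.Build R[i] (Cc A) (bop (hl2 G H)) *:%R regrep regrep_linear).

Lemma regrep_hom : star_hom regrep_lin.
Proof.
split=> f; last first.
  elim/Cc_indP : f => [|f g IHf IHg|s a].
  - by rewrite star0 linear0 star0.
  - by rewrite starD !linearD starD IHf IHg.
  - by rewrite Cc1_star /= !regrep1 regop_star.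
elim/Cc_indP : f => [|f g IHf IHg|s a] k.
- by rewrite smul0l linear0 smul0l.
- by rewrite smulDl !linearD smulDl IHf IHg.
elim/Cc_indP : k => [|f g IHf IHg|t b].
- by rewrite smul0r linear0 smul0r.
- by rewrite smulDr !linearD smulDr IHf IHg.
- by rewrite Cc1M /= !regrep1 regopM.
Qed.

End RegularRepresentation.

Section MaxNorm.
Variables (R : realType) (G : groupType).

(** Representations of C_c(G, A) are bounded by the l^1-norm as soon as those
    of A are. *)
Lemma Cc_hom_bound (A : gStarAlgType G R) (N : A -> R)
    (H : hilbertType R) (Th : {linear Cc A -> bop H}) : star_hom Th ->
  (forall a, 0 <= N a) ->
  (forall a, opnorm (Th (Cc1 1%g (smul a (star a)))) <= N a ^+ 2) ->
  forall f, opnorm (Th f) <= \sum_(s <- Cc_supp f) N (f s).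
Proof.
move=> [ThM ThS] N0 ThN f.
rewrite {1}(Cc_decomp (Cc_supp_uniq f) (@Cc_suppP _ _ _ f)) linear_sum.
have -> : opnorm (\sum_(s <- Cc_supp f) Th (Cc1 s (f s))) =
  rnorm (\sum_(s <- Cc_supp f) Th (Cc1 s (f s))) by [].
rewrite (le_trans (rnorm_sum _ _ _))//; apply: ler_sum => s _.
rewrite -(@ler_pXn2r _ 2) ?nnegrE ?rnorm_ge0// -rnorm_smul_star -ThS -ThM.
apply: le_trans (ThN _); rewrite Cc1_star Cc1M mulgV -actM mulgV act1.
exact: lexx.
Qed.

(** The supremum that defines max_norm bounds its members as soon as it is
    finite. *)
Lemma max_norm_has (T : starAlgType R) (x : T) (M : R) :
  (forall (H : hilbertType R) (rho : {linear T -> bop H}), star_hom rho ->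
    opnorm (rho x) <= M) ->
  forall (H : hilbertType R) (rho : {linear T -> bop H}), star_hom rho ->
    opnorm (rho x) <= max_norm x.
Proof.
move=> xM H rho hrho; apply: ub_le_sup; last by exists H, rho.
by exists M => _ [H' [rho' [h ->]]]; exact: xM.
Qed.

Lemma max_norm_Cc (A : gCstarAlgType G R) (f : Cc A) (H : hilbertType R)
    (rho : {linear Cc A -> bop H}) : star_hom rho ->
  opnorm (rho f) <= max_norm f.
Proof.
apply: (@max_norm_has _ _ (\sum_(s <- Cc_supp f) rnorm (f s))) => {H rho}.
move=> H rho hrho; apply: (Cc_hom_bound hrho (N := @rnorm R A)) => [a|a].
  exact: rnorm_ge0.
have l1 : linear (rho \o @Cc1 R G A 1%g).
  by move=> c x y /=; rewrite Cc1_lin linearP.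
pose r : {linear A -> bop H} := HB.pack (rho \o @Cc1 R G A 1%g)
  (GRing.isLinear.Build R[i] A (bop H) *:%R (rho \o @Cc1 R G A 1%g) l1).
have hr : star_hom r.
  split=> [x y|x] /=.
    by rewrite -hrho.1 Cc1M mulg1 act1.
  by rewrite -hrho.2 Cc1_star invg1 act1.
apply: opnorm_le => [|v]; first by rewrite sqr_ge0.
rewrite -rnorm_smul_star; exact: (star_hom_le (smul a (star a)) v hr).
Qed.

Lemma max_norm_group (f : group_algebra R G) (H : hilbertType R)
    (rho : {linear group_algebra R G -> bop H}) : star_hom rho ->
  opnorm (rho f) <= max_norm f.
Proof.
apply: (@max_norm_has _ _ (\sum_(s <- Cc_supp f) complex.Re `|f s|)) => {H rho}.
move=> H rho hrho; apply: (Cc_hom_bound hrho (N := fun c : R[i] => complex.Re `|c|)) => [a|a].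
  exact: cnorm_ge0.
pose p := rho (Cc1 1%g (1 : R[i])).
have pp : smul (star p) p = p.
  rewrite -hrho.2 -hrho.1 Cc1_star Cc1M invg1 mulg1; congr (rho (Cc1 _ _)).
  by rewrite !act1; apply: etrans (mulr1 _) _; rewrite -[LHS]/(1^* : R[i]) conjC1.
have np : opnorm p <= 1.
  have [->|pN] := eqVneq (opnorm p) 0; first exact: ler01.
  have pg : 0 < opnorm p by rewrite lt_neqAle eq_sym pN opnorm_ge0.
  by rewrite -(ler_pM2r pg) mul1r -expr2 -opnorm_star_mul pp.
have -> : Cc1 1%g (smul a (star a)) = (a * a^*) *: (Cc1 1%g (1 : R[i]) : group_algebra R G).
  by apply: CcP => t; rewrite CcZE !Cc1E; case: eqP => _; [exact: esym (mulr1 _)|rewrite scaler0].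
rewrite linearZ opnormZ cnormM cnorm_conj -expr2 ler_piMr ?sqr_ge0//.
Qed.

End MaxNorm.

(** * Absolute values and injective homomorphisms *)

Section AbsoluteValue.
Variables (R : realType) (U : cstarAlgType R) (e : U).
Hypotheses (mul1x : forall x, smul e x = x) (mulx1 : forall x, smul x e = x).
Hypothesis norm_one : rnorm e = 1.
Implicit Types (x y z a b r s : U) (t : R).

Local Notation "x ** y" := (smul x y) (at level 40, left associativity).
Local Notation pos := (pos e).

(** Square roots depend continuously on positive elements: (r - s)^4 is dominated
    by (r - s)^2 (r + s)^2 = (r^2 - s^2)^2. *)
Lemma sqrt_dist r s : pos r -> pos s -> r ** s = s ** r ->
  rnorm (r - s) ^+ 2 <= rnorm (r ** r - s ** s).
Proof.
move=> pr ps rs; have sr := pos_sa pr; have ss := pos_sa ps.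
pose a := r - s; pose b := r + s; pose c := r ** r - s ** s.
have sa : star a = a by rewrite starB sr ss.
have sc : star c = c by rewrite starB !starM sr ss.
have ab : a ** b = c.
  by rewrite /a /b !(smulDl, smulDr, smulNl) rs /c; abel.
have ba : b ** a = c.
  by rewrite /a /b !(smulDl, smulDr, smulNr) rs /c; abel.
have pp : pos (r ** s) by exact: posM.
have bb : b ** b = a ** a + (4 : R)%:C *: (r ** s).
  have -> : (4 : R)%:C *: (r ** s) = r ** s + r ** s + (r ** s + r ** s).
    have -> : (4 : R) = 1 + 1 + (1 + 1) by ring.
    by rewrite !RCD !scalerDl scale1r.
  by rewrite /a /b !(smulDl, smulDr, smulNl, smulNr) rs; abel.
have ars : a ** (r ** s) = (r ** s) ** a.
  rewrite /a smulBl smulBr; congr (_ - _); first by rewrite -[RHS]smulA -rs.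
  by rewrite smulA -rs.
have h : a ** a ** (a ** a) + a ** a ** ((4 : R)%:C *: (r ** s)) = c ** c.
  rewrite -smulDr -bb -ab -!smulA (smulA b a b) ba -ab.
  by rewrite -!smulA.
have p1 : pos (a ** a ** (a ** a)) by apply: pos_sqr => //; rewrite starM sa.
have p2 : pos (a ** a ** ((4 : R)%:C *: (r ** s))).
  rewrite smulZr; apply: posZ => //; apply: posM => //; first exact: pos_sqr.
  by rewrite -smulA ars smulA ars -smulA.
have := pos_add_le_norm mul1x mulx1 norm_one p1 p2 (lexx _); rewrite h.
rewrite rnorm_sa_sqr ?starM ?sa// rnorm_sa_sqr// rnorm_sa_sqr//.
by rewrite ler_pXn2r ?nnegrE ?exprn_ge0 ?rnorm_ge0.
Qed.

Lemma pos_lim (u : nat -> U) r : (forall n, pos (u n)) -> rlim (@rnorm R U) u r ->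
  pos r.
Proof.
move=> pu ur.
have sr : star r = r.
  apply: rnorm_small => d d0; have [N NP] := ur _ (divr_gt0 d0 (ltr0Sn R 1)).
  have h := NP N (leqnn N); have su := pos_sa (pu N).
  rewrite (le_trans (rdistD (u N) _ _))// [leRHS]splitr lerD//.
  by rewrite -{1}su -starB rnorm_star rdistC.
apply: pos_closed => // t t0; have [N NP] := ur t t0.
have -> : r + t%:C *: e = u N + (t%:C *: e - (u N - r)) by abel.
apply: posD => //; apply: pos_sc_sub => //; last exact: NP.
by rewrite starB (pos_sa (pu N)) sr.
Qed.

(** The absolute value |x|, as the limit of the square roots of x^2 + 1/n. *)
Lemma pos_abs x : star x = x -> exists r, [/\ pos r, r ** r = x ** x
  & forall z, z ** (x ** x) = (x ** x) ** z -> z ** r = r ** z].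
Proof.
move=> sx; have px : pos (x ** x) by exact: pos_sqr.
pose q n : R := n.+1%:R^-1.
have q0 n : 0 < q n by rewrite invr_gt0.
have /choice[u uP] n := pos_sqrt mul1x mulx1 px (q0 n).
have ucomm n m : u n ** u m = u m ** u n.
  have [_ _ cm] := uP m; apply: cm; have [_ _ cn] := uP n.
  by apply/esym/cn.
have ud n m : rnorm (u n - u m) ^+ 2 <= `|q n - q m|.
  have [pn un _] := uP n; have [pm um _] := uP m.
  rewrite (le_trans (sqrt_dist pn pm (ucomm n m)))// un um.
  have -> : x ** x + (q n)%:C *: e - (x ** x + (q m)%:C *: e) = (q n - q m)%:C *: e.
    by rewrite RCB scalerBl; abel.
  by rewrite rnormZr norm_one mulr1.
have [|r rP] := @rcauchy_lim R U u.
  move=> d d0; have [N NP] := natSinv_small (exprn_gt0 2 d0).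
  exists N => m k Nm Nk; rewrite -(@ler_pXn2r _ 2) ?nnegrE ?rnorm_ge0 ?(ltW d0)//.
  rewrite (le_trans (ud m k))//; have := NP m Nm; have := NP k Nk.
  rewrite -/(q m) -/(q k); have := q0 m; have := q0 k.
  by rewrite ler_norml => *; apply/andP; split; lra.
exists r; split.
- by apply: pos_lim rP => n; case: (uP n).
- apply: rnorm_small => d d0.
  pose C := 2 * rnorm r + 2; have C0 : 0 < C by rewrite ltr_wpDl ?mulr_ge0 ?rnorm_ge0.
  pose d' := Num.min 1 (d / 2 / C).
  have d'0 : 0 < d' by rewrite lt_min ltr01 !divr_gt0.
  have [N1 h1] := rP _ d'0; have [N2 h2] := natSinv_small (divr_gt0 d0 (ltr0Sn R 1)).
  pose n := maxn N1 N2; have un := h1 n (leq_maxl _ _); have qn := h2 n (leq_maxr _ _).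
  have [_ uu _] := uP n.
  rewrite (le_trans (rdistD (u n ** u n) _ _))// [leRHS]splitr lerD//; last first.
    by rewrite uu addrC addrA addNr add0r rnormZr norm_one mulr1 gtr0_norm// ltW.
  have -> : r ** r - u n ** u n = r ** (r - u n) + (r - u n) ** u n.
    by rewrite smulBr smulBl; abel.
  rewrite (le_trans (rnormD _ _))//.
  have nu : rnorm (u n) <= rnorm r + 1.
    have := rnormD r (u n - r); rewrite addrC subrK => /le_trans; apply.
    by rewrite lerD2l (le_trans un)// ge_min lexx.
  have dC : d' * C <= d / 2 by rewrite -ler_pdivlMr// ge_min lexx orbT.
  rewrite rdistC in un; have := rnorm_smul r (r - u n); have := rnorm_smul (r - u n) (u n).
  have := rnorm_ge0 r; have := rnorm_ge0 (u n); have := rnorm_ge0 (r - u n).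
  move: dC; rewrite /C; nra.
- move=> z zx; apply: rnorm_small => d d0.
  pose C := 2 * (rnorm z + 1); have C0 : 0 < C by rewrite mulr_gt0// ltr_wpDl ?rnorm_ge0.
  have [N NP] := rP _ (divr_gt0 d0 C0); have := NP N (leqnn N).
  have [_ _ /(_ z zx) zu] := uP N.
  have -> : z ** r - r ** z = (u N - r) ** z - z ** (u N - r).
    by rewrite smulBr smulBl zu; abel.
  rewrite ler_pdivlMr// => h; rewrite (le_trans (rnormD _ _))// rnormN.
  have := rnorm_smul z (u N - r); have := rnorm_smul (u N - r) z.
  have := rnorm_ge0 z; have := rnorm_ge0 (u N - r); move: h; rewrite /C; nra.
Qed.

End AbsoluteValue.

Section InjectiveHoms.
Variable R : realType.

Lemma star_hom_contractive (A B : cstarAlgType R) (Phi : {linear A -> B}) a :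
  star_hom Phi -> rnorm (Phi a) <= rnorm a.
Proof.
move=> [PM PS]; have [H [rho [[rM rS] rN]]] := gelfand_naimark B.
have lr : linear (rho \o Phi) by move=> c x y /=; rewrite !linearP.
pose r : {linear A -> bop H} := HB.pack (rho \o Phi)
  (GRing.isLinear.Build R[i] A (bop H) *:%R (rho \o Phi) lr).
have sr : star_hom r by split=> [x y|x]; rewrite /= ?PM ?PS ?rM ?rS.
rewrite -rN; apply: opnorm_le => [|v]; first exact: rnorm_ge0.
exact: (star_hom_le a v sr).
Qed.

Section Unital.
Variables (U V : cstarAlgType R) (e : U) (e' : V).
Hypotheses (mul1x : forall x, smul e x = x) (mulx1 : forall x, smul x e = x).
Hypothesis norm_one : rnorm e = 1.
Hypotheses (mul1y : forall y, smul e' y = y) (muly1 : forall y, smul y e' = y).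
Hypothesis norm_one' : rnorm e' = 1.
Variable Phi : {linear U -> V}.
Hypotheses (Phi_hom : star_hom Phi) (Phi1 : Phi e = e') (Phi_inj : injective Phi).

Let Phi_pos x : pos e x -> pos e' (Phi x).
Proof.
move=> px; apply: pos_closed => //; first by rewrite -Phi_hom.2 (pos_sa px).
move=> t t0; have [r [/pos_sa sr rr _]] := pos_sqrt mul1x mulx1 px t0.
have -> : Phi x + t%:C *: e' = smul (Phi r) (Phi r).
  by rewrite -Phi_hom.1 rr linearD linearZ Phi1.
by apply: pos_sqr => //; rewrite -Phi_hom.2 sr.
Qed.

(** If |Phi h| < t < |h| for a positive h, then x = h - t is not negative but
    its image is, so |x| + x is a nonzero element of the kernel. *)
Lemma inj_star_hom_ge_unital a : rnorm a <= rnorm (Phi a).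
Proof.
pose h := smul (star a) a.
suff hh : rnorm h <= rnorm (Phi h).
  rewrite -(@ler_pXn2r _ 2) ?nnegrE ?rnorm_ge0// -!rnorm_star_smul.
  by rewrite -Phi_hom.2 -Phi_hom.1.
rewrite leNgt; apply/negP => lt.
pose t := (rnorm (Phi h) + rnorm h) / 2.
have t1 : rnorm (Phi h) < t by rewrite /t; lra.
have t2 : t < rnorm h by rewrite /t; lra.
have sh : star h = h by rewrite starM starK.
have ph : pos e h by apply: pos_star_mul.
have t0 : 0 <= t := le_trans (rnorm_ge0 _) (ltW t1).
pose x := h - t%:C *: e.
have se : star (t%:C *: e) = t%:C *: e by apply: (@pos_sa R U e); apply: pos_sc.
have sx : star x = x by rewrite starB sh se.
have [r [pr rr cr]] := pos_abs mul1x mulx1 norm_one sx.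
have rx : smul x r = smul r x by apply: cr; rewrite smulA.
have nx : pos e' (- Phi x).
  rewrite linearB linearZ Phi1 opprB; apply: pos_sc_sub => //; last exact: ltW.
  by rewrite -Phi_hom.2 sh.
have z0 : Phi r = - Phi x.
  have d := sqrt_dist mul1y muly1 norm_one' (Phi_pos pr) nx.
  move: d; rewrite smulNl smulNr -!Phi_hom.1 rx => /(_ erefl).
  rewrite smulNl smulNr !opprK -!Phi_hom.1 rr subrr rnorm0 => d.
  apply/eqP; rewrite -addr_eq0; apply/eqP/rnorm_eq0/eqP.
  by rewrite -sqrf_eq0 eq_le d sqr_ge0.
have rE : r = - x by apply: Phi_inj; rewrite linearN.
have : rnorm h <= t.
  by apply: (pos_le_norm mul1x mulx1 norm_one ph); rewrite -opprB -/x -rE.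
by rewrite leNgt t2.
Qed.

End Unital.

Theorem inj_star_hom_isometric (A B : cstarAlgType R) (Phi : {linear A -> B}) a :
  star_hom Phi -> injective Phi -> rnorm (Phi a) = rnorm a.
Proof.
move=> hPhi iPhi; apply/eqP; rewrite eq_le star_hom_contractive//=.
pose F (x : unitization A) : unitization B := (Phi x.1, x.2).
have UP (C : cstarAlgType R) (x y : unitization C) : x.1 = y.1 -> x.2 = y.2 -> x = y.
  by case: x y => [? ?] [? ?] /= -> ->.
have lF : linear F by move=> c x y; apply: UP => //=; rewrite linearP.
pose f : {linear unitization A -> unitization B} := HB.pack F
  (GRing.isLinear.Build R[i] (unitization A) (unitization B) *:%R F lF).
have hf : star_hom f.
  split=> [x y|x]; apply: UP => //=; last exact: hPhi.2.
  by rewrite !linearD !linearZ hPhi.1.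
have jf : injective f.
  move=> x y fxy; apply: UP; last exact: (congr1 snd fxy).
  exact: iPhi (congr1 fst fxy).
have f1 : f (unit_one A) = unit_one B by apply: UP => //=; rewrite linear0.
have := @inj_star_hom_ge_unital _ _ (unit_one A) (unit_one B) (@unit_mul1x R A) (@unit_mulx1 R A)
  (unit_norm_one A) (@unit_mul1x R B) (@unit_mulx1 R B) (unit_norm_one B) f hf f1 jf ((a, 0) : unitization A).
by rewrite -[f _]/((F (a, 0))) /F /= !unit_base.
Qed.

End InjectiveHoms.

(** * Matrices over a C*-algebra *)

Section MatrixInequality.
Variables (R : realType) (A : cstarAlgType R) (I : eqType) (F : seq I).
Implicit Types (x : I -> I -> A) (K : R).

(** The matrix rho(x) applied to a column of vectors. *)
Definition mxapp (H : hilbertType R) (rho : {linear A -> bop H}) x (xi : I -> H) t : H :=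
  \sum_(s <- F) rho (x t s) (xi s).

Definition mxbound (H : hilbertType R) (rho : {linear A -> bop H}) x K :=
  forall xi : I -> H,
  \sum_(t <- F) rnorm (mxapp rho x xi t) ^+ 2 <= K * \sum_(s <- F) rnorm (xi s) ^+ 2.

(** The entries of x^* x. *)
Definition mxsq x t s : A := \sum_(k <- F) smul (star (x k t)) (x k s).

Section OneRepresentation.
Variables (H : hilbertType R) (rho : {linear A -> bop H}).
Hypothesis hrho : star_hom rho.
Implicit Types (xi zeta : I -> H).

Lemma mxapp_sq x xi zeta :
  \sum_(t <- F) dot (mxapp rho (mxsq x) xi t) (zeta t) =
  \sum_(k <- F) dot (mxapp rho x xi k) (mxapp rho x zeta k).
Proof.
transitivity (\sum_(t <- F) \sum_(k <- F) \sum_(s <- F)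
    dot (rho (x k s) (xi s)) (rho (x k t) (zeta t))).
  apply: eq_bigr => t _; rewrite /mxapp dot_suml exchange_big /=.
  apply: eq_bigr => s _; rewrite /mxsq linear_sum.
  have -> : (\sum_(k <- F) rho (smul (star (x k t)) (x k s))) (xi s) =
      \sum_(k <- F) rho (smul (star (x k t)) (x k s)) (xi s).
    by elim/big_rec2 : _ => // i u v _ <-.
  rewrite dot_suml; apply: eq_bigr => k _.
  by rewrite hrho.1 hrho.2 /= dotC -adjP -dotC.
rewrite exchange_big; apply: eq_bigr => k _ /=.
rewrite /mxapp dot_sumr; apply: eq_bigr => t _.
by rewrite dot_suml.
Qed.

(* Both estimates use |<u, v>| <= (c |u|^2 + |v|^2 / c) / 2. *)
Let dot_amgm (c : R) (u v : H) : 0 < c ->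
  2 * complex.Re (dot u v) <= c * rnorm u ^+ 2 + c^-1 * rnorm v ^+ 2.
Proof.
move=> c0; have := Re_dot_le u v; have := sqr_ge0 (c * rnorm u - rnorm v).
have -> : (c * rnorm u - rnorm v) ^+ 2 =
  c * (c * rnorm u ^+ 2 + c^-1 * rnorm v ^+ 2 - 2 * (rnorm u * rnorm v)).
  by field; rewrite gt_eqF.
rewrite pmulr_rge0//; lra.
Qed.

Let sum_amgm (c : R) (a b : I -> H) : 0 < c ->
  2 * complex.Re (\sum_(t <- F) dot (a t) (b t)) <=
  c * \sum_(t <- F) rnorm (a t) ^+ 2 + c^-1 * \sum_(t <- F) rnorm (b t) ^+ 2.
Proof.
move=> c0; rewrite Re_sum !mulr_sumr -big_split /=.
by apply: ler_sum => t _; exact: dot_amgm.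
Qed.

Let sum_sq (a : I -> H) :
  complex.Re (\sum_(t <- F) dot (a t) (a t)) = \sum_(t <- F) rnorm (a t) ^+ 2.
Proof. by rewrite Re_sum; apply: eq_bigr => t _; rewrite dotxx. Qed.

Lemma mxbound_sq x K : 0 < K -> mxbound rho x K -> mxbound rho (mxsq x) (K ^+ 2).
Proof.
move=> K0 h xi; set Z := \sum_(s <- F) rnorm (xi s) ^+ 2.
set zeta := mxapp rho (mxsq x) xi.
have := sum_amgm (mxapp rho x xi) (mxapp rho x zeta) K0.
rewrite -mxapp_sq -/zeta sum_sq.
have := h xi; have := h zeta; rewrite -/Z.
set S := \sum_(t <- F) rnorm (zeta t) ^+ 2.
set X := \sum_(t <- F) rnorm (mxapp rho x xi t) ^+ 2.
set Y := \sum_(t <- F) rnorm (mxapp rho x zeta t) ^+ 2.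
move=> YS XZ h2; have : K^-1 * Y <= S by rewrite mulrC ler_pdivrMr// mulrC.
have : K * X <= K ^+ 2 * Z by rewrite expr2 -mulrA ler_pM2l.
lra.
Qed.

Lemma mxbound_of_sq x K : 0 < K -> mxbound rho (mxsq x) (K ^+ 2) -> mxbound rho x K.
Proof.
move=> K0 h xi; have := h xi; set Z := \sum_(s <- F) rnorm (xi s) ^+ 2.
have Ki : 0 < K^-1 by rewrite invr_gt0.
have := sum_amgm (mxapp rho (mxsq x) xi) xi Ki; rewrite mxapp_sq sum_sq invrK -/Z.
set S := \sum_(t <- F) _ => h1; set T := \sum_(t <- F) _ => h2.
rewrite -/T in h1.
have : K^-1 * T <= K * Z.
  by rewrite mulrC ler_pdivrMr// mulrAC -expr2.
lra.
Qed.

Lemma mxbound_iter_sq m x K : 0 < K -> mxbound rho x K ->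
  mxbound rho (iter m mxsq x) (K ^+ (2 ^ m)).
Proof.
move=> K0 h; elim: m => [|m IH]; first by rewrite expn0 expr1.
by rewrite iterS expnS mulnC exprM; apply: mxbound_sq => //; rewrite exprn_gt0.
Qed.

Lemma mxbound_of_iter_sq m x K : 0 < K -> mxbound rho (iter m mxsq x) (K ^+ (2 ^ m)) ->
  mxbound rho x K.
Proof.
elim: m x K => [|m IH] x K K0; first by rewrite expn0 expr1.
rewrite iterSr expnS exprM => /IH h; apply: mxbound_of_sq => //.
by apply: h; rewrite exprn_gt0.
Qed.

Lemma mxbound_le x K K' : K <= K' -> mxbound rho x K -> mxbound rho x K'.
Proof.
move=> KK' h xi; apply: le_trans (h xi) _; rewrite ler_wpM2r//.
by apply: sumr_ge0 => s _; rewrite exprn_ge0 ?rnorm_ge0.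
Qed.

(** A crude bound, by the triangle inequality; its factor n^3 is removed by
    mxbound_transfer. *)
Lemma mxbound_entries x K : 0 <= K ->
  (forall t s, t \in F -> s \in F -> rnorm (x t s) ^+ 2 <= K) ->
  mxbound rho x ((size F)%:R ^+ 3 * K).
Proof.
move=> K0 xK xi; set Z := \sum_(s <- F) rnorm (xi s) ^+ 2.
have Z0 : 0 <= Z by apply: sumr_ge0 => s _; rewrite exprn_ge0 ?rnorm_ge0.
have xiZ s : s \in F -> rnorm (xi s) <= Num.sqrt Z.
  move=> sF; rewrite -(@ler_pXn2r _ 2) ?nnegrE ?rnorm_ge0 ?sqrtr_ge0// sqr_sqrtr//.
  rewrite /Z (big_rem s sF) /= lerDl; apply: sumr_ge0 => k _.
  by rewrite exprn_ge0 ?rnorm_ge0.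
have appZ t : t \in F -> rnorm (mxapp rho x xi t) ^+ 2 <= (size F)%:R ^+ 2 * (K * Z).
  move=> tF; have : rnorm (mxapp rho x xi t) <= (size F)%:R * (Num.sqrt K * Num.sqrt Z).
    rewrite (le_trans (rnorm_sum _ _ _))//.
    rewrite -sum1_size natr_sum mulr_suml big_seq [leRHS]big_seq.
    apply: ler_sum => s sF; rewrite mul1r (le_trans (star_hom_le _ _ hrho))//.
    rewrite ler_pM ?rnorm_ge0 ?xiZ//.
    rewrite -(@ler_pXn2r _ 2) ?nnegrE ?rnorm_ge0 ?sqrtr_ge0// sqr_sqrtr//.
    exact: xK.
  rewrite -(@ler_pXn2r _ 2) ?nnegrE ?rnorm_ge0 ?mulr_ge0 ?sqrtr_ge0//.
  by rewrite !exprMn !sqr_sqrtr.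
have -> : (size F)%:R ^+ 3 * K * Z = \sum_(t <- F) (size F)%:R ^+ 2 * (K * Z).
  by rewrite big_const_seq count_predT iter_addr_0 -mulr_natl; ring.
by rewrite big_seq [leRHS]big_seq; apply: ler_sum => t; exact: appZ.
Qed.

End OneRepresentation.

Hypothesis uF : uniq F.

Lemma mxbound_entry (H : hilbertType R) (sigma : {linear A -> bop H}) x K t s :
  (forall a, opnorm (sigma a) = rnorm a) -> 0 <= K -> mxbound sigma x K ->
  t \in F -> s \in F -> rnorm (x t s) ^+ 2 <= K.
Proof.
move=> sN K0 h tF sF; rewrite -sN -[leRHS]sqr_sqrtr//.
rewrite ler_pXn2r ?nnegrE ?sqrtr_ge0 ?opnorm_ge0//.
apply: opnorm_le => [|v]; first exact: sqrtr_ge0.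
rewrite -(@ler_pXn2r _ 2) ?nnegrE ?mulr_ge0 ?sqrtr_ge0 ?rnorm_ge0//.
rewrite exprMn sqr_sqrtr//.
have := h (fun r => if r == s then v else 0).
have -> : \sum_(r <- F) rnorm (if r == s then v else 0) ^+ 2 = rnorm v ^+ 2.
  rewrite (bigD1_seq s)//= eqxx big1 ?addr0// => r /negPf ->.
  by rewrite rnorm0 expr0n.
apply: le_trans; rewrite (big_rem t tF) /=.
have -> : mxapp sigma x (fun r => if r == s then v else 0) t = sigma (x t s) v.
  rewrite /mxapp (bigD1_seq s)//= eqxx big1 ?addr0// => r /negPf ->.
  by rewrite linear0.
rewrite lerDl; apply: sumr_ge0 => k _; by rewrite exprn_ge0 ?rnorm_ge0.
Qed.

(** On matrices over A the norm of any representation is dominated by that of an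
    isometric one. The entries give this up to the factor n^3, and applying the
    estimate to x^* x, (x^* x)^2, (x^* x)^4 and so on removes the factor. *)
Theorem mxbound_transfer (H H' : hilbertType R) (sigma : {linear A -> bop H})
    (rho : {linear A -> bop H'}) x K K' :
  star_hom sigma -> (forall a, opnorm (sigma a) = rnorm a) -> star_hom rho ->
  0 < K -> K < K' -> mxbound sigma x K -> mxbound rho x K'.
Proof.
move=> hs sN hr K0 KK' h; have K'0 := lt_trans K0 KK'.
pose c : R := (size F)%:R ^+ 3.
have [m mP] : exists m, c * K ^+ (2 ^ m) <= K' ^+ (2 ^ m).
  have q1 : K / K' < 1 by rewrite ltr_pdivrMr// mul1r.
  have q0 : 0 < K / K' by rewrite divr_gt0.
  have : (fun n => (K / K') ^+ n) @ \oo --> (0 : R).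
    by apply: cvg_expr; rewrite ger0_norm// ltW.
  have c1 : 0 < (c + 1)^-1 by rewrite invr_gt0 ltr_wpDl ?exprn_ge0.
  move/cvgrPdist_le/(_ _ c1) => [N _ /(_ (2 ^ N)%N)] /=.
  rewrite (ltnW (ltn_expl _ _))// => /(_ isT).
  rewrite sub0r normrN ger0_norm ?exprn_ge0 ?(ltW q0)// => hN; exists N.
  move: hN; rewrite expr_div_n ler_pdivrMr ?exprn_gt0// mulrC ler_pdivlMr; last first.
    by rewrite ltr_wpDl ?exprn_ge0.
  have : 0 <= K ^+ (2 ^ N) by rewrite exprn_ge0// ltW.
  by move: (K ^+ _) (K' ^+ _) => a b; lra.
apply: (mxbound_of_iter_sq hr (m := m)) => //.
apply: mxbound_le mP _; apply: mxbound_entries => //; first by rewrite exprn_ge0// ltW.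
move=> t s tF sF; apply: (mxbound_entry sN) tF sF; first by rewrite exprn_ge0// ltW.
exact: mxbound_iter_sq.
Qed.

End MatrixInequality.

(** * The reduced norm as a lower bound *)

Lemma bop_sumE (R : realType) (H : hilbertType R) (I : Type) (r : seq I)
    (P : pred I) (T : I -> bop H) v :
  (\sum_(i <- r | P i) T i) v = \sum_(i <- r | P i) T i v.
Proof. by elim/big_rec2 : _ => // i u S _ <-. Qed.

Lemma dot_sum_lel (R : realType) (G : choiceType) (H : hilbertType R) (F : seq G)
    (a b : G -> H) : uniq F ->
  dot (\sum_(t <- F) lel t (a t)) (\sum_(t <- F) lel t (b t)) =
  \sum_(t <- F) dot (a t) (b t).
Proof.
move=> uF; rewrite dot_suml big_seq [RHS]big_seq; apply: eq_bigr => t tF.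
rewrite dot_sumr (bigD1_seq t)//= dot_lel asboolT// big1 ?addr0// => s /eqP st.
by rewrite dot_lel asboolF// => ts; apply: st.
Qed.

Lemma sum_le_supp (R : realType) (G : eqType) (F F' : seq G) (a : G -> R) :
  uniq F -> uniq F' -> (forall t, 0 <= a t) ->
  (forall t, t \in F -> t \notin F' -> a t = 0) ->
  \sum_(t <- F) a t <= \sum_(t <- F') a t.
Proof.
move=> uF uF' a0 aF; rewrite (bigID (fun t => t \in F')) /= [X in _ + X]big1_seq ?addr0.
  have -> : \sum_(t <- F | t \in F') a t = \sum_(t <- F' | t \in F) a t.
    rewrite -[LHS]big_filter -[RHS]big_filter; apply: perm_big; apply: uniq_perm.
    - by rewrite filter_uniq.
    - by rewrite filter_uniq.
    - by move=> t; rewrite !mem_filter andbC.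
  rewrite [leRHS](bigID (fun t => t \in F)) /= lerDl.
  by apply: sumr_ge0 => t _.
by move=> t /andP[tF' tF]; exact: aF.
Qed.

Section RegularCoefficients.
Variables (R : realType) (G : groupType) (A : gCstarAlgType G R).
Variables (H : hilbertType R) (pi : {linear A -> bop H}) (hpi : star_hom pi).
Implicit Types (f : Cc A) (F : seq G) (xi : G -> H).

Lemma regrep_coef f s t h k : dot (regrep hpi f (lel s h)) (lel t k) =
  dot (pi (act t^-1%g (f (t * s^-1)%g)) h) k.
Proof.
pose r := undup ((t * s^-1)%g :: Cc_supp f).
rewrite (@regrepE _ _ _ _ _ hpi f r) ?undup_uniq//; last first.
  by move=> q fq; rewrite mem_undup inE Cc_suppP ?orbT.
rewrite bop_sumE dot_suml (bigD1_seq (t * s^-1)%g) ?undup_uniq//=; last first.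
  by rewrite mem_undup mem_head.
rewrite regopE mulgVK dot_lel asboolT// big1 ?addr0// => q /eqP qts.
by rewrite regopE dot_lel asboolF// => e; apply: qts; rewrite -e mulgK.
Qed.

(** The finite sections of the operator matrix of regrep hpi f, with entries
    pi (t^-1.f(t s^-1)), are bounded by the operator. *)
Lemma regrep_matrix_le f F xi : uniq F ->
  \sum_(t <- F) rnorm (\sum_(s <- F) pi (act t^-1%g (f (t * s^-1)%g)) (xi s)) ^+ 2
  <= opnorm (regrep hpi f) ^+ 2 * \sum_(s <- F) rnorm (xi s) ^+ 2.
Proof.
move=> uF; pose eta t := \sum_(s <- F) pi (act t^-1%g (f (t * s^-1)%g)) (xi s).
pose v := \sum_(s <- F) lel s (xi s); pose w := \sum_(t <- F) lel t (eta t).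
have nrm (a : G -> H) : rnorm (\sum_(t <- F) lel t (a t)) ^+ 2 = \sum_(t <- F) rnorm (a t) ^+ 2.
  apply: complexI; rewrite -dotxx dot_sum_lel// RCsum.
  by apply: eq_bigr => t _; rewrite dotxx.
have vw : dot (regrep hpi f v) w = (rnorm w ^+ 2)%:C.
  rewrite nrm RCsum /w dot_sumr; apply: eq_bigr => t _; rewrite -dotxx.
  rewrite /v linear_sum dot_suml {1}/eta dot_suml; apply: eq_bigr => s _.
  exact: regrep_coef.
rewrite -/(eta _) -(nrm xi) -/v; have := Re_dot_le (regrep hpi f v) w.
rewrite vw /= expr2 -nrm -/w => h; rewrite -exprMn ler_pXn2r ?nnegrE ?mulr_ge0 ?rnorm_ge0 ?opnorm_ge0//.
apply: le_trans (opnormP _ _); apply: sqr_le_mul; first exact: rnorm_ge0.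
by rewrite expr2.
Qed.

(** Substituting s = q^-1 t in the sum over q turns the value at t into a row of
    the same operator matrix. *)
Lemma regular_op_matrix f F xi t : uniq F ->
  (forall q, f q != 0 -> xi (q^-1 * t)%g != 0 -> (q^-1 * t)%g \in F) ->
  regular_op pi f xi t = \sum_(s <- F) pi (act t^-1%g (f (t * s^-1)%g)) (xi s).
Proof.
move=> uF hF; rewrite (@fsbig_seq _ _ _ _ F)// -(@fsum_setT _ _ [set` F]).
  rewrite (@reindex_fsbigT _ _ _ _ _ (fun q => q^-1 * t)%g); last first.
    by exists (fun s => t * s^-1)%g => q; rewrite ?invgM ?invgK ?mulVKg ?mulgVK ?mulKg ?mulKVg.
  by apply: eq_fsbigr => q _; rewrite invgM invgK mulVKg.
move=> s sF; have [->|xs] := eqVneq (xi s) 0; first exact: linear0.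
have -> : f (t * s^-1)%g = 0.
  apply/eqP; apply: contrapT => /negP /hF; rewrite invgM invgK mulgVK => /(_ xs).
  exact: sF.
by rewrite act0 linear0.
Qed.

End RegularCoefficients.

Section SquareSums.
Variables (R : realType) (G : groupType) (H : hilbertType R).
Implicit Types (xi : G -> H) (C : R).

Lemma l2norm_le xi C : 0 <= C ->
  (forall F : seq G, uniq F -> \sum_(t <- F) rnorm (xi t) ^+ 2 <= C ^+ 2) ->
  (l2norm xi <= C%:E)%E.
Proof.
move=> C0 h; rewrite /l2norm.
have -> : C%:E = sqrte (C ^+ 2)%:E by rewrite /= sqrtr_sqr ger0_norm.
rewrite lee_sqrt ?lee_fin ?sqr_ge0//; apply: ge_ereal_sup => _ [X [fX _] <-].
have [r rX] := proj1 (finite_seqP _) fX.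
have -> : X = [set` undup r] by rewrite rX; apply/seteqP; split=> x /=; rewrite mem_undup.
rewrite -fsbig_seq ?undup_uniq// sumEFin lee_fin; exact/h/undup_uniq.
Qed.

Lemma l2norm_ge xi C (F : seq G) : 0 <= C -> (l2norm xi <= C%:E)%E -> uniq F ->
  \sum_(t <- F) rnorm (xi t) ^+ 2 <= C ^+ 2.
Proof.
move=> C0 + uF; rewrite /l2norm.
have -> : C%:E = sqrte (C ^+ 2)%:E by rewrite /= sqrtr_sqr ger0_norm.
rewrite lee_sqrt ?lee_fin ?sqr_ge0// => h; rewrite -lee_fin -sumEFin.
apply: le_trans h; apply: ereal_sup_ubound; exists [set` F]; first by split=> //; exact: finite_seq.
by rewrite -fsbig_seq.
Qed.

Lemma l2norm_zero_le1 : (l2norm (fun _ : G => 0%R : H) <= 1)%E.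
Proof.
apply: l2norm_le => // F _; rewrite big1 ?expr1n// => t _.
by rewrite rnorm0 expr0n.
Qed.

End SquareSums.

Section LowerBound.
Variables (R : realType) (G : groupType) (A B : gCstarAlgType G R).
Variable iota : {linear A -> B}.
Hypothesis emb : equivariant_embedding iota.

(** The regular representation that is induced by an isometric representation
    of B dominates, on C_c(G, A), every regular representation induced by a
    representation of A: through iota the former is isometric on A, and both are
    given by the same matrices over A. *)
Theorem regular_op_le (f : Cc A) (H : hilbertType R) (rho : {linear A -> bop H})
    (xi : G -> H) : star_hom rho -> (l2norm xi <= 1)%E ->
  (l2norm (regular_op rho f xi) <= (max_norm (Cc_map iota f))%:E)%E.
Proof.
move=> hrho xi1; have [hi iinj ieq] := emb.
have [K [sigma [hs sN]]] := gelfand_naimark B.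
pose C := opnorm (regrep hs (Cc_map iota f)).
have CM : C <= max_norm (Cc_map iota f) by exact: (max_norm_Cc _ (regrep_hom hs)).
have C0 : 0 <= C by exact: opnorm_ge0.
have lt : linear (sigma \o iota) by move=> c x y /=; rewrite !linearP.
pose tau : {linear A -> bop K} := HB.pack (sigma \o iota)
  (GRing.isLinear.Build R[i] A (bop K) *:%R (sigma \o iota) lt).
have ht : star_hom tau.
  by split=> [x y|x]; rewrite /= ?hi.1 ?hi.2 ?hs.1 ?hs.2.
have tN a : opnorm (tau a) = rnorm a.
  by rewrite /= sN; apply: inj_star_hom_isometric.
pose x t s := act t^-1%g (f (t * s^-1)%g).
have bt F : uniq F -> mxbound F tau x (C ^+ 2).
  move=> uF zeta; have := regrep_matrix_le hs (Cc_map iota f) zeta uF.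
  congr (_ <= _); apply: eq_bigr => t _; congr (rnorm _ ^+ 2).
  by apply: eq_bigr => s _; rewrite /= /x ieq.
have br F : uniq F -> mxbound F rho x (C ^+ 2).
  move=> uF zeta; set Z := \sum_(s <- F) rnorm (zeta s) ^+ 2.
  have Z0 : 0 <= Z by apply: sumr_ge0 => s _; rewrite exprn_ge0 ?rnorm_ge0.
  apply/ler_addgt0Pr => d d0.
  pose q := d / (Z + 1); have q0 : 0 < q by rewrite divr_gt0// ltr_wpDl.
  have q2 : 0 < q / 2 by rewrite divr_gt0.
  have bt' : mxbound F tau x (C ^+ 2 + q / 2).
    by apply: mxbound_le (bt F uF); rewrite lerDl ltW.
  have := @mxbound_transfer _ _ _ F uF _ _ tau rho x (C ^+ 2 + q / 2) (C ^+ 2 + q) ht tN hrho.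
  rewrite ltr_wpDl ?sqr_ge0// ltrD2l ltr_pdivrMr// mulr2n mulrDr mulr1 ltrDl q0.
  move=> /(_ isT isT bt' zeta) /le_trans; apply.
  rewrite -/Z mulrDl lerD2l /q mulrAC ler_pdivrMr ?ltr_wpDl//.
  by rewrite ler_pM2l// lerDl.
apply: le_trans (_ : (C%:E <= _)%E); last by rewrite lee_fin.
apply: l2norm_le => // F uF.
pose F' := undup (F ++ [seq (q^-1 * t)%g | q <- Cc_supp f, t <- F]).
have uF' : uniq F' by exact: undup_uniq.
have E t : t \in F -> regular_op rho f xi t = mxapp F' rho x xi t.
  move=> tF; apply: regular_op_matrix => // q fq _.
  rewrite mem_undup mem_cat; apply/orP; right; apply/allpairsP.
  by exists (q, t); split=> //; exact: Cc_suppP.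
have FF' : {subset F <= F'} by move=> t tF; rewrite mem_undup mem_cat tF.
have -> : \sum_(t <- F) rnorm (regular_op rho f xi t) ^+ 2 =
    \sum_(t <- F) rnorm (mxapp F' rho x xi t) ^+ 2.
  by rewrite big_seq [RHS]big_seq; apply: eq_bigr => t tF; rewrite E.
apply: le_trans (sum_le_supp (F' := F') uF uF' _ _) _ => [t|t /FF' -> //|].
  by rewrite exprn_ge0 ?rnorm_ge0.
apply: le_trans (br F' uF' xi) _; rewrite ler_piMr ?sqr_ge0//.
by have := l2norm_ge ler01 xi1 uF'; rewrite expr1n.
Qed.

End LowerBound.

(** * Algebraic tensor products and their C*-norms *)

Section PureTensors.
Variables (R : realType) (D B : starAlgType R).
Implicit Types (a : D) (b : B) (s t : seq (D * B)).

Definition pure a b : tensor D B := tens_of [:: (a, b)].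

Lemma tens_of_sum s : tens_of s = \sum_(p <- s) pure p.1 p.2.
Proof.
elim: s => [|[a b] s IH]; first by rewrite big_nil tens_of_0.
by rewrite big_cons -IH -tens_of_D.
Qed.

Lemma pureDl a a' b : pure (a + a') b = pure a b + pure a' b.
Proof. by rewrite -tens_of_D; apply/tensP/tens_Dl. Qed.

Lemma pureDr a b b' : pure a (b + b') = pure a b + pure a b'.
Proof. by rewrite -tens_of_D; apply/tensP/tens_Dr. Qed.

Lemma pureZl (c : R[i]) a b : pure (c *: a) b = c *: pure a b.
Proof. by rewrite -[RHS]/(tens_scale c (pure a b)) tens_of_scale. Qed.

Lemma pureZr (c : R[i]) a b : pure a (c *: b) = c *: pure a b.
Proof. by rewrite -pureZl; apply/esym/tensP/tens_Z. Qed.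

Lemma pure0r a : pure a 0 = 0.
Proof. by rewrite -(scale0r (0 : B)) pureZr scale0r. Qed.

Lemma pure_suml (I : Type) (r : seq I) (P : pred I) (F : I -> D) b :
  pure (\sum_(i <- r | P i) F i) b = \sum_(i <- r | P i) pure (F i) b.
Proof.
elim/big_rec2 : _ => [|i u v _ <-]; last exact: pureDl.
by rewrite -(scale0r (0 : D)) pureZl scale0r.
Qed.

Lemma pureM a b a' b' : smul (pure a b) (pure a' b') = pure (smul a a') (smul b b').
Proof. exact: tens_of_mul. Qed.

Lemma pure_star a b : star (pure a b) = pure (star a) (star b).
Proof. exact: tens_of_star. Qed.

Lemma tens_indP (P : tensor D B -> Prop) : P 0 ->
  (forall x y, P x -> P y -> P (x + y)) -> (forall a b, P (pure a b)) ->
  forall x, P x.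
Proof.
move=> P0 PD P1; elim/tens_of_ind => s; rewrite tens_of_sum.
by elim/big_rec : _ => // p x _; apply: PD.
Qed.

End PureTensors.

Section CommutingPairs.
Variables (R : realType) (D B : starAlgType R) (L : hilbertType R).
Variables (V : {linear D -> bop L}) (W : {linear B -> bop L}).
Hypotheses (hV : star_hom V) (hW : star_hom W)
  (VW : forall a b, smul (V a) (W b) = smul (W b) (V a)).

Let lsum (s : seq (D * B)) : bop L := \sum_(p <- s) smul (V p.1) (W p.2).

Let lsum_eq s t : tens_eq s t -> lsum s = lsum t.
Proof.
rewrite /lsum; elim=> {s t} //=.
- by move=> s t u _ -> _ ->.
- by move=> s t u v _ h _ h'; rewrite !big_cat h h'.
- by move=> s t; rewrite !big_cat /=; exact: addrC.
- by move=> b; rewrite big_seq1 big_nil linear0 smul0l.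
- by move=> a a' b; rewrite !big_cons !big_nil /= linearD smulDl !addr0.
- by move=> a b b'; rewrite !big_cons !big_nil /= linearD smulDr !addr0.
- by move=> c a b; rewrite !big_seq1 /= !linearZ smulZl smulZr.
Qed.

(** The representation of the algebraic tensor product that two commuting
    representations define. *)
Definition tlift (x : tensor D B) : bop L := lsum (repr x).

Lemma tlift_of s : tlift (tens_of s) = \sum_(p <- s) smul (V p.1) (W p.2).
Proof. by apply: lsum_eq; apply/tensP; rewrite [LHS]reprK. Qed.

Lemma tliftE a b : tlift (pure a b) = smul (V a) (W b).
Proof. by rewrite tlift_of big_seq1. Qed.

Lemma tlift_linear : linear tlift.
Proof.
move=> c; elim/tens_of_ind => s; elim/tens_of_ind => t.
have -> : c *: tens_of s + tens_of t = tens_of (fscale c s ++ t).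
  by rewrite tens_of_D -tens_of_scale.
rewrite !tlift_of big_cat; congr (_ + _).
rewrite /fscale scaler_sumr; elim: s => [|p s IH]; first by rewrite !big_nil.
by rewrite /= !big_cons IH /= linearZ smulZl.
Qed.

Definition tlift_lin : {linear tensor D B -> bop L} := HB.pack tlift
  (GRing.isLinear.Build R[i] (tensor D B) (bop L) *:%R tlift tlift_linear).

Lemma tlift_hom : star_hom tlift_lin.
Proof.
split=> x; last first.
  elim/tens_indP : x => [|x y IHx IHy|a b].
  - by rewrite star0 linear0 star0.
  - by rewrite starD !linearD starD IHx IHy.
  - by rewrite pure_star /= !tliftE hV.2 hW.2 starM -hV.2 -hW.2 VW.
elim/tens_indP : x => [|x z IHx IHz|a b] y.
- by rewrite smul0l linear0 smul0l.
- by rewrite smulDl !linearD smulDl IHx IHz.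
elim/tens_indP : y => [|x z IHx IHz|a' b'].
- by rewrite smul0r linear0 smul0r.
- by rewrite smulDr !linearD smulDr IHx IHz.
- rewrite pureM /= !tliftE hV.1 hW.1 !smulA; congr (smul _ _).
  by rewrite -!smulA VW.
Qed.

End CommutingPairs.

Section CStarNorms.
Variables (R : realType) (T : starAlgType R).

Lemma cstar_norm_ge0 (N : T -> R) x : cstar_norm N -> 0 <= N x.
Proof.
move=> [ND NZ _ _ _]; have N0 : N 0 = 0.
  by rewrite -(scale0r (0 : T)) NZ normr0 mul0r.
have NN : N (- x) = N x.
  by rewrite -scaleN1r NZ normrN normr1 mul1r.
by have := ND x (- x); rewrite subrr N0 NN; lra.
Qed.

Lemma cstar_norm_opnorm (L : hilbertType R) (phi : {linear T -> bop L}) :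
  star_hom phi -> injective phi -> cstar_norm (fun x => opnorm (phi x)).
Proof.
move=> [pM pS] pI; split=> [x y|c x|x /opnorm_eq0 x0|x y|x].
- by rewrite linearD opnormD.
- by rewrite linearZ opnormZ.
- by apply: pI; rewrite x0 linear0.
- by rewrite pM opnormM.
- by rewrite pM pS opnorm_star_mul.
Qed.

Lemma cstar_norm_max (N : T -> R) (L : hilbertType R) (phi : {linear T -> bop L}) :
  cstar_norm N -> star_hom phi ->
  cstar_norm (fun x => Num.max (N x) (opnorm (phi x))).
Proof.
move=> hN [pM pS]; have [ND NZ N0 NM NS] := hN.
have N_ge0 x := cstar_norm_ge0 x hN.
split=> [x y|c x|x x0|x y|x].
- rewrite ge_max; apply/andP; split.
    by rewrite (le_trans (ND x y))// lerD// le_max lexx.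
  by rewrite linearD (le_trans (opnormD _ _))// lerD// le_max lexx orbT.
- by rewrite NZ linearZ opnormZ maxr_pMr// cnorm_ge0.
- apply: N0; apply/eqP; rewrite eq_le N_ge0 andbT.
  by rewrite -x0 le_max lexx.
- rewrite ge_max; apply/andP; split.
    by rewrite (le_trans (NM x y))// ler_pM// le_max lexx.
  by rewrite pM (le_trans (opnormM _ _))// ler_pM ?opnorm_ge0// le_max lexx orbT.
- rewrite NS pM pS opnorm_star_mul /Num.max ltr_pXn2r ?nnegrE ?opnorm_ge0//.
  by case: ifP.
Qed.

End CStarNorms.

(** The local lifting property is used only through this comparison: the
    maximum of a C*-norm and of the seminorm of a representation is again a
    C*-norm, hence equal to the first one. *)
Lemma LLP_le (R : realType) (D : cstarAlgType R) (K L L' : hilbertType R)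
    (phi : {linear tensor D (bop K) -> bop L})
    (psi : {linear tensor D (bop K) -> bop L'}) x : LLP D ->
  star_hom phi -> injective phi -> star_hom psi ->
  opnorm (psi x) <= opnorm (phi x).
Proof.
move=> /(_ K)[N [_ NU]] hphi iphi hpsi.
have c1 := cstar_norm_opnorm hphi iphi.
have c2 := cstar_norm_max c1 hpsi.
have e : Num.max (opnorm (phi x)) (opnorm (psi x)) = opnorm (phi x).
  by have := NU _ c1; rewrite (NU _ c2) => /(congr1 (@^~ x)).
by rewrite -e le_max lexx orbT.
Qed.

Section FaithfulTensor.
Variables (R : realType) (D : cstarAlgType R) (K L : hilbertType R).
Variable sigma : {linear D -> bop L}.
Hypotheses (hsigma : star_hom sigma) (isigma : forall a, sigma a = 0 -> a = 0).

Let lV : linear (@tensl R L K \o sigma).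
Proof. by move=> c x y /=; rewrite linearP tensl_linear. Qed.

Definition tensl_lin : {linear D -> bop (htens L K)} := HB.pack (@tensl R L K \o sigma)
  (GRing.isLinear.Build R[i] D (bop (htens L K)) *:%R (@tensl R L K \o sigma) lV).

Definition tensr_lin : {linear bop K -> bop (htens L K)} := HB.pack (@tensr R L K)
  (GRing.isLinear.Build R[i] (bop K) (bop (htens L K)) *:%R (@tensr R L K) (@tensr_linear R L K)).

Lemma tensl_hom : star_hom tensl_lin.
Proof.
by split=> [x y|x] /=; rewrite ?hsigma.1 ?hsigma.2 ?tenslM ?tensl_star.
Qed.

Lemma tensr_hom : star_hom tensr_lin.
Proof. by split=> [x y|x] /=; rewrite ?tensrM ?tensr_star. Qed.

Let comm a b : smul (tensl_lin a) (tensr_lin b) = smul (tensr_lin b) (tensl_lin a).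
Proof. exact: tensC. Qed.

Definition tens_rep := tlift_lin tensl_lin tensr_lin.

Lemma tens_rep_hom : star_hom tens_rep. Proof. exact: tlift_hom tensl_hom tensr_hom comm. Qed.

Lemma tens_repE a b : tens_rep (pure a b) = smul (tensl K (sigma a)) (tensr L b).
Proof. exact: tliftE. Qed.

(** If b is not 0, some matrix coefficient of b does not vanish, and pairing
    with it expresses a through the other first components; this shortens a
    tensor that acts as 0. *)
Lemma tens_rep_inj : injective tens_rep.
Proof.
suff ker s : tens_rep (tens_of s) = 0 -> tens_of s = 0.
  move=> x y xy; apply/eqP; rewrite -subr_eq0; apply/eqP.
  have : tens_rep (x - y) = 0 by rewrite linearB xy subrr.
  by elim/tens_of_ind : (x - y) => s; exact: ker.
have [n] := ubnP (size s); elim: n s => // n IH [|[a b] s] sn h0.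
  exact: tens_of_0.
have [b0|bN] := pselect (b = 0).
  have e : tens_of ((a, b) :: s) = tens_of s.
    by rewrite -[_ :: s]/([:: (a, b)] ++ s) tens_of_D b0 -/(pure a 0) pure0r add0r.
  by move: h0; rewrite e => /IH; apply.
have [k [k' bk]] : exists k k', dot (b k) k' != 0.
  apply: contrapT => hn; apply: bN; apply: bopP => k; apply: dot_injl => k'.
  apply: contrapT => hk; apply: hn; exists k, k'; apply/eqP => h; apply: hk.
  by rewrite h -[(0 : bop K) k]/(0 : K) dot0l.
pose g (p : D * bop K) := dot (p.2 k) k' / dot (b k) k'.
have aE : a = - \sum_(p <- s) g p *: p.1.
  apply/eqP; rewrite -subr_eq0 opprK; apply/eqP/isigma; apply: bopP => l.
  apply: dot_injl => l'; rewrite -[(0 : bop L) l]/(0 : L) dot0l.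
  have : dot (tens_rep (tens_of ((a, b) :: s)) (tel l k)) (tel l' k') = 0.
    by rewrite h0 -[(0 : bop _) _]/(0 : htens L K) dot0l.
  rewrite tens_of_sum linear_sum bop_sumE dot_suml big_cons.
  have coef (p : D * bop K) : dot (tens_rep (pure p.1 p.2) (tel l k)) (tel l' k') =
      dot (sigma p.1 l) l' * dot (p.2 k) k'.
    by rewrite tens_repE /= tensrE tenslE dot_tel.
  rewrite coef (eq_bigr _ (fun p _ => coef p)) /= => h.
  rewrite linearD linear_sum bopDE bop_sumE dotDl dot_suml.
  apply: (mulfI bk); rewrite mulr0 -[RHS]h mulrDr mulrC; congr (_ + _).
  rewrite mulr_sumr; apply: eq_bigr => p _; rewrite linearZ bopZE dotZl /g.
  by rewrite mulrA mulrCA divff// mulr1 mulrC.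
pose s' := [seq (p.1, p.2 - g p *: b) | p <- s].
have e : tens_of ((a, b) :: s) = tens_of s'.
  rewrite !tens_of_sum big_cons big_map aE /=.
  rewrite -[- _]scaleN1r pureZl pure_suml scaler_sumr -big_split; apply: eq_bigr => p _ /=.
  by rewrite pureDr -scaleNr pureZr pureZl scalerA mulN1r addrC.
move: h0; rewrite e => /IH; apply.
by rewrite size_map.
Qed.

End FaithfulTensor.

Section DenseExtension.
Variables (R : realType) (T : starAlgType R) (D : cstarAlgType R) (L : hilbertType R).
Variables (j : {linear T -> D}) (V : {linear T -> bop L}).
Hypotheses (hj : star_hom j) (jd : dense (range j)) (hV : star_hom V).
Hypothesis Vj : forall x, opnorm (V x) <= rnorm (j x).
Implicit Types (d : D) (S : bop L).

Let approx d e : 0 < e -> exists x, rnorm (j x - d) <= e.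
Proof.
move=> e0; have [] := jd (O := interior (ball d e%:C)).
- by exists d; apply: nbhsx_ballx; rewrite ltcR.
- exact: open_interior.
move=> y [/interior_subset yb [x _ xE]]; exists x; move: yb.
by rewrite -xE -ball_normE /= rnormE ltcR rdistC => /ltW.
Qed.

Let ext d S := forall e : R, 0 < e -> exists x, rnorm (j x - d) <= e /\ rnorm (V x - S) <= e.

Let Vdist x y : rnorm (V x - V y) <= rnorm (j x - j y).
Proof. by rewrite -!linearB rnorm_bop. Qed.

Let ext_exists d : exists S, ext d S.
Proof.
have p0 n : 0 < (n.+1%:R^-1 : R) by rewrite invr_gt0.
have /choice[x xP] n := approx d (p0 n).
have [|S SP] := @rcauchy_lim R (bop L) (fun n => V (x n)).
  move=> e e0; have [N NP] := natSinv_small (divr_gt0 e0 (ltr0Sn R 1)).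
  exists N => m k Nm Nk; rewrite (le_trans (Vdist _ _))//.
  rewrite (le_trans (rdistD d _ _))// [leRHS]splitr lerD//.
    by rewrite (le_trans (xP m))// ltW// NP.
  by rewrite rdistC (le_trans (xP k))// ltW// NP.
exists S => e e0; have [N NP] := natSinv_small e0; have [M MP] := SP e e0.
exists (x (maxn N M)); split; last exact: MP (leq_maxr _ _).
by rewrite (le_trans (xP _))// ltW// NP// leq_maxl.
Qed.

Let ext_uniq d S S' : ext d S -> ext d S' -> S = S'.
Proof.
move=> h h'; apply: rnorm_small => e e0.
have e4 : 0 < e / 4 by rewrite divr_gt0.
have [x [x1 x2]] := h _ e4; have [y [y1 y2]] := h' _ e4.
have := rdistD (V x) S S'; have := rdistD (V y) (V x) S'; have := Vdist x y.
have := rdistD d (j x) (j y); rewrite (rdistC S (V x)) (rdistC d (j y)); lra.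
Qed.

Let ext_j x : ext (j x) (V x).
Proof. by move=> e e0; exists x; rewrite !subrr !rnorm0 ltW. Qed.

Let ext_lin (c : R[i]) d d' S S' : ext d S -> ext d' S' ->
  ext (c *: d + d') (c *: S + S').
Proof.
move=> h h' e e0; pose C := complex.Re `|c| + 1.
have C0 : 0 < C by rewrite ltr_wpDl ?cnorm_ge0.
have e1 : 0 < e / 2 / C by rewrite !divr_gt0.
have e2 : 0 < e / 2 by rewrite divr_gt0.
have [x [x1 x2]] := h _ e1; have [y [y1 y2]] := h' _ e2.
have bnd (r : R) : 0 <= r -> r <= e / 2 / C -> complex.Re `|c| * r <= e / 2.
  move=> r0; rewrite ler_pdivlMr// mulrC /C mulrDl mul1r; lra.
exists (c *: x + y); rewrite (linearP j) (linearP V) !opprD.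
split; rewrite addrACA -scalerBr (le_trans (rnormD _ _))// [leRHS]splitr lerD// rnormZ;
  by apply: bnd; rewrite ?rnorm_ge0.
Qed.

Let ext_mul d d' S S' : ext d S -> ext d' S' -> ext (smul d d') (smul S S').
Proof.
move=> h h' e e0.
pose C := rnorm d + rnorm d' + rnorm S + rnorm S' + 1.
have n1 := rnorm_ge0 d; have n2 := rnorm_ge0 d'.
have n3 := rnorm_ge0 S; have n4 := rnorm_ge0 S'.
have C0 : 0 < C by rewrite ltr_wpDl ?addr_ge0.
pose q := Num.min 1 (e / 2 / C).
have q0 : 0 < q by rewrite lt_min ltr01 !divr_gt0.
have q1 : q <= 1 by rewrite ge_min lexx.
have qC : q * C <= e / 2 by rewrite -ler_pdivlMr// ge_min lexx orbT.
have est (E : cstarAlgType R) (u v a b : E) : rnorm (u - a) <= q ->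
    rnorm (v - b) <= q -> rnorm a + rnorm b + 1 <= C ->
    rnorm (smul u v - smul a b) <= e.
  move=> uq vq abC.
  have -> : smul u v - smul a b = smul (u - a) v + smul a (v - b).
    by rewrite smulBl smulBr; abel.
  rewrite (le_trans (rnormD _ _))//.
  have := rnorm_smul (u - a) v; have := rnorm_smul a (v - b).
  have := rnormD b (v - b); rewrite addrC subrK.
  have := rnorm_ge0 (u - a); have := rnorm_ge0 (v - b); have := rnorm_ge0 a.
  have := rnorm_ge0 b; have := rnorm_ge0 v; nra.
have [x [x1 x2]] := h _ q0; have [y [y1 y2]] := h' _ q0.
exists (smul x y); rewrite hj.1 hV.1; split.
  by apply: est => //; rewrite /C; lra.
by apply: (est (bop L)) => //; rewrite /C; lra.
Qed.

Let ext_star d S : ext d S -> ext (star d) (star S).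
Proof.
move=> h e e0; have [x [x1 x2]] := h e e0; exists (star x).
rewrite hj.2 hV.2 -!starB rnorm_star; split=> //.
by rewrite (@rnorm_star R (bop L)).
Qed.

Let ext_commute d S S' : ext d S -> (forall x, smul (V x) S' = smul S' (V x)) ->
  smul S S' = smul S' S.
Proof.
move=> h VS; apply: rnorm_small => e e0; pose C := 2 * rnorm S' + 1.
have C0 : 0 < C by rewrite ltr_wpDl ?mulr_ge0 ?rnorm_ge0.
have [x [_ xS]] := h _ (divr_gt0 e0 C0).
have -> : smul S S' - smul S' S = smul S' (V x - S) - smul (V x - S) S'.
  by rewrite smulBl smulBr VS; abel.
have := rnormD (smul S' (V x - S)) (- smul (V x - S) S'); rewrite rnormN.
have := rnorm_smul S' (V x - S); have := rnorm_smul (V x - S) S'.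
move: xS; rewrite ler_pdivlMr// /C; have := rnorm_ge0 (V x - S); nra.
Qed.

(** Both the relations and the commutant pass to the limit. *)
Theorem dense_extension : exists V' : {linear D -> bop L},
  [/\ star_hom V', forall x, V' (j x) = V x &
   forall S, (forall x, smul (V x) S = smul S (V x)) ->
     forall d, smul (V' d) S = smul S (V' d)].
Proof.
have /choice[F FP] := ext_exists.
have Fe d S : ext d S -> F d = S by exact: ext_uniq (FP d).
have lF : linear F by move=> c d d'; apply: Fe; exact: ext_lin.
pose V' : {linear D -> bop L} := HB.pack F
  (GRing.isLinear.Build R[i] D (bop L) *:%R F lF).
exists V'; split; first split=> [d d'|d].
- by apply: Fe; exact: ext_mul.
- by apply: Fe; exact: ext_star.
- by move=> x; apply: Fe; exact: ext_j.
- by move=> S VS d; exact: ext_commute (FP d) VS.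
Qed.

End DenseExtension.

(** * Inner actions, Fell absorption and the reduced norm *)

Section Translations.
Variables (R : realType) (G : groupType) (H : hilbertType R).
Implicit Types (s t : G) (h : H).

Let idop_subproof : (@id H) \in @bounded_op R H.
Proof. by apply/asboolP; split=> //; exists 1 => x; rewrite mul1r. Qed.

Let idop : bop H := Bop idop_subproof.

Let idop_le t h : rnorm (idop h) <= 1 * rnorm h.
Proof. by rewrite mul1r. Qed.

Definition lam s : bop (hl2 G H) := lop (@mulgI G s) ler01 idop_le.

Lemma lamE s t h : lam s (lel t h) = lel (s * t)%g h.
Proof. exact: lopE. Qed.

Lemma lamM s t : smul (lam s) (lam t) = lam (s * t)%g.
Proof. by apply: (bop_total_eq (@lel_total R G H)) => -[r h] /=; rewrite !lamE mulgA. Qed.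

Lemma lam_star s : star (lam s) = lam s^-1%g.
Proof.
apply: (bop_total_adj (@lel_total R G H)) => -[t h] [r k]; rewrite !lamE !dot_lel /=.
congr (if _ then _ else _).
by apply: asbool_equiv_eq; split=> [<-|->]; rewrite ?mulKg ?mulVKg.
Qed.

Lemma lam1 v : lam 1%g v = v.
Proof.
apply: (total_inj (@lel_total R G H)) => -[t h].
by rewrite adjP -[adj _]/(star (lam 1)) lam_star lamE invg1 mul1g.
Qed.

Lemma lam1l (T : bop (hl2 G H)) : smul (lam 1%g) T = T.
Proof. by apply: bopP => v; exact: lam1. Qed.

Lemma lam1r (T : bop (hl2 G H)) : smul T (lam 1%g) = T.
Proof. by apply: bopP => v /=; rewrite lam1. Qed.

Lemma lamVK s (T : bop (hl2 G H)) : smul (lam s^-1%g) (smul (lam s) T) = T.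
Proof. by rewrite smulA lamM mulVg lam1l. Qed.

(** All bounded operators on l^2(G, H), with G acting by conjugation with the
    translations: an inner action, so that its covariant representations split
    into two commuting parts. *)
Definition adbop : Type := bop (hl2 G H).

HB.instance Definition _ := CStarAlgebra.on adbop.

Implicit Types (b : adbop).

Let adact s b : adbop := smul (smul (lam s) b) (lam s^-1%g).

Let adact1 b : adact 1%g b = b.
Proof. by rewrite /adact invg1 lam1l lam1r. Qed.

Let adactM s t b : adact (s * t)%g b = adact s (adact t b).
Proof. by rewrite /adact invgM -!lamM !smulA. Qed.

Let adactD s : {morph adact s : b b' / b + b'}.
Proof. by move=> b b'; rewrite /adact smulDr smulDl. Qed.

Let adactZ s (c : R[i]) b : adact s (c *: b) = c *: adact s b.
Proof. by rewrite /adact smulZr smulZl. Qed.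

Let adact_smul s b b' : adact s (smul b b') = smul (adact s b) (adact s b').
Proof. by rewrite /adact -!smulA lamVK. Qed.

Let adact_star s b : adact s (star b) = star (adact s b).
Proof. by rewrite /adact !starM !lam_star invgK smulA. Qed.

HB.instance Definition _ := @StarAlgebra_hasAction.Build G R adbop
  adact adact1 adactM adactD adactZ adact_smul adact_star.

Lemma adactE s b : act s b = smul (smul (lam s) b) (lam s^-1%g) :> adbop.
Proof. by []. Qed.

End Translations.

Section RegularEmbedding.
Variables (R : realType) (G : groupType) (A : gCstarAlgType G R).
Variables (H : hilbertType R) (pi : {linear A -> bop H}).
Hypotheses (hpi : star_hom pi) (ipi : forall a, pi a = 0 -> a = 0).

Let lE : linear (regop hpi 1%g : A -> adbop G H).
Proof. exact: regop_linear. Qed.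

Definition regemb : {linear A -> adbop G H} := HB.pack (regop hpi 1%g : A -> adbop G H)
  (GRing.isLinear.Build R[i] A (adbop G H) *:%R (regop hpi 1%g : A -> adbop G H) lE).

Lemma regop_lam s a : regop hpi s a = smul (regop hpi 1%g a) (lam H s).
Proof.
by apply: (bop_total_eq (@lel_total R G H)) => -[t h] /=; rewrite lamE !regopE mul1g.
Qed.

Lemma regemb_embedding : equivariant_embedding regemb.
Proof.
split.
- split=> [a b|a] /=.
    by have := regopM hpi 1%g 1%g a b; rewrite mulg1 act1 => /esym.
  by have := regop_star hpi 1%g a; rewrite invg1 act1 => /esym.
- suff ker a : regemb a = 0 -> a = 0.
    move=> a b ab; apply/eqP; rewrite -subr_eq0; apply/eqP/ker.
    by rewrite linearB ab subrr.
  move=> a0; apply: ipi; apply: bopP => h; apply: dot_injl => k.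
  have := dot_lel (1%g : G) (1%g : G) (pi a h) k; rewrite asboolT// => <-.
  have := regopE hpi 1%g a 1%g h; rewrite mul1g invg1 act1 => <-.
  rewrite -[regop hpi 1%g a]/(regemb a : bop (hl2 G H)) a0.
  by rewrite -[(0 : adbop G H) _]/(0 : hl2 G H) -[(0 : bop H) h]/(0 : H) !dot0l.
- move=> g a; rewrite adactE; apply: (bop_total_eq (@lel_total R G H)) => -[t h] /=.
  rewrite lamE !regopE lamE !mul1g mulVKg -actM.
  by rewrite invgM invgK.
Qed.

End RegularEmbedding.

Section FellAbsorption.
Variables (R : realType) (G : groupType) (L H : hilbertType R).
Let K := hl2 G H.

Let e (p : L * (G * H)) : htens L K := tel p.1 (lel p.2.1 p.2.2).

Let e_total : total_family e.
Proof. exact: tel_total (@lel_total R G H). Qed.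

Section Controlled.
Variable w : G -> bop L.
Hypothesis w1 : forall t l, rnorm (w t l) <= 1 * rnorm l.

Let ctl_bound : psd (fun p q => (1 ^+ 2)%:C * dot (e p) (e q) -
  dot (tel (w p.2.1 p.1) (lel p.2.1 p.2.2) : htens L K)
      (tel (w q.2.1 q.1) (lel q.2.1 q.2.2))).
Proof.
have h t : psd (fun x y : L * H =>
    ((1 ^+ 2)%:C * dot x.1 y.1 - dot (w t x.1) (w t y.1)) * dot x.2 y.2).
  exact: psd_schur (psd_bop _ (w1 t) ler01).
have := psd_comp (fun p : L * (G * H) => (p.2.1, (p.1, p.2.2))) (psd_dsum h).
apply: psd_ext => -[l [t k]] [l' [t' k']] /=.
rewrite !dot_tel !dot_lel /=; case: asboolP => [->|_].
  by rewrite mulrBl mulrA.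
by rewrite !mulr0 subrr.
Qed.

(** A block diagonal operator on L (x) l^2(G, H), the sum of the w t (x) e_tt. *)
Definition ctl : bop (htens L K) := bop_ext ler01 ctl_bound.

Lemma ctlE l t h : ctl (tel l (lel t h)) = tel (w t l) (lel t h).
Proof. exact: (bop_extE ler01 ctl_bound (l, (t, h))). Qed.

Lemma ctl_le v : rnorm (ctl v) <= rnorm v.
Proof. by rewrite -[leRHS]mul1r; exact: bop_ext_le. Qed.

End Controlled.

Variables (A : gCstarAlgType G R) (pi : {linear A -> bop H}) (hpi : star_hom pi).
Variable u : G -> bop L.
Hypotheses (uM : forall s t, smul (u s) (u t) = u (s * t)%g)
  (uS : forall s, star (u s) = u s^-1%g).

Let u1 s l : rnorm (u s l) <= 1 * rnorm l.
Proof.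
apply: le_trans (opnormP _ _) _; rewrite ler_wpM2r ?rnorm_ge0//.
have n1 t : opnorm (u t) ^+ 2 = opnorm (u 1%g).
  by rewrite -opnorm_star_mul uS uM mulVg.
have : opnorm (u 1%g) <= 1.
  have := n1 1%g; have := opnorm_ge0 (u 1%g); nra.
have := n1 s; have := opnorm_ge0 (u s); nra.
Qed.

(** Fell's absorption principle. Conjugation with the block diagonal operator
    of the u t turns the operators 1 (x) regop s a into u s (x) regop s a; the
    family u may be degenerate, so that this operator is only a partial
    isometry, which is enough for an upper bound. *)
Theorem fell_absorption (f : Cc A) (r : seq G) : uniq r ->
  (forall t, f t != 0 -> t \in r) ->
  opnorm (\sum_(s <- r) smul (tensl K (u s)) (tensr L (regop hpi s (f s)))) <=
  opnorm (regrep hpi f).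
Proof.
move=> ur fr.
pose U := ctl u1; pose U' := ctl (fun t => u1 t^-1%g).
have absorb s a : smul (tensl K (u s)) (tensr L (regop hpi s a)) =
    smul U (smul (tensr L (regop hpi s a)) U').
  apply: (bop_total_eq e_total) => -[l [t h]] /=.
  rewrite /e /= tensrE tenslE ctlE tensrE regopE ctlE; congr (tel _ _).
  have := congr1 (fun T : bop L => T l) (uM (s * t)%g t^-1%g); rewrite mulgK.
  by move=> /= ->.
have -> : \sum_(s <- r) smul (tensl K (u s)) (tensr L (regop hpi s (f s))) =
    smul U (smul (tensr L (regrep hpi f)) U').
  rewrite (regrepE hpi ur fr) -[tensr L _]/((tensr_lin K L : {linear _ -> _}) _) linear_sum.
  rewrite smul_suml smul_sumr; apply: eq_bigr => s _; exact: absorb.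
apply: opnorm_le => [|v]; first exact: opnorm_ge0.
rewrite /= (le_trans (ctl_le _ _))// (le_trans (tensr_le _ _))//.
by rewrite ler_wpM2l ?opnorm_ge0 ?ctl_le.
Qed.

End FellAbsorption.

Section ReducedUpperBound.
Variables (R : realType) (G : groupType) (A : gCstarAlgType G R).
Implicit Types f : Cc A.

Lemma id_embedding : equivariant_embedding (idfun : {linear A -> A}).
Proof. by split. Qed.

(** The regular operators take values in square summable functions; their norms
    are real numbers below the reduced norm. *)
Lemma reduced_le f (H : hilbertType R) (rho : {linear A -> bop H}) (xi : G -> H) :
  star_hom rho -> (l2norm xi <= 1)%E ->
  exists2 r, (r%:E = l2norm (regular_op rho f xi))%E & 0 <= r <= reduced_norm f.
Proof.
move=> hrho xi1.
have le := regular_op_le id_embedding f; have ge0 (zeta : G -> H) : (0 <= l2norm zeta)%E by exact: sqrte_ge0.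
have fin : l2norm (regular_op rho f xi) \is a fin_num.
  rewrite ge0_fin_numE ?ge0//; apply: le_lt_trans (le _ _ _ hrho xi1) _.
  exact: ltry.
exists (fine (l2norm (regular_op rho f xi))); first by rewrite fineK.
apply/andP; split; first by rewrite fine_ge0.
apply: ub_le_sup; last by exists H, rho, xi; split=> //; rewrite fineK.
exists (max_norm (Cc_map (idfun : {linear A -> A}) f)).
move=> r [H' [rho' [xi' [h' x' rE]]]].
by rewrite -lee_fin rE; exact: le.
Qed.

Variables (H : hilbertType R) (pi : {linear A -> bop H}) (hpi : star_hom pi).

Let l2vec (F : seq G) (xi : G -> H) : hl2 G H := \sum_(t <- F) lel t (xi t).

Let rnorm_l2vec F xi : uniq F -> rnorm (l2vec F xi) ^+ 2 = \sum_(t <- F) rnorm (xi t) ^+ 2.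
Proof.
move=> uF; apply: complexI; rewrite -dotxx dot_sum_lel// RCsum.
by apply: eq_bigr => t _; rewrite dotxx.
Qed.

(* The part of the group that a finitely supported function can reach. *)
Let spread f (F : seq G) : seq G := undup [seq (q * t)%g | q <- Cc_supp f, t <- F].

Let regrep_l2vec f F xi : uniq F -> (forall t, xi t != 0 -> t \in F) ->
  regrep hpi f (l2vec F xi) = l2vec (spread f F) (regular_op pi f xi).
Proof.
move=> uF xF; apply: (total_inj (@lel_total R G H)) => -[t k] /=.
have -> : dot (l2vec (spread f F) (regular_op pi f xi)) (lel t k) =
    dot (regular_op pi f xi t) k.
  rewrite dot_suml; have [tF|tF] := boolP (t \in spread f F).
    rewrite (bigD1_seq t) ?undup_uniq//= dot_lel asboolT// big1 ?addr0// => s /eqP st.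
    by rewrite dot_lel asboolF.
  rewrite big_seq big1 => [|s sF]; last first.
    by rewrite dot_lel asboolF// => st; rewrite -st sF in tF.
  rewrite (@regular_op_matrix _ _ _ _ pi f [::])// ?big_nil ?dot0l// => q fq xq.
  have : t \in spread f F; last by rewrite (negPf tF).
  rewrite mem_undup; apply/allpairsP; exists (q, (q^-1 * t)%g).
  by split; rewrite ?mulVKg//=; [exact: Cc_suppP|exact: xF].
rewrite (@regular_op_matrix _ _ _ _ pi f F)//; last by move=> q _ /xF.
rewrite linear_sum !dot_suml; apply: eq_bigr => s _; exact: regrep_coef.
Qed.

Let unit_bound f F xi : uniq F -> (forall t, xi t != 0 -> t \in F) ->
  rnorm (l2vec F xi) <= 1 -> rnorm (regrep hpi f (l2vec F xi)) <= reduced_norm f.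
Proof.
move=> uF xF v1.
have x1 : (l2norm xi <= 1)%E.
  apply: l2norm_le => // F' uF'; rewrite expr1n.
  apply: (@le_trans _ _ (\sum_(t <- F) rnorm (xi t) ^+ 2)).
    apply: sum_le_supp => // t; first by rewrite exprn_ge0 ?rnorm_ge0.
    move=> _; apply: contraNeq; rewrite expf_eq0 /= => h; apply: xF.
    by apply: contraNneq h => ->; rewrite rnorm0.
  by rewrite -rnorm_l2vec// exprn_ile1 ?rnorm_ge0.
have [r rE /andP[r0 rN]] := reduced_le f hpi x1.
apply: le_trans rN; rewrite -(@ler_pXn2r _ 2) ?nnegrE ?rnorm_ge0//.
rewrite regrep_l2vec// rnorm_l2vec ?undup_uniq//.
by apply: l2norm_ge; rewrite ?rE ?undup_uniq.
Qed.

Lemma reduced_norm_ge0 f : 0 <= reduced_norm f.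
Proof.
have [r _ /andP[r0 rN]] := reduced_le f hpi (l2norm_zero_le1 G H).
exact: le_trans rN.
Qed.

(** It is enough to estimate the operator on finitely supported vectors, where
    it is the regular operator of the definition of the reduced norm. *)
Theorem opnorm_regrep_le f : opnorm (regrep hpi f) <= reduced_norm f.
Proof.
have N0 := reduced_norm_ge0 f.
apply: opnorm_le => //; apply: (bop_total_le (@lel_total R G H) N0).
apply/psd_subgram => s; rewrite -exprMn.
rewrite ler_pXn2r ?nnegrE ?mulr_ge0 ?rnorm_ge0//.
rewrite (rnorm_comb (regrep hpi f) (fun p : G * H => lel p.1 p.2) s) /=.
pose F := undup [seq p.2.1 | p <- s].
pose xi t := \sum_(p <- s) (if p.2.1 == t then p.1 *: p.2.2 else 0).
have uF : uniq F by exact: undup_uniq.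
have xF t : xi t != 0 -> t \in F.
  apply: contraNT => tF; rewrite /xi big_seq big1// => p ps.
  case: eqP => // pt; move: tF; rewrite mem_undup => /negP[].
  by apply/mapP; exists p.
have -> : \sum_(p <- s) p.1 *: lel p.2.1 p.2.2 = l2vec F xi.
  rewrite /l2vec (eq_bigr _ (fun t _ => lel_sum _ _ _ _)) exchange_big /=.
  rewrite big_seq [RHS]big_seq; apply: eq_bigr => p ps.
  have pF : p.2.1 \in F by rewrite mem_undup; apply/mapP; exists p.
  rewrite (bigD1_seq p.2.1)//= eqxx lelZ big1 ?addr0// => t /negPf.
  by rewrite eq_sym => ->; rewrite lel0.
set c := rnorm (l2vec F xi).
have [c0|cN] := eqVneq c 0.
  by rewrite (rnorm_eq0 c0) linear0 rnorm0 mulr_ge0 ?rnorm_ge0.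
have cp : 0 < c by rewrite lt_neqAle eq_sym cN rnorm_ge0.
have sc : l2vec F (fun t => c^-1%:C *: xi t) = c^-1%:C *: l2vec F xi.
  by rewrite /l2vec scaler_sumr; apply: eq_bigr => t _; rewrite lelZ.
have := @unit_bound f F (fun t => c^-1%:C *: xi t) uF.
rewrite sc linearZ !rnormZr ger0_norm ?invr_ge0 ?(ltW cp)// -/c mulVf// => h.
rewrite mulrC -ler_pdivrMl//; apply: h => // t.
by rewrite scaler_eq0 negb_or => /andP[_ /xF].
Qed.

End ReducedUpperBound.

(** * Representations of the crossed product by an inner action *)

Section CovariantSplitting.
Variables (R : realType) (G : groupType) (H L : hilbertType R).
Let K := hl2 G H.
Let B : gCstarAlgType G R := adbop G H.

Let cancel_fun (x : group_algebra R G) (g : G) : B := (x g : R[i]) *: (lam H g^-1%g : B).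

Let cancel_subproof x : cancel_fun x \in @finsupp R G B.
Proof.
apply/asboolP; apply: sub_finite_set (Cc_finsupp x) => t /=.
by apply: contra_neq => e; rewrite /cancel_fun e scale0r.
Qed.

Let cancel (x : group_algebra R G) : Cc B := MkCc (cancel_subproof x).

Let cancel_linear : linear cancel.
Proof.
move=> c x y; apply: CcP => t; rewrite CcDE CcZE.
rewrite -[LHS]/(((c *: x + y) t : R[i]) *: (lam H t^-1%g : B)).
by rewrite CcDE CcZE scalerDl scalerA.
Qed.

(** In the crossed product of an inner action, the product of delta_g with the
    inverse of the unitary that implements g commutes with the coefficients;
    these products form a copy of the group algebra. *)
Definition cancel_lin : {linear group_algebra R G -> Cc B} := HB.pack cancel
  (GRing.isLinear.Build R[i] (group_algebra R G) (Cc B) *:%R cancel cancel_linear).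

Lemma cancel1 s (c : R[i]) :
  cancel_lin (Cc1 s c) = Cc1 s (c *: (lam H s^-1%g : B)).
Proof.
apply: CcP => t; rewrite -[LHS]/((Cc1 s c t : R[i]) *: (lam H t^-1%g : B)) !Cc1E.
by case: eqP => [->//|_]; rewrite scale0r.
Qed.

Lemma cancel_hom : star_hom cancel_lin.
Proof.
split=> x; last first.
  elim/Cc_indP : x => [|x y IHx IHy|s c].
  - by rewrite star0 linear0 star0.
  - by rewrite starD !linearD starD IHx IHy.
  - rewrite Cc1_star !cancel1 Cc1_star adactE starZ; congr (Cc1 _ _).
    rewrite smulZr smulZl invgK; congr (_ *: _).
    by rewrite lam_star invgK -smulA lamVK.
elim/Cc_indP : x => [|x z IHx IHz|s c] y.
- by rewrite smul0l linear0 smul0l.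
- by rewrite smulDl !linearD smulDl IHx IHz.
elim/Cc_indP : y => [|x z IHx IHz|t d].
- by rewrite smul0r linear0 smul0r.
- by rewrite smulDr !linearD smulDr IHx IHz.
- rewrite Cc1M !cancel1 Cc1M adactE; congr (Cc1 _ _).
  rewrite smulZl !smulZr smulZl smulZr scalerA; congr (_ *: _).
  by rewrite -smulA lamVK lamM invgM.
Qed.

Variable Th : {linear Cc B -> bop L}.
Hypothesis hTh : star_hom Th.

Let lV : linear (Th \o cancel_lin).
Proof. by move=> c x y; rewrite -[LHS]/(Th (cancel (c *: x + y))) cancel_linear linearP. Qed.

Definition grp_part : {linear group_algebra R G -> bop L} := HB.pack (Th \o cancel_lin)
  (GRing.isLinear.Build R[i] (group_algebra R G) (bop L) *:%R (Th \o cancel_lin) lV).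

Lemma grp_part_hom : star_hom grp_part.
Proof.
split=> [x y|x]; rewrite -[LHS]/(Th (cancel_lin _)).
  by rewrite cancel_hom.1 hTh.1.
by rewrite cancel_hom.2 hTh.2.
Qed.

Let lW : linear (Th \o @Cc1 R G B 1%g : bop K -> bop L).
Proof.
move=> c x y; rewrite -[LHS]/(Th (Cc1 1%g (c *: (x : B) + y))) Cc1_lin.
exact: linearP.
Qed.

Definition coef_part : {linear bop K -> bop L} :=
  HB.pack (Th \o @Cc1 R G B 1%g : bop K -> bop L)
  (GRing.isLinear.Build R[i] (bop K) (bop L) *:%R (Th \o @Cc1 R G B 1%g : bop K -> bop L) lW).

Lemma coef_partE (b : B) : coef_part b = Th (Cc1 1%g b).
Proof. by []. Qed.

Lemma coef_part_hom : star_hom coef_part.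
Proof.
split=> [x y|x].
  by rewrite !coef_partE -hTh.1 Cc1M mulg1 act1.
by rewrite !coef_partE -hTh.2 Cc1_star invg1 act1.
Qed.

Lemma parts_commute (x : group_algebra R G) (b : B) :
  smul (grp_part x) (coef_part b) = smul (coef_part b) (grp_part x).
Proof.
elim/Cc_indP : x => [|x y IHx IHy|s c].
- by rewrite linear0 smul0l smul0r.
- by rewrite linearD smulDl smulDr IHx IHy.
rewrite -[grp_part _]/(Th (cancel_lin _)) coef_partE -!hTh.1 cancel1 !Cc1M adactE.
rewrite mulg1 mul1g act1 smulZl smulZr; congr (Th (Cc1 _ (_ *: _))).
by rewrite -smulA lamVK.
Qed.

Lemma parts_product (s : G) (b : B) :
  smul (grp_part (Cc1 s (1 : R[i]))) (coef_part (smul b (lam H s : B))) = Th (Cc1 s b).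
Proof.
rewrite -[grp_part _]/(Th (cancel_lin _)) coef_partE -hTh.1 cancel1 scale1r Cc1M adactE mulg1.
congr (Th (Cc1 _ _)); rewrite -!smulA lamM mulgV lam1r.
exact: lamVK.
Qed.

End CovariantSplitting.

Section MaximalUpperBound.
Variables (R : realType) (G : groupType) (D : cstarAlgType R).
Variable j : {linear group_algebra R G -> D}.
Hypotheses (jmax : is_max_group_cstar j) (Dllp : LLP D).
Variables (A : gCstarAlgType G R) (H : hilbertType R) (pi : {linear A -> bop H}).
Hypothesis hpi : star_hom pi.

(** A representation of the crossed product by the inner action splits into
    commuting representations of the group and of all bounded operators; the
    local lifting property bounds it by the spatial tensor product, where the
    element becomes an absorbed regular representation. *)
Theorem crossed_le_regrep (f : Cc A) (L : hilbertType R)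
    (Th : {linear Cc (adbop G H) -> bop L}) : star_hom Th ->
  opnorm (Th (Cc_map (regemb hpi) f)) <= opnorm (regrep hpi f).
Proof.
move=> hTh; have [hj jN jd] := jmax.
have [V [hV Vj Vc]] : exists V : {linear D -> bop L},
  [/\ star_hom V, forall x, V (j x) = grp_part Th x &
   forall S, (forall x, smul (grp_part Th x) S = smul S (grp_part Th x)) ->
     forall d, smul (V d) S = smul S (V d)].
  apply: dense_extension => //; first exact: grp_part_hom.
  by move=> x; rewrite jN; exact: max_norm_group (grp_part_hom hTh).
have hW := coef_part_hom hTh.
have VW d b : smul (V d) (coef_part Th b) = smul (coef_part Th b) (V d).
  by apply: Vc => x; exact: parts_commute.
have [M [sigma [hs sN]]] := gelfand_naimark D.
have isigma d : sigma d = 0 -> d = 0.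
  by move=> d0; apply: rnorm_eq0; rewrite -sN d0 opnorm0.
(* The factor lam s of regop s (f s) = iota(f s) lam s cancels the inverse
   translation that the group part of Th carries. *)
pose y : tensor D (bop (hl2 G H)) :=
  \sum_(s <- Cc_supp f) pure (j (Cc1 s (1 : R[i]))) (regop hpi s (f s)).
have uf := Cc_supp_uniq f; have sf := @Cc_suppP _ _ _ f.
have yT : tlift_lin V (coef_part Th) y = Th (Cc_map (regemb hpi) f).
  rewrite (@Cc_decomp _ _ _ (Cc_map (regemb hpi) f) (Cc_supp f))//; last first.
    move=> t ft; apply: sf; apply: contra_neq ft => f0.
    by rewrite -[LHS]/(regemb hpi (f t)) f0 linear0.
  rewrite !linear_sum; apply: eq_bigr => s _.
  by rewrite /= tliftE Vj regop_lam; exact: parts_product.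
rewrite -yT; apply: le_trans (LLP_le y Dllp (tens_rep_hom (hl2 G H) hs)
  (tens_rep_inj isigma) (tlift_hom hV hW VW)) _.
rewrite linear_sum (eq_bigr _ (fun s _ => tens_repE sigma _ _)).
apply: (fell_absorption hpi (u := fun s => sigma (j (Cc1 s (1 : R[i]))))) => // [s t|s].
  rewrite -hs.1 -hj.1 Cc1M; congr (sigma (j (Cc1 _ _))).
  exact: mulr1.
rewrite -hs.2 -hj.2 Cc1_star; congr (sigma (j (Cc1 _ _))).
exact: conjC1.
Qed.

End MaximalUpperBound.

(** * The injective norm is the reduced norm *)

Theorem proposition4p4 (R : realType) (G : groupType)
    (D : cstarAlgType R) (j : {linear group_algebra R G -> D})
    (D_is_Cmax : is_max_group_cstar j) (D_llp : LLP D)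
    (A : gCstarAlgType G R) (f : Cc A) :
  inj_norm f = reduced_norm f.
Proof.
have [H [pi [hpi piN]]] := gelfand_naimark A.
have ipi a : pi a = 0 -> a = 0.
  by move=> a0; apply: rnorm_eq0; rewrite -piN a0 opnorm0.
have lower (B : gCstarAlgType G R) (iota : {linear A -> B}) :
    equivariant_embedding iota -> reduced_norm f <= max_norm (Cc_map iota f).
  move=> emb; apply: ge_sup.
    have [r rE _] := reduced_le f hpi (l2norm_zero_le1 G H).
    by exists r, H, pi, (fun=> 0); split=> //; exact: l2norm_zero_le1.
  move=> r [H' [rho [xi [hrho xi1 rE]]]]; rewrite -lee_fin rE.
  exact: regular_op_le.
apply/eqP; rewrite eq_le; apply/andP; split; last first.
  apply: lb_le_inf.
    by exists (max_norm (Cc_map (idfun : {linear A -> A}) f)), A, idfun; split=> //; exact: id_embedding.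
  by move=> r [B [iota [emb ->]]]; exact: lower.
apply: (@le_trans _ _ (max_norm (Cc_map (regemb hpi) f))).
  apply: ge_inf; first by exists (reduced_norm f) => r [B [iota [emb ->]]]; exact: lower.
  by exists (adbop G H), (regemb hpi); split=> //; exact: regemb_embedding.
have [L [rho [hrho _]]] := gelfand_naimark (adbop G H).
apply: ge_sup.
  by exists (opnorm (regrep_lin hrho (Cc_map (regemb hpi) f))), (hl2 G L), (regrep_lin hrho); split=> //; exact: regrep_hom.
move=> r [L' [Th [hTh ->]]].
apply: le_trans (crossed_le_regrep D_is_Cmax D_llp hpi f hTh) _.
exact: opnorm_regrep_le.
Qed.
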